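(* Let $r\in\mathbb{N}_{\ge 1}$ and let $M=(M_p)_{p\in\mathbb{N}}$, $N=(N_p)_{p\in\mathbb{N}}$ be sequences of positive real numbers such that $M,N\in\mathcal{LC}$, $\lim_{p\to\infty}\left(\frac{(M_p)^{1/r}}{p!}\right)^{1/p}=\infty$, and there is a constant $C\ge 1$ with $M_p\le C^pN_p$ for all $p\in\mathbb{N}$. Then $$\Lambda_{(M)}\subseteq\{(f^{(rj)}(0))_{j\in\mathbb{N}}:\ f\in\mathcal{D}_{r,(N)}([-1,1])\}$$ if and only if condition $(M,N)_{SV_r}$ holds.
   Context: $\mathbb{N}=\{0,1,2,\dots\}$, $\mathbb{N}_{>0}=\{1,2,\dots\}$. For sequences $M,N$ of positive reals put $\mu_p=M_p/M_{p-1}$, $\nu_p=N_p/N_{p-1}$ for $p\ge1$, $\mu_0=\nu_0=1$. $\mathcal{LC}$ is the set of all positive sequences $M$ that are normalized ($1=M_0\le M_1$), log-convex ($M_j^2\le M_{j-1}M_{j+1}$ for all $j\ge 1$), and satisfy $\lim_{k\to\infty}(M_k)^{1/k}=\infty$. For $p,s\in\mathbb{N}_{>0}$ let $\lambda^{M,N}_{p,s}:=\sup_{0\le j<p}\left(\frac{M_p}{s^pN_j}\right)^{1/(p-j)}$. Condition $(M,N)_{SV_r}$ means: there exists $s\in\mathbb{N}_{>0}$ such that $\sup_{p\in\mathbb{N}_{>0}}\frac{(\lambda^{M,N}_{p,s})^{1/r}}{p}\sum_{k\ge p}\left(\frac{1}{\nu_k}\right)^{1/r}<\infty$ (in particular the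 series converges). $\Lambda_{(M)}$ is the set of all complex sequences $(a_p)_{p\in\mathbb{N}}$ such that for every $h>0$ one has $\sup_{p\in\mathbb{N}}\frac{|a_p|}{h^pM_p}<\infty$. $\mathcal{D}_{r,(N)}([-1,1])$ is the set of all $\mathcal{C}^\infty$ functions $f:\mathbb{R}\to\mathbb{C}$ with support in $[-1,1]$, with $f^{(rn+j)}(0)=0$ for all $n\in\mathbb{N}$ and $j\in\{1,\dots,r-1\}$, and such that for every $h>0$ one has $\sup_{n\in\mathbb{N},x\in\mathbb{R}}\frac{|f^{(rn)}(x)|}{h^nN_n}<\infty$. *)

(* Defs.v *)
(* Stdlib reals with Coquelicot. *)
From Stdlib Require Import Reals Rtopology.
From Coquelicot Require Import Coquelicot.
Open Scope R_scope.

(** * Weight sequences *)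

(* [mu_p = M_p / M_(p-1)] for [p >= 1], and [mu_0 = 1]. *)
Definition quotients (M : nat -> R) (p : nat) : R :=
  match p with
  | O => 1
  | S q => M (S q) / M q
  end.

(* Roots and real powers are written with [Rpower], which is the usual power
   for a positive base; every base below is positive when [M] and [N] are.
   In limits along [nat], the junk value of the [1/0]-th root is irrelevant. *)

Definition positive_seq (M : nat -> R) : Prop := forall p, 0 < M p.

Definition log_convex (M : nat -> R) : Prop :=
  forall j, (1 <= j)%nat -> M j ^ 2 <= M (j - 1)%nat * M (j + 1)%nat.

Definition LC (M : nat -> R) : Prop :=
  positive_seq M /\
  M 0%nat = 1 /\ 1 <= M 1%nat /\
  log_convex M /\
  is_lim_seq (fun k => Rpower (M k) (1 / INR k)) p_infty.

(* For [p >= 1] this is the supremum of a nonempty finite set, so [Lub_Rbar]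
   is finite and its projection to [R] loses nothing. *)
Definition lambda_ps (M N : nat -> R) (p s : nat) : R :=
  real (Lub_Rbar (fun y => exists j : nat, (j < p)%nat /\
    y = Rpower (M p / (INR s ^ p * N j)) (1 / INR (p - j)))).

Definition SV (r : nat) (M N : nat -> R) : Prop :=
  exists s : nat, (1 <= s)%nat /\
    (forall p : nat, (1 <= p)%nat ->
      ex_series (fun i => Rpower (1 / quotients N (p + i)) (1 / INR r))) /\
    exists A : R, forall p : nat, (1 <= p)%nat ->
      Rpower (lambda_ps M N p s) (1 / INR r) / INR p *
      Series (fun i => Rpower (1 / quotients N (p + i)) (1 / INR r)) <= A.

Definition Lambda_Beurling (M : nat -> R) (a : nat -> C) : Prop :=
  forall h : R, 0 < h ->
    exists A : R, forall p : nat, Cmod (a p) / (h ^ p * M p) <= A.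

(** * Smooth functions from [R] to [C] *)

(* Coquelicot's [Derive] is real-valued. *)
Definition RCDerive (f : R -> C) (x : R) : C :=
  (Derive (fun t => Re (f t)) x, Derive (fun t => Im (f t)) x).

Lemma RCDerive_correct (f : R -> C) (x : R) :
  ex_derive f x -> is_derive f x (RCDerive f x).
Proof.
  intros [l Hl].
  assert (H1 : RCDerive f x = (Re l, Im l)).
  { unfold RCDerive; apply f_equal2; apply is_derive_unique.
    - apply (filterdiff_comp' f fst x (fun y : R => scal y l) fst Hl).
      apply filterdiff_linear, is_linear_fst.
    - apply (filterdiff_comp' f snd x (fun y : R => scal y l) snd Hl).
      apply filterdiff_linear, is_linear_snd. }
  rewrite H1; destruct l; exact Hl.
Qed.

Fixpoint RCDerive_n (f : R -> C) (n : nat) : R -> C :=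
  match n with
  | O => f
  | S m => RCDerive (RCDerive_n f m)
  end.

Definition smooth (f : R -> C) : Prop :=
  forall (n : nat) (x : R), ex_derive (RCDerive_n f n) x.

Definition support (f : R -> C) : R -> Prop :=
  adherence (fun x => f x <> RtoC 0).

Definition D_Beurling (r : nat) (N : nat -> R) (f : R -> C) : Prop :=
  smooth f /\
  included (support f) (fun x => -1 <= x <= 1) /\
  (forall n j : nat, (1 <= j <= r - 1)%nat ->
    RCDerive_n f (r * n + j) 0 = RtoC 0) /\
  (forall h : R, 0 < h ->
    exists A : R, forall (n : nat) (x : R),
      Cmod (RCDerive_n f (r * n) x) / (h ^ n * N n) <= A).

(* Main.v *)
Require Import Defs.
From Stdlib Require Import Reals Factorial.
From Coquelicot Require Import Coquelicot.
From Stdlib Require Import Rtopology Lra Lia Classical ClassicalEpsilon.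
Open Scope R_scope.

(** Everything reduces to real-valued functions, handled as the sequence of
    their derivatives, and [beta k = nu_k ^ (-1/r)].

    Necessity.  A Baire category argument in [Lambda_(M)] yields [K, h] and, for
    each [p], functions [f] with [|f^(rn)| <= K N_n / (h^p M_p)] whose
    derivatives at [0] are, up to an arbitrarily small error on finitely many
    orders, those of [x^(rp) / (rp)!].  By Taylor's formula at the order [rj],
    [f^(rp)] must drop from [1] below [1/2] within a distance of order
    [p / lambda_j^(1/r)], where [lambda_j] is the [j]-th term in the supremum
    [lambda_{p,s}].  As [f^(rp)] is flat at [0], Bang's proof of the
    Denjoy-Carleman theorem (with Landau's inequality for the orders not
    divisible by [r]) bounds the sum of the [beta k], [k > p], by a multiple of it;
    the first few terms are of size [beta p], and their number is controlled by
    [log (s^p N_p / M_p) <= p r (nu_p / lambda_j)^(1/r)].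

    Sufficiency.  Take [f] to be the sum of [a_p x^(rp) / (rp)! phi_p], where
    the cutoff [phi_p] is an infinite convolution of boxes: [rp] of width
    [1/l], [l = lambda_p^(1/r) / c_p], and [r] of width [c_k beta_k] for each
    [k > p].  Here [c_k] tends to infinity so slowly that [|a_p| c_p^(2rp) <= M_p]
    eventually and the tails of [c_k beta_k] stay comparable with those of
    [c_p beta_k]; then [(M,N)_SV] makes the support of [phi_p] of size [p / l],
    and the definition of [lambda_p] gives the bounds on the derivatives.
    Finitely many [p] use a fixed cutoff. *)

(** The Beurling conditions ask for every [h], and each sequence of $\Lambda_{(M)}$ comes with its
    own function; Baire's theorem is what turns this into one pair [K, h] valid for all [p]. The
    value of [h] cannot be prescribed, and the factor [s ^ p] in [lambda_ps] is what absorbs it.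
    Approximation on finitely many orders suffices because the partial sums of the series are
    bounded one at a time, each bound reading finitely many derivatives at [0]. In the converse
    direction, boxes of width [beta k] would bound the order $rn$ by $B^n N_n$ with one fixed $B$.
    Widening them by the unbounded [c k] divides this by $(c_1\cdots c_n)^r$, which beats every
    geometric factor. Of the power $c_p^{2rp}$, one half pays for passing from $\lambda_p^{1/r}$ to
    $l$ and for that product up to $p$, the other half makes the sum over [p] converge. The growth
    of $M_p^{1/r}/p!$ forces $\lambda_p^{1/r}/p\to\infty$, so that supports of size $p/l$ still fit
    into $[-1,1]$ after the division by $c_p$. *)

(** * Finite sums and products, and their grouping into blocks of length [r] *)

Fixpoint bsum (a : nat -> R) (n : nat) : R :=
  match n with O => 0 | S m => bsum a m + a m end.

Fixpoint bprod (a : nat -> R) (n : nat) : R :=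
  match n with O => 1 | S m => bprod a m * a m end.

Lemma bsum_ext a b n :
  (forall i, (i < n)%nat -> a i = b i) -> bsum a n = bsum b n.
Proof.
  induction n as [|n IH]; intros H; simpl; [reflexivity|].
  rewrite IH, (H n) by (try (intros; apply H); lia); reflexivity.
Qed.

Lemma bsum_le a b n :
  (forall i, (i < n)%nat -> a i <= b i) -> bsum a n <= bsum b n.
Proof.
  induction n as [|n IH]; intros H; simpl; [lra|].
  apply Rplus_le_compat; [apply IH; intros; apply H|apply H]; lia.
Qed.

Lemma bsum_scal k a n : bsum (fun i => k * a i) n = k * bsum a n.
Proof. induction n as [|n IH]; simpl; [|rewrite IH]; ring. Qed.

Lemma bsum_abs a n : Rabs (bsum a n) <= bsum (fun i => Rabs (a i)) n.
Proof.
  induction n as [|n IH]; simpl; [rewrite Rabs_R0; lra|].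
  eapply Rle_trans; [apply Rabs_triang|]; lra.
Qed.

Lemma bsum_nonneg a n : (forall i, 0 <= a i) -> 0 <= bsum a n.
Proof. intros H; induction n as [|n IH]; simpl; [lra|specialize (H n); lra]. Qed.

Lemma bsum_mono a n m :
  (forall i, 0 <= a i) -> (n <= m)%nat -> bsum a n <= bsum a m.
Proof.
  intros H; induction 1 as [|m _ IH]; simpl; [lra|specialize (H m); lra].
Qed.

Lemma bsum_const k n : bsum (fun _ => k) n = INR n * k.
Proof. induction n as [|n IH]; [simpl; ring|]. rewrite S_INR; simpl; rewrite IH; ring. Qed.

Lemma bsum_add a n m : bsum a (n + m) = bsum a n + bsum (fun i => a (n + i)%nat) m.
Proof.
  induction m as [|m IH]; simpl; [rewrite Nat.add_0_r; ring|].
  rewrite Nat.add_succ_r; simpl; rewrite IH; ring.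
Qed.

Lemma sum_f_R0_bsum a n : sum_f_R0 a n = bsum a (S n).
Proof. induction n as [|n IH]; simpl; [ring|]. rewrite IH; reflexivity. Qed.

Lemma sum_n_bsum a n : sum_n a n = bsum a (S n).
Proof. rewrite sum_n_Reals; apply sum_f_R0_bsum. Qed.

Lemma bprod_pos a n : (forall i, 0 < a i) -> 0 < bprod a n.
Proof.
  intros H; induction n as [|n IH]; simpl; [lra|].
  apply Rmult_lt_0_compat; auto.
Qed.

Lemma bprod_add a n m : bprod a (n + m) = bprod a n * bprod (fun i => a (n + i)%nat) m.
Proof.
  induction m as [|m IH]; simpl; [rewrite Nat.add_0_r; ring|].
  rewrite Nat.add_succ_r; simpl; rewrite IH; ring.
Qed.

Lemma bprod_ext a b n :
  (forall i, (i < n)%nat -> a i = b i) -> bprod a n = bprod b n.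
Proof.
  induction n as [|n IH]; intros H; simpl; [reflexivity|].
  rewrite IH, (H n) by (try (intros; apply H); lia); reflexivity.
Qed.

Lemma bprod_le a b n :
  (forall i, (i < n)%nat -> 0 < a i <= b i) -> bprod a n <= bprod b n.
Proof.
  intros H; cut (0 < bprod a n <= bprod b n); [tauto|].
  induction n as [|n IH]; simpl; [lra|].
  destruct IH as [I1 I2]; [intros; apply H; lia|].
  destruct (H n) as [H1 H2]; [lia|].
  split; [apply Rmult_lt_0_compat|apply Rmult_le_compat]; lra.
Qed.

Lemma bprod_mult a b n : bprod (fun i => a i * b i) n = bprod a n * bprod b n.
Proof. induction n as [|n IH]; simpl; [ring|rewrite IH; ring]. Qed.

Lemma bprod_const k n : bprod (fun _ => k) n = k ^ n.
Proof. induction n as [|n IH]; simpl; [|rewrite IH]; ring. Qed.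

Lemma bprod_pow a k n : bprod (fun i => a i ^ k) n = bprod a n ^ k.
Proof.
  induction n as [|n IH]; simpl; [symmetry; apply pow1|].
  rewrite IH, Rpow_mult_distr; reflexivity.
Qed.

Lemma bprod_inv a n : (forall i, a i <> 0) -> bprod (fun i => / a i) n = / bprod a n.
Proof.
  intros H; induction n as [|n IH]; simpl; [field|].
  rewrite IH, Rinv_mult; reflexivity.
Qed.

Lemma div_add_r (r p i : nat) : (1 <= r)%nat -> ((r * p + i) / r = p + i / r)%nat.
Proof. intros; rewrite Nat.mul_comm, Nat.div_add_l; lia. Qed.

Lemma bsum_blocks a (r n : nat) : (1 <= r)%nat ->
  bsum (fun i => a (i / r)%nat) (r * n) = INR r * bsum a n.
Proof.
  intros hr; induction n as [|n IH].
  - rewrite Nat.mul_0_r; simpl; ring.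
  - rewrite Nat.mul_succ_r, bsum_add, IH; simpl bsum.
    rewrite (bsum_ext (fun i => a ((r * n + i) / r)%nat) (fun _ => a n)).
    + rewrite bsum_const; ring.
    + intros i Hi; f_equal; rewrite div_add_r, Nat.div_small by lia; lia.
Qed.

Lemma bprod_blocks a (r n : nat) : (1 <= r)%nat ->
  bprod (fun i => a (i / r)%nat) (r * n) = bprod a n ^ r.
Proof.
  intros hr; induction n as [|n IH].
  - rewrite Nat.mul_0_r; simpl; rewrite pow1; reflexivity.
  - rewrite Nat.mul_succ_r, bprod_add, IH; simpl bprod.
    rewrite (bprod_ext (fun i => a ((r * n + i) / r)%nat) (fun _ => a n)).
    + rewrite bprod_const, Rpow_mult_distr; reflexivity.
    + intros i Hi; f_equal; rewrite div_add_r, Nat.div_small by lia; lia.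
Qed.

Lemma exp_partial_le x n : 0 <= x -> bsum (fun i => x ^ i / INR (fact i)) n <= exp x.
Proof.
  intros Hx.
  destruct n as [|n]; [simpl; left; apply exp_pos|].
  assert (E := is_exp_Reals x).
  rewrite <- (bsum_ext (fun i => scal (pow_n x i) (/ INR (fact i)))).
  2:{ intros i _; rewrite pow_n_pow; unfold scal; simpl; unfold mult; simpl; reflexivity. }
  rewrite <- sum_n_bsum.
  apply (is_lim_seq_incr_compare _ _ E).
  intros k; rewrite !sum_n_bsum.
  change (bsum ?a (S (S k))) with (bsum a (S k) + a (S k)).
  cbv beta. rewrite pow_n_pow.
  assert (0 <= x ^ S k * / INR (fact (S k))).
  { apply Rmult_le_pos; [apply pow_le; lra|].
    left; apply Rinv_0_lt_compat, lt_0_INR, lt_O_fact. }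
  unfold scal; simpl; unfold mult; simpl; simpl in H; lra.
Qed.

Lemma pow_fact_le_exp x n : 0 <= x -> x ^ n / INR (fact n) <= exp x.
Proof.
  intros Hx; eapply Rle_trans; [|apply (exp_partial_le x (S n) Hx)].
  simpl bsum.
  assert (0 <= bsum (fun i => x ^ i / INR (fact i)) n); [|lra].
  apply bsum_nonneg; intros i; apply Rmult_le_pos; [apply pow_le; lra|].
  left; apply Rinv_0_lt_compat, lt_0_INR, lt_O_fact.
Qed.

(** * Towers of derivatives *)

(** A smooth function is carried along with all its derivatives, so that shifting, scaling and
    summing act on every order at once. *)
Definition tower (F : nat -> R -> R) : Prop :=
  forall m x, is_derive (F m) x (F (S m) x).

Lemma tower_ext (F G : nat -> R -> R) :
  (forall m x, F m x = G m x) -> tower F -> tower G.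
Proof.
  intros E H m x; rewrite <- E.
  apply (is_derive_ext (F m)); [intros; apply E|apply H].
Qed.

Lemma tower_shift F k : tower F -> tower (fun m => F (k + m)%nat).
Proof. intros H m x; rewrite Nat.add_succ_r; apply H. Qed.

Lemma tower_scal c F : tower F -> tower (fun m x => c * F m x).
Proof. intros H m x; apply (is_derive_scal (F m)), H. Qed.

Lemma tower_plus F G : tower F -> tower G -> tower (fun m x => F m x + G m x).
Proof. intros HF HG m x; apply (is_derive_plus (F m) (G m)); auto. Qed.

Lemma tower_affine F k b : tower F -> tower (fun m x => k ^ m * F m (k * x + b)).
Proof.
  intros H m x; auto_derive; [eexists; apply H|].
  rewrite (is_derive_unique _ _ _ (H m _)); simpl; ring.
Qed.

Lemma tower_Derive_n F m x : tower F -> Derive_n (F 0%nat) m x = F m x.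
Proof.
  intros H; revert x; induction m as [|m IH]; intros x; simpl; [reflexivity|].
  rewrite (Derive_ext _ (F m)) by exact IH.
  apply is_derive_unique, H.
Qed.

Lemma tower_ex_derive_n F m x : tower F -> ex_derive_n (F 0%nat) m x.
Proof.
  intros H; destruct m as [|m]; simpl; [exact I|].
  apply (ex_derive_ext (F m)); [intros t; symmetry; apply tower_Derive_n, H|].
  eexists; apply H.
Qed.

Lemma tower_continuous F m x : tower F -> continuous (F m) x.
Proof. intros H; apply (ex_derive_continuous (F m)); eexists; apply H. Qed.

Lemma tower_taylor F n x y : tower F -> x < y -> (1 <= n)%nat ->
  exists z, x < z < y /\
    F 0%nat y = bsum (fun i => (y - x) ^ i / INR (fact i) * F i x) n
                + (y - x) ^ n / INR (fact n) * F n z.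
Proof.
  intros H Hxy Hn; destruct n as [|n]; [lia|].
  destruct (Taylor_Lagrange (F 0%nat) n x y Hxy) as [z [Hz E]].
  { intros; apply tower_ex_derive_n, H. }
  exists z; split; [exact Hz|].
  rewrite E, sum_f_R0_bsum, tower_Derive_n by exact H; f_equal.
  apply bsum_ext; intros i _; rewrite tower_Derive_n by exact H; reflexivity.
Qed.

Lemma tower_mvt F m x y : tower F ->
  exists z, Rmin x y <= z <= Rmax x y /\ F m y - F m x = F (S m) z * (y - x).
Proof.
  intros H.
  destruct (MVT_gen (F m) x y (F (S m))) as [z [Hz E]].
  - intros; apply H.
  - intros; apply continuity_pt_filterlim, tower_continuous, H.
  - exists z; auto.
Qed.

Lemma tower_lipschitz F m B : tower F -> (forall x, Rabs (F (S m) x) <= B) ->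
  forall x y, Rabs (F m y - F m x) <= B * Rabs (y - x).
Proof.
  intros H HB x y; destruct (tower_mvt F m x y H) as [z [_ E]].
  rewrite E, Rabs_mult; apply Rmult_le_compat_r; [apply Rabs_pos|apply HB].
Qed.

(** The mean value theorem replaces Taylor's formula, since [g] is only Lipschitz; the price is the
    lost factor 1/2. *)
Lemma lipschitz_derive_quadratic f g B :
  (forall x, is_derive f x (g x)) -> 
  (forall x y, Rabs (g y - g x) <= B * Rabs (y - x)) ->
  forall x y, Rabs (f y - f x - (y - x) * g x) <= B * (y - x) ^ 2.
Proof.
  intros H HB x y.
  destruct (MVT_gen f x y g) as [z [Hz E]].
  - intros; apply H.
  - intros; apply continuity_pt_filterlim, (ex_derive_continuous f); eexists; apply H.
  - rewrite E; replace (g z * (y - x) - (y - x) * g x) with ((g z - g x) * (y - x)) by ring.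
    rewrite Rabs_mult, <- (pow2_abs (y - x)).
    assert (HB0 := HB x (x + 1)).
    replace (x + 1 - x) with 1 in HB0 by ring.
    rewrite Rabs_R1 in HB0; assert (H0 := Rabs_pos (g (x + 1) - g x)).
    assert (Rabs (z - x) <= Rabs (y - x)).
    { unfold Rmin, Rmax in Hz; destruct (Rle_dec x y);
      unfold Rabs; repeat destruct Rcase_abs; lra. }
    replace (B * Rabs (y - x) ^ 2) with (B * Rabs (y - x) * Rabs (y - x)) by ring.
    apply Rmult_le_compat_r; [apply Rabs_pos|].
    eapply Rle_trans; [apply HB|]; apply Rmult_le_compat_l; lra.
Qed.

(* A quadratic remainder bound survives pointwise limits, so limits of
   functions can be differentiated without uniform convergence. *)
Lemma is_derive_quadratic f x l B :
  (forall y, Rabs (f y - f x - (y - x) * l) <= B * (y - x) ^ 2) -> is_derive f x l.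
Proof.
  intros H; apply is_derive_Reals; intros eps Heps.
  assert (HB : 0 <= B).
  { specialize (H (x + 1)); replace (x + 1 - x) with 1 in H by ring.
    assert (H0 := Rabs_pos (f (x + 1) - f x - 1 * l)); lra. }
  assert (Hd : 0 < eps / (B + 1)) by (apply Rdiv_lt_0_compat; lra).
  exists (mkposreal _ Hd); intros h Hh0 Hh; simpl in Hh.
  specialize (H (x + h)); replace (x + h - x) with h in H by ring.
  replace ((f (x + h) - f x) / h - l) with ((f (x + h) - f x - h * l) / h) by (field; auto).
  rewrite Rabs_div by auto.
  assert (0 < Rabs h) by (apply Rabs_pos_lt; auto).
  apply Rle_lt_trans with (B * Rabs h).
  - apply Rle_div_l; [auto|]. rewrite <- (pow2_abs h) in H; nra.
  - apply Rle_lt_trans with (B * (eps / (B + 1))).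
    + apply Rmult_le_compat_l; lra.
    + replace (B * (eps / (B + 1))) with (eps - eps / (B + 1)) by (field; lra).
      lra.
Qed.

Lemma cauchy_limit (u e : nat -> R) :
  is_lim_seq e 0 -> (forall n k, Rabs (u (n + k)%nat - u n) <= e n) ->
  exists l : R, is_lim_seq u l /\ forall n, Rabs (l - u n) <= e n.
Proof.
  intros He H.
  assert (Hc : ex_finite_lim_seq u).
  { apply ex_lim_seq_cauchy_corr; intros eps.
    destruct (proj2 (is_lim_seq_spec e 0) He (mkposreal _ (is_pos_div_2 eps))) as [n0 Hn0].
    exists n0; intros n m Hn Hm; simpl in Hn0.
    assert (Hk : e n0 < eps / 2).
    { specialize (Hn0 n0 (le_n _)); apply Rabs_def2 in Hn0; lra. }
    assert (H1 := H n0 (n - n0)%nat); assert (H2 := H n0 (m - n0)%nat).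
    replace (n0 + (n - n0))%nat with n in H1 by lia.
    replace (n0 + (m - n0))%nat with m in H2 by lia.
    replace (u n - u m) with ((u n - u n0) - (u m - u n0)) by ring.
    eapply Rle_lt_trans; [apply Rabs_triang|]; rewrite Rabs_Ropp; lra. }
  destruct Hc as [l Hl]; exists l; split; [exact Hl|].
  intros n.
  assert (H1 : is_lim_seq (fun k => Rabs (u (k + n)%nat - u n)) (Rabs (l - u n))).
  { apply (is_lim_seq_abs _ (Finite (l - u n))).
    apply is_lim_seq_minus'; [|apply is_lim_seq_const].
    apply -> is_lim_seq_incr_n; exact Hl. }
  refine (is_lim_seq_le _ (fun _ => e n) _ _ _ H1 (is_lim_seq_const _)).
  intros k; rewrite Nat.add_comm; apply H.
Qed.

(** * Baire category in the space of admissible sequences *)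

Definition RLambda (M : nat -> R) (a : nat -> R) : Prop :=
  forall h, 0 < h -> exists A, forall p, Rabs (a p) <= A * (h ^ p * M p).

Section Baire.

Variables (M : nat -> R) (V : nat -> (nat -> R) -> Prop).
Hypothesis hM : forall p, 0 < M p.

(** A state [(a, (rho, h))] is a centre, a radius and the parameter of a norm. The space has one
    norm for each [h], so the nested balls of Baire's argument shrink in [rho] and in [h]. *)
Let in_ball (st : (nat -> R) * (R * R)) (b : nat -> R) : Prop :=
  forall j, Rabs (b j - fst st j) <= fst (snd st) * (snd (snd st) ^ j * M j).

Let good (st : (nat -> R) * (R * R)) : Prop :=
  RLambda M (fst st) /\ 0 < fst (snd st) /\ 0 < snd (snd st).

Let finer m (st st' : (nat -> R) * (R * R)) : Prop :=
  fst (snd st') <= fst (snd st) / 2 /\ snd (snd st') <= snd (snd st) / 2 /\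
  (forall j, Rabs (fst st' j - fst st j) <= fst (snd st) / 2 * (snd (snd st) ^ j * M j)) /\
  (forall b, in_ball st' b -> ~ V m b).

(** Approximation is meant coordinatewise, on finitely many coordinates. Its failure is an open
    condition on these coordinates, hence it persists on a small ball for any [h]. *)
Let dense_in m st : Prop :=
  forall b, RLambda M b -> in_ball st b ->
  forall J delta, 0 < delta ->
  exists a, V m a /\ forall j, (j <= J)%nat -> Rabs (a j - b j) <= delta.

Lemma small_multiple (g : nat -> R) J delta :
  0 < delta -> exists rho, 0 < rho /\ forall j, (j <= J)%nat -> rho * g j <= delta.
Proof.
  intros Hd; induction J as [|J [rho [H1 H2]]].
  - exists (delta / (Rabs (g 0%nat) + 1)).
    assert (H := Rabs_pos (g 0%nat)); assert (H' := Rle_abs (g 0%nat)).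
    split; [apply Rdiv_lt_0_compat; lra|].
    intros j Hj; replace j with 0%nat by lia.
    unfold Rdiv; rewrite Rmult_assoc, (Rmult_comm (/ _)); apply Rle_trans with (delta * 1); [|lra].
    apply Rmult_le_compat_l; [lra|]; apply Rle_div_l; lra.
  - assert (H := Rabs_pos (g (S J))); assert (H' := Rle_abs (g (S J))).
    assert (H3 : 0 < delta / (Rabs (g (S J)) + 1)) by (apply Rdiv_lt_0_compat; lra).
    assert (Hs : delta / (Rabs (g (S J)) + 1) * (Rabs (g (S J)) + 1) = delta) by (field; lra).
    exists (Rmin rho (delta / (Rabs (g (S J)) + 1))); split; [apply Rmin_pos; auto|].
    intros j Hj; destruct (Rle_or_lt (g j) 0) as [Hg|Hg].
    + assert (0 < Rmin rho (delta / (Rabs (g (S J)) + 1))) by (apply Rmin_pos; auto).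
      nra.
    + destruct (Nat.eq_dec j (S J)) as [->|Hne].
      * assert (Hm := Rmin_r rho (delta / (Rabs (g (S J)) + 1))); nra.
      * specialize (H2 j ltac:(lia)).
        assert (Hm := Rmin_l rho (delta / (Rabs (g (S J)) + 1))); nra.
Qed.

(** A point [b] that [V m] does not approach on the first [J] coordinates has a whole ball free of
    [V m]: its radius is taken so small that these coordinates move by at most [delta]. *)
Let refine_step : 
  (forall m st, good st -> ~ dense_in m st) ->
  forall m st, good st -> exists st', good st' /\ finer m st st'.
Proof.
  intros H m [a [rho h]] [Ha [Hr Hh]]; simpl in *.
  (* Looking for [b] in the ball of half the radius leaves room for a ball around [b] inside the old
     one. *)
  assert (Hn := H m (a, (rho / 2, h))).
  apply not_all_ex_not in Hn; [|split; [exact Ha|simpl; lra]].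
  destruct Hn as [b Hb].
  apply imply_to_and in Hb; destruct Hb as [Hb1 Hb].
  apply imply_to_and in Hb; destruct Hb as [Hb2 Hb].
  apply not_all_ex_not in Hb; destruct Hb as [J Hb].
  apply not_all_ex_not in Hb; destruct Hb as [delta Hb].
  apply imply_to_and in Hb; destruct Hb as [Hd Hb].
  unfold in_ball in Hb2; simpl in Hb2.
  destruct (small_multiple (fun j => (h / 2) ^ j * M j) J delta Hd) as [rho' [Hr1 Hr2]].
  exists (b, (Rmin rho' (rho / 2), h / 2)); split.
  - split; [exact Hb1|]; simpl; split; [apply Rmin_pos|]; lra.
  - unfold finer; simpl; repeat split.
    + apply Rmin_r.
    + lra.
    + exact Hb2.
    + intros a' Ha' HV; apply Hb; exists a'; split; [exact HV|].
      intros j Hj; specialize (Ha' j); simpl in Ha'.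
      eapply Rle_trans; [exact Ha'|]; eapply Rle_trans; [|apply (Hr2 j Hj)].
      apply Rmult_le_compat_r; [|apply Rmin_l].
      left; apply Rmult_lt_0_compat; [apply pow_lt; lra|apply hM].
Qed.

(** Otherwise the balls can be refined so that the [m]-th step avoids [V m], and their common point
    lies in no [V m]. The sets are not assumed closed, so the conclusion speaks of approximation and
    not of membership. *)
Lemma Lambda_baire :
  (forall a, RLambda M a -> exists m, V m a) ->
  exists m a rho h, RLambda M a /\ 0 < rho /\ 0 < h /\
    forall b, RLambda M b -> (forall j, Rabs (b j - a j) <= rho * (h ^ j * M j)) ->
    forall J delta, 0 < delta ->
    exists a', V m a' /\ forall j, (j <= J)%nat -> Rabs (a' j - b j) <= delta.
Proof.
  intros Hcov; apply NNPP; intros Hcon.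
  assert (Hno : forall m st, good st -> ~ dense_in m st).
  { intros m [a [rho h]] [G1 [G2 G3]] D; apply Hcon.
    exists m, a, rho, h; repeat split; auto. }
  assert (Hstep := refine_step Hno).
  set (next := fun m (s : {st | good st}) =>
    let (st', P) := constructive_indefinite_description _ (Hstep m (proj1_sig s) (proj2_sig s))
    in exist good st' (proj1 P)).
  assert (Hnext : forall m s, finer m (proj1_sig s) (proj1_sig (next m s))).
  { intros m s; unfold next; destruct (constructive_indefinite_description _ _) as [st' P].
    apply P. }
  assert (G0 : good ((fun _ => 0), (1, 1))).
  { split; [|simpl; lra]; intros h Hh; exists 0; intros p; simpl; rewrite Rabs_R0; lra. }
  set (sq := fix sq n := match n with O => exist good _ G0 | S m => next m (sq m) end).
  set (A := fun n => fst (proj1_sig (sq n))).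
  set (rho := fun n => fst (snd (proj1_sig (sq n)))).
  set (h := fun n => snd (snd (proj1_sig (sq n)))).
  assert (HA : forall n, RLambda M (A n)) by (intros n; apply (proj2_sig (sq n))).
  assert (Hr : forall n, 0 < rho n) by (intros n; apply (proj2_sig (sq n))).
  assert (Hh : forall n, 0 < h n) by (intros n; apply (proj2_sig (sq n))).
  assert (Hf : forall n, rho (S n) <= rho n / 2 /\ h (S n) <= h n / 2 /\
    (forall j, Rabs (A (S n) j - A n j) <= rho n / 2 * (h n ^ j * M j)) /\
    (forall b, (forall j, Rabs (b j - A (S n) j) <= rho (S n) * (h (S n) ^ j * M j)) -> ~ V n b))
    by (intros n; exact (Hnext n (sq n))).
  assert (Hh' : forall n k, h (n + k)%nat <= h n).
  { intros n k; induction k as [|k IH]; [rewrite Nat.add_0_r; lra|].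
    rewrite Nat.add_succ_r; destruct (Hf (n + k)%nat) as [_ [H1 _]].
    specialize (Hh (n + k)%nat); lra. }
  assert (Hpow : forall n k j, 0 <= h (n + k)%nat ^ j * M j <= h n ^ j * M j).
  { intros n k j; split.
    - apply Rmult_le_pos; [apply pow_le|]; left; auto.
    - apply Rmult_le_compat_r; [left; auto|]; apply pow_incr; split; [left; auto|auto]. }
  (* Distance travelled since stage [n] plus current radius never exceeds [rho n], all measured in
     the norm of stage [n]; this is the nesting of the balls. *)
  assert (Hdist : forall n k j,
    Rabs (A (n + k)%nat j - A n j) + rho (n + k)%nat * (h n ^ j * M j) <= rho n * (h n ^ j * M j)).
  { intros n k j; induction k as [|k IH].
    - rewrite Nat.add_0_r, Rminus_diag, Rabs_R0; lra.
    - rewrite Nat.add_succ_r; destruct (Hf (n + k)%nat) as [F1 [_ [F3 _]]].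
      specialize (F3 j); specialize (Hpow n k j); specialize (Hr (n + k)%nat).
      replace (A (S (n + k)) j - A n j) with
        ((A (S (n + k)) j - A (n + k)%nat j) + (A (n + k)%nat j - A n j)) by ring.
      assert (T := Rabs_triang (A (S (n + k)) j - A (n + k)%nat j) (A (n + k)%nat j - A n j)).
      nra. }
  assert (Hgeo : forall n, rho n <= (/ 2) ^ n).
  { induction n as [|n IH]; [simpl; unfold rho; simpl; lra|].
    destruct (Hf n) as [F1 _]; simpl; lra. }
  assert (Hhgeo : forall n, h n <= (/ 2) ^ n).
  { induction n as [|n IH]; [simpl; unfold h; simpl; lra|].
    destruct (Hf n) as [_ [F1 _]]; simpl; lra. }
  assert (Hlim : forall j, exists l : R, is_lim_seq (fun n => A n j) l /\
    forall n, Rabs (l - A n j) <= rho n * (h n ^ j * M j)).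
  { intros j; apply cauchy_limit.
    - apply (is_lim_seq_le_le (fun _ => 0) _ (fun n => (/ 2) ^ n * M j)).
      + intros n; destruct (Hpow 0%nat n j) as [P1 P2]; simpl in P1, P2.
        split; [apply Rmult_le_pos; [left; auto|exact P1]|].
        unfold h at 2 in P2; simpl in P2; rewrite pow1, Rmult_1_l in P2.
        apply Rmult_le_compat; auto; left; auto.
      + apply is_lim_seq_const.
      + replace (Finite 0) with (Rbar_mult 0 (M j)) by (simpl; f_equal; ring).
        apply is_lim_seq_scal_r, is_lim_seq_geom; rewrite Rabs_pos_eq; lra.
    - intros n k; specialize (Hdist n k j); specialize (Hr (n + k)%nat).
      destruct (Hpow n 0%nat j) as [P1 P2].
      assert (0 <= rho (n + k)%nat * (h n ^ j * M j)); [|lra].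
      apply Rmult_le_pos; lra. }
  apply choice in Hlim; destruct Hlim as [a Ha].
  destruct (Hcov a) as [m Hm].
  (* The limit satisfies the condition for every [k]: once [h n <= k], both [A n] and its distance
     to [a] are of size [k ^ j * M j]. *)
  - intros k Hk.
    destruct (pow_lt_1_zero (/ 2) ltac:(rewrite Rabs_pos_eq; lra) k Hk) as [n Hn].
    specialize (Hn n (le_n _)); rewrite Rabs_pos_eq in Hn by (apply pow_le; lra).
    destruct (HA n k Hk) as [B HB]; exists (B + rho n); intros j.
    specialize (HB j); destruct (Ha j) as [_ Hj]; specialize (Hj n).
    replace (a j) with ((a j - A n j) + A n j) by ring.
    eapply Rle_trans; [apply Rabs_triang|].
    assert (h n ^ j * M j <= k ^ j * M j).
    { apply Rmult_le_compat_r; [left; auto|]; apply pow_incr; split; [left; auto|].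
      specialize (Hhgeo n); lra. }
    specialize (Hr n); nra.
  - destruct (Hf m) as [_ [_ [_ F4]]]; apply (F4 a); [|exact Hm].
    intros j; apply Ha.
Qed.

End Baire.

(** * Landau's inequality and Bang's lemma *)

Lemma tower_difference F : tower F -> tower (fun m x => F m (x + 1) - F m x).
Proof.
  intros H.
  apply (tower_ext (fun m x => 1 ^ m * F m (1 * x + 1) + (-1) * F m x)).
  - intros m x; rewrite pow1, !Rmult_1_l; ring.
  - apply tower_plus; [apply tower_affine, H|apply tower_scal, H].
Qed.

(* The induction compares [F] with its difference [F (x + 1) - F x], whose
   derivatives of order one less are attained by derivatives of [F]. *)
Lemma landau (r : nat) : (1 <= r)%nat -> exists C, 1 <= C /\
  forall F B0 B1, tower F ->
  (forall x, Rabs (F 0%nat x) <= B0) -> (forall x, Rabs (F r x) <= B1) ->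
  forall j x, (j <= r)%nat -> Rabs (F j x) <= C * (B0 + B1).
Proof.
  induction 1 as [|r Hr [C [HC IH]]].
  - exists 1; split; [lra|]; intros F B0 B1 _ H0 H1 j x Hj.
    assert (P0 := Rabs_pos (F 0%nat x)); assert (P1 := Rabs_pos (F 1%nat x)).
    specialize (H0 x); specialize (H1 x).
    destruct j as [|[|j]]; [lra|lra|lia].
  - exists (C * (1 + 2 * C) + 1); split; [nra|].
    intros F B0 B1 HF H0 H1 j x Hj.
    assert (P0 : 0 <= B0) by (eapply Rle_trans; [apply Rabs_pos|apply (H0 x)]).
    assert (P1 : 0 <= B1) by (eapply Rle_trans; [apply Rabs_pos|apply (H1 x)]).
    destruct (Nat.eq_dec j (S r)) as [->|Hne].
    { eapply Rle_trans; [apply H1|]; nra. }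
    assert (Hlip := tower_lipschitz F r B1 HF H1).
    assert (Hr' : forall y, Rabs (F r y) <= C * (2 * B0 + B1) + B1).
    { intros y.
      assert (Hg := IH _ (2 * B0) B1 (tower_difference F HF)); simpl in Hg.
      assert (Hg' : Rabs (F (r - 1)%nat (y + 1) - F (r - 1)%nat y) <= C * (2 * B0 + B1)).
      { apply Hg; [| |lia].
        - intros z; assert (Q1 := H0 z); assert (Q2 := H0 (z + 1)).
          unfold Rminus; eapply Rle_trans; [apply Rabs_triang|]; rewrite Rabs_Ropp; lra.
        - intros z; eapply Rle_trans; [apply Hlip|].
          replace (z + 1 - z) with 1 by ring; rewrite Rabs_R1; lra. }
      destruct (tower_mvt F (r - 1) y (y + 1) HF) as [z [Hz E]].
      replace (S (r - 1)) with r in E by lia.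
      replace (F r z * (y + 1 - y)) with (F r z) in E by ring.
      rewrite E in Hg'.
      rewrite Rmin_left, Rmax_right in Hz by lra.
      specialize (Hlip z y).
      assert (Rabs (y - z) <= 1) by (apply Rabs_le; lra).
      replace (F r y) with ((F r y - F r z) + F r z) by ring.
      eapply Rle_trans; [apply Rabs_triang|]; nra. }
    eapply Rle_trans; [apply (IH F B0 _ HF H0 Hr'); lia|]; nra.
Qed.

(** The unscaled inequality is applied to [x -> F (h x)]. A free [h] stands in for the usual
    optimisation: it will be chosen to make the two bounds equal. *)
Lemma landau_scaled (r : nat) : (1 <= r)%nat -> exists C, 1 <= C /\
  forall F B0 B1 h, tower F -> 0 < h ->
  (forall x, Rabs (F 0%nat x) <= B0) -> (forall x, Rabs (F r x) <= B1) ->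
  forall j x, (j <= r)%nat -> h ^ j * Rabs (F j x) <= C * (B0 + h ^ r * B1).
Proof.
  intros hr; destruct (landau r hr) as [C [HC H]]; exists C; split; [exact HC|].
  intros F B0 B1 h HF Hh H0 H1 j x Hj.
  assert (L := H _ B0 (h ^ r * B1) (tower_affine F h 0 HF)); simpl in L.
  specialize (L ltac:(intros; rewrite Rmult_1_l; apply H0)).
  assert (Hp : forall k, Rabs (h ^ k) = h ^ k) by (intros; apply Rabs_pos_eq, pow_le; lra).
  specialize (L ltac:(intros; rewrite Rabs_mult, Hp; apply Rmult_le_compat_l;
    [apply pow_le; lra|apply H1]) j (x / h) Hj).
  rewrite Rabs_mult, Hp in L.
  replace (h * (x / h) + 0) with x in L by (field; lra); exact L.
Qed.

(* Bang's argument: the flatness of [U] at [0] degrades by a factor [e] at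
   most over each step of length [al n / e]. *)
Lemma bang (U : nat -> R -> R) (A al : nat -> R) (m : nat) :
  tower U -> (forall j, 0 < A j) -> (forall j, 0 < al j) ->
  (forall j, A (S j) = A j / al j) ->
  (forall i j, (i <= j)%nat -> al j <= al i) ->
  (forall j t, Rabs (U j t) <= A j) ->
  (forall j, (j < m)%nat -> Rabs (U j 0) <= A j * exp (INR j - INR m)) ->
  forall n t j, (n <= m)%nat -> 0 <= t -> exp 1 * t <= bsum al m - bsum al n ->
  (j <= n)%nat -> Rabs (U j t) <= A j * exp (INR j - INR n).
Proof.
  intros HU HA Hal HAS Hmono Hb H0 n t j Hnm; revert t j.
  (* The quotients [A (S j) / A j = 1 / al j] increase, so [i] of them with index at most [k]
     multiply to at most [1 / al k ^ i]. *)
  assert (Hquot : forall k j i, (j + i <= S k)%nat -> A (j + i)%nat <= A j / al k ^ i).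
  { intros k j i; induction i as [|i IH]; intros Hi.
    - rewrite Nat.add_0_r; simpl; lra.
    - rewrite Nat.add_succ_r, HAS.
      assert (P := pow_lt (al k) i (Hal k)).
      replace (A j / al k ^ S i) with (A j / al k ^ i / al k)
        by (simpl; assert (Q := Hal k); field; lra).
      assert (I1 := IH ltac:(lia)).
      apply Rle_trans with (A (j + i)%nat / al k).
      + apply Rmult_le_compat_l; [left; auto|].
        apply Rinv_le_contravar; [auto|]; apply Hmono; lia.
      + apply Rmult_le_compat_r; [left; apply Rinv_0_lt_compat; auto|exact I1]. }
  replace n with (m - (m - n))%nat by lia.
  assert (Hle : (m - n <= m)%nat) by lia; revert Hle; generalize (m - n)%nat as k.
  assert (He := exp_pos 1).
  induction k as [|k IH]; intros Hk t j Ht Hlen Hj.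
  - rewrite Nat.sub_0_r in *.
    assert (t = 0) by nra; subst t.
    destruct (Nat.eq_dec j m) as [->|Hne]; [|apply H0; lia].
    rewrite Rminus_diag, exp_0, Rmult_1_r; auto.
  - set (n' := (m - S k)%nat) in *.
    replace (m - k)%nat with (S n') in IH by lia.
    specialize (IH ltac:(lia)).
    (* Up to [t0] the estimate of stage [S n'] applies and is more than enough. Beyond, Taylor's
       formula at [t0] uses that estimate for the lower orders and the global bound [A] for the
       remainder of order [S n']; all terms are then dominated by the exponential series at some
       [y <= 1], which costs the factor [e]. *)
    set (t0 := (bsum al m - bsum al (S n')) / exp 1) in *.
    assert (Et0 : exp 1 * t0 = bsum al m - bsum al (S n')) by (unfold t0; field; lra).
    assert (Hmon : bsum al (S n') <= bsum al m).
    { apply bsum_mono; [intros; left; auto|lia]. }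
    assert (Hexp : forall i, exp (INR i - INR n') = exp (INR i - INR (S n')) * exp 1).
    { intros i; rewrite <- exp_plus; f_equal; rewrite S_INR; ring. }
    destruct (Rle_or_lt t t0) as [Hle|Hlt].
    + eapply Rle_trans; [apply IH; [exact Ht|nra|lia]|].
      rewrite Hexp; apply Rmult_le_compat_l; [left; auto|].
      assert (1 <= exp 1) by (assert (Q := exp_ineq1_le 1); lra).
      assert (Q := exp_pos (INR j - INR (S n'))); nra.
    + assert (Ht0 : 0 <= t0) by (apply Rdiv_le_0_compat; lra).
      destruct (tower_taylor _ (S n' - j) t0 t (tower_shift U j HU) Hlt ltac:(lia))
        as [z [_ Ez]].
      rewrite Nat.add_0_r in Ez; rewrite Ez.
      set (d := (S n' - j)%nat) in *.
      set (c := A j * exp (INR j - INR (S n'))).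
      set (y := exp 1 * (t - t0) / al n').
      assert (Hterm : forall i v, (j + i <= S n')%nat ->
        Rabs v <= A (j + i)%nat * exp (INR (j + i) - INR (S n')) ->
        Rabs ((t - t0) ^ i / INR (fact i) * v) <= c * (y ^ i / INR (fact i))).
      { intros i v Hi Hv.
        assert (Hf : 0 < / INR (fact i)) by (apply Rinv_0_lt_compat, lt_0_INR, lt_O_fact).
        assert (Hp : 0 <= (t - t0) ^ i) by (apply pow_le; lra).
        rewrite Rabs_mult, (Rabs_pos_eq (_ / _)) by (apply Rmult_le_pos; lra).
        replace (c * (y ^ i / INR (fact i))) with
          ((t - t0) ^ i / INR (fact i) *
           (A j / al n' ^ i * exp (INR (j + i) - INR (S n')))).
        - apply Rmult_le_compat_l; [apply Rmult_le_pos; lra|].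
          eapply Rle_trans; [exact Hv|].
          apply Rmult_le_compat_r; [left; apply exp_pos|apply Hquot; lia].
        - unfold c, y; rewrite plus_INR.
          replace (INR j + INR i - INR (S n')) with ((INR j - INR (S n')) + INR i) by ring.
          rewrite exp_plus, <- (Rmult_1_r (INR i)) at 1.
          replace (exp (INR i * 1)) with (exp 1 ^ i)
            by (rewrite <- Rpower_pow by auto; unfold Rpower; rewrite ln_exp; reflexivity).
          unfold Rdiv; rewrite !Rpow_mult_distr, pow_inv; ring. }
      rewrite Hexp.
      apply Rle_trans with (bsum (fun i => c * (y ^ i / INR (fact i))) (S d)).
      * eapply Rle_trans; [apply Rabs_triang|]; simpl bsum.
        apply Rplus_le_compat.
        -- eapply Rle_trans; [apply bsum_abs|]; apply bsum_le; intros i Hi.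
           apply Hterm; [lia|]; apply IH; [exact Ht0|lra|lia].
        -- apply Hterm; [lia|].
           replace (j + d)%nat with (S n') by lia.
           rewrite Rminus_diag, exp_0, Rmult_1_r; auto.
      * rewrite bsum_scal, <- Rmult_assoc; fold c.
        apply Rmult_le_compat_l; [left; apply Rmult_lt_0_compat; [auto|apply exp_pos]|].
        assert (Hy : 0 <= y <= 1).
        { assert (Q := Hal n'); unfold y; split.
          - apply Rmult_le_pos; [nra|]; left; apply Rinv_0_lt_compat; auto.
          - apply Rle_div_l; [auto|]; simpl bsum in *; lra. }
        eapply Rle_trans; [apply exp_partial_le; lra|].
        destruct (Rle_lt_or_eq_dec y 1) as [Q|Q]; [lra|left; apply exp_increasing; auto|rewrite Q; lra].
Qed.

(** If [F d] stayed above 1/2 on $[0,X]$, Taylor's formula would give $F_0(X) > \frac12\cdot 4W -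
    \delta e^X \ge W$. *)
Lemma tower_drop F d X W delta : tower F -> (1 <= d)%nat -> 0 < X ->
  (forall x, Rabs (F 0%nat x) <= W) -> 4 * INR (fact d) * W < X ^ d ->
  (forall i, (i < d)%nat -> Rabs (F i 0) <= delta) -> delta * exp X <= W ->
  exists t, 0 <= t <= X /\ F d t <= 1 / 2.
Proof.
  intros HF Hd HX HW HXd H0 Hdelta; apply NNPP; intros Hno.
  assert (Hbig : forall t, 0 <= t <= X -> 1 / 2 < F d t).
  { intros t Ht; apply Rnot_le_lt; intros Q; apply Hno; exists t; auto. }
  destruct (tower_taylor F d 0 X HF HX Hd) as [z [Hz E]].
  rewrite Rminus_0_r in E.
  assert (HdX : 0 <= delta).
  { eapply Rle_trans; [apply Rabs_pos|apply (H0 0%nat); lia]. }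
  assert (Hsum : Rabs (bsum (fun i => X ^ i / INR (fact i) * F i 0) d) <= delta * exp X).
  { eapply Rle_trans; [apply bsum_abs|].
    apply Rle_trans with (bsum (fun i => delta * (X ^ i / INR (fact i))) d).
    - apply bsum_le; intros i Hi.
      assert (Hp : 0 <= X ^ i / INR (fact i)).
      { apply Rmult_le_pos; [apply pow_le; lra|].
        left; apply Rinv_0_lt_compat, lt_0_INR, lt_O_fact. }
      rewrite Rabs_mult, (Rabs_pos_eq _ Hp), Rmult_comm.
      apply Rmult_le_compat_r; auto.
    - rewrite bsum_scal; apply Rmult_le_compat_l; [exact HdX|apply exp_partial_le; lra]. }
  assert (Hf : 0 < INR (fact d)) by (apply lt_0_INR, lt_O_fact).
  assert (Hrem : 4 * W < X ^ d / INR (fact d)).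
  { apply (proj1 (Rlt_div_r _ _ _ Hf)).
    replace (4 * W * INR (fact d)) with (4 * INR (fact d) * W) by ring; exact HXd. }
  assert (Hz' := Hbig z ltac:(lra)); assert (HW' := HW X).
  assert (HW0 : 0 <= W) by (eapply Rle_trans; [apply Rabs_pos|apply (HW 0)]).
  apply Rabs_le_between in Hsum; apply Rabs_le_between in HW'; nra.
Qed.

(** * Weight sequences and roots of their quotients *)

Lemma INR_gt_0 n : (1 <= n)%nat -> 0 < INR n.
Proof. intros; apply lt_0_INR; lia. Qed.

Lemma Rpower_pos x y : 0 < Rpower x y.
Proof. apply exp_pos. Qed.

Lemma Rpower_root_pow x n : (1 <= n)%nat -> 0 < x -> Rpower x (1 / INR n) ^ n = x.
Proof.
  intros Hn Hx; assert (H := INR_gt_0 n Hn).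
  rewrite <- Rpower_pow, Rpower_mult by apply Rpower_pos.
  replace (1 / INR n * INR n) with 1 by (field; lra); apply Rpower_1, Hx.
Qed.

Lemma pow_lt_reg x y n : 0 <= y -> x ^ n < y ^ n -> x < y.
Proof.
  intros Hy H; apply Rnot_le_lt; intros Q; apply (Rlt_irrefl (x ^ n)).
  eapply Rlt_le_trans; [exact H|]; apply pow_incr; lra.
Qed.

Lemma pow_lt_mono x y n : (1 <= n)%nat -> 0 <= x -> x < y -> x ^ n < y ^ n.
Proof.
  intros Hn Hx Hxy; destruct n as [|n]; [lia|].
  simpl; apply Rle_lt_trans with (x * y ^ n).
  - apply Rmult_le_compat_l; [exact Hx|]; apply pow_incr; lra.
  - apply Rmult_lt_compat_r; [apply pow_lt; lra|exact Hxy].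
Qed.

Lemma pow_le_reg x y n : (1 <= n)%nat -> 0 <= y -> x ^ n <= y ^ n -> x <= y.
Proof.
  intros Hn Hy H; apply Rnot_lt_le; intros Q.
  assert (P := pow_lt_mono y x n Hn Hy Q); lra.
Qed.

Definition beta (r : nat) (N : nat -> R) (k : nat) : R :=
  Rpower (1 / quotients N k) (1 / INR r).

Section Quotients.

Variable N : nat -> R.
Hypothesis hN : LC N.

Lemma quotients_pos k : 0 < quotients N k.
Proof.
  destruct k as [|k]; simpl; [lra|].
  destruct hN as [P _]; apply Rdiv_lt_0_compat; apply P.
Qed.

Lemma quotients_step k : quotients N k <= quotients N (S k).
Proof.
  destruct hN as [P [H0 [H1 [L _]]]].
  destruct k as [|k]; simpl.
  - rewrite H0; lra.
  - specialize (L (S k) ltac:(lia)).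
    replace (S k - 1)%nat with k in L by lia.
    replace (S k + 1)%nat with (S (S k)) in L by lia.
    assert (P0 := P k); assert (P1 := P (S k)).
    apply Rle_div_l; [auto|].
    replace (N (S (S k)) / N (S k) * N k) with (N k * N (S (S k)) / N (S k)) by (field; lra).
    apply (proj1 (Rle_div_r _ _ _ P1)); simpl in L; lra.
Qed.

Lemma quotients_mono i j : (i <= j)%nat -> quotients N i <= quotients N j.
Proof.
  induction 1 as [|j _ IH]; [lra|].
  eapply Rle_trans; [exact IH|apply quotients_step].
Qed.

Lemma quotients_ge_1 k : 1 <= quotients N k.
Proof. apply (quotients_mono 0 k); lia. Qed.

Lemma weight_bprod p n :
  N (p + n)%nat = N p * bprod (fun i => quotients N (S (p + i))) n.
Proof.
  destruct hN as [P _].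
  induction n as [|n IH]; cbn [bprod].
  - rewrite Nat.add_0_r; ring.
  - rewrite Nat.add_succ_r, <- Rmult_assoc, <- IH; simpl.
    assert (Q := P (p + n)%nat); field; lra.
Qed.

Lemma weight_bprod0 n : N n = bprod (fun i => quotients N (S i)) n.
Proof.
  destruct hN as [_ [H0 _]].
  assert (H := weight_bprod 0 n); cbn [Nat.add] in H; rewrite H0, Rmult_1_l in H; exact H.
Qed.

Lemma weight_pos n : 0 < N n.
Proof. apply hN. Qed.

Lemma weight_ratio_le j p : (j <= p)%nat -> N p <= N j * quotients N p ^ (p - j).
Proof.
  intros H; replace (N p) with (N (j + (p - j))%nat) by (f_equal; lia).
  rewrite weight_bprod, <- (bprod_const (quotients N p)).
  apply Rmult_le_compat_l; [left; apply weight_pos|].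
  apply bprod_le; intros i Hi; split; [apply quotients_pos|apply quotients_mono; lia].
Qed.

End Quotients.

Section Roots.

Variables (r : nat) (N : nat -> R).
Hypotheses (hr : (1 <= r)%nat) (hN : LC N).

Lemma beta_pos k : 0 < beta r N k.
Proof. apply Rpower_pos. Qed.

Lemma beta_pow k : beta r N k ^ r = / quotients N k.
Proof.
  unfold beta; rewrite Rpower_root_pow; auto.
  - unfold Rdiv; ring.
  - apply Rdiv_lt_0_compat; [lra|apply (quotients_pos N hN)].
Qed.

Lemma beta_mono i j : (i <= j)%nat -> beta r N j <= beta r N i.
Proof.
  intros H; apply (pow_le_reg _ _ r); [exact hr|left; apply beta_pos|].
  rewrite !beta_pow; apply Rinv_le_contravar; [apply (quotients_pos N hN)|apply (quotients_mono N hN), H].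
Qed.

Lemma beta_le_1 k : beta r N k <= 1.
Proof.
  apply (pow_le_reg _ _ r); [exact hr|lra|].
  rewrite beta_pow, pow1, <- Rinv_1; apply Rinv_le_contravar; [lra|apply (quotients_ge_1 N hN)].
Qed.

(** Extension of [N] from the orders [r * n] to all orders: the [r] steps from [r * n] to [r * S n]
    share the quotient $\nu_{n+1}^{1/r}$. It is again log-convex, as Bang's lemma requires. *)
Definition fine_weight (m : nat) : R := / bprod (fun i => beta r N (S (i / r))) m.

Lemma fine_weight_pos m : 0 < fine_weight m.
Proof. apply Rinv_0_lt_compat, bprod_pos; intros; apply beta_pos. Qed.

Lemma fine_weight_S m : fine_weight (S m) = fine_weight m / beta r N (S (m / r)).
Proof. unfold fine_weight; simpl; rewrite Rinv_mult; reflexivity. Qed.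

Lemma fine_weight_mono i j : (i <= j)%nat -> fine_weight i <= fine_weight j.
Proof.
  induction 1 as [|j _ IH]; [lra|].
  rewrite fine_weight_S; eapply Rle_trans; [exact IH|].
  assert (H := beta_pos (S (j / r))); assert (H1 := beta_le_1 (S (j / r))).
  assert (H2 := fine_weight_pos j).
  apply Rle_div_r; [auto|]; nra.
Qed.

Lemma fine_weight_block n j : (j <= r)%nat ->
  fine_weight (r * n + j) = N n / beta r N (S n) ^ j.
Proof.
  intros Hj; unfold fine_weight.
  rewrite bprod_add, Rinv_mult; unfold Rdiv; f_equal.
  - rewrite (bprod_blocks (fun k => beta r N (S k))) by exact hr.
    rewrite <- bprod_pow, <- bprod_inv, (weight_bprod0 N hN).
    + apply bprod_ext; intros i _; rewrite beta_pow, Rinv_inv; reflexivity.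
    + intros i; apply pow_nonzero; assert (H := beta_pos (S i)); lra.
  - f_equal; rewrite <- bprod_const; apply bprod_ext; intros i Hi.
    do 2 f_equal; rewrite div_add_r, Nat.div_small by lia; lia.
Qed.

End Roots.

(** * Necessity *)

Definition spaced (r : nat) (F : nat -> R -> R) : Prop :=
  forall n j, (1 <= j <= r - 1)%nat -> F (r * n + j)%nat 0 = 0.

(** Landau's inequality between the orders [r * n] and [r * S n], with [h = beta r N (S n)]: then
    [h ^ r * N (S n) = N n], and both of its terms coincide. *)
Lemma fine_bound (r : nat) : (1 <= r)%nat -> exists C, 1 <= C /\
  forall N W F, LC N -> 0 < W -> tower F ->
  (forall n x, Rabs (F (r * n)%nat x) <= W * N n) ->
  forall m x, Rabs (F m x) <= C * W * fine_weight r N m.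
Proof.
  intros hr; destruct (landau_scaled r hr) as [C [HC HL]].
  exists (2 * C); split; [lra|].
  intros N W F hN HW HF HB m x.
  rewrite (Nat.div_mod_eq m r); set (n := (m / r)%nat); set (j := (m mod r)%nat).
  assert (Hj : (j < r)%nat) by (apply Nat.mod_upper_bound; lia).
  rewrite fine_weight_block by (auto; lia).
  assert (Hb := beta_pos r N (S n)).
  assert (L := HL _ (W * N n) (W * N (S n)) (beta r N (S n)) (tower_shift F (r * n) HF) Hb).
  cbv beta in L; rewrite Nat.add_0_r in L.
  specialize (L (HB n)); replace (r * n + r)%nat with (r * S n)%nat in L by lia.
  specialize (L (HB (S n)) j x ltac:(lia)).
  assert (E : beta r N (S n) ^ r * (W * N (S n)) = W * N n).
  { rewrite beta_pow by auto; simpl.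
    assert (P := weight_pos N hN n); assert (P' := weight_pos N hN (S n)).
    field; split; lra. }
  rewrite E in L.
  assert (Hp : 0 < beta r N (S n) ^ j) by (apply pow_lt; auto).
  replace (2 * C * W * (N n / beta r N (S n) ^ j)) with
    ((C * (W * N n + W * N n)) / beta r N (S n) ^ j) by (field; lra).
  apply (proj1 (Rle_div_r _ _ _ Hp)); lra.
Qed.

(** Two facts collide: Taylor's formula from order [r * j] forces the derivative of order [r * p] to
    fall from about 1 to 1/2 at some [t <= X], while Bang's lemma keeps it almost constant as long
    as [exp 1 * t] fits into the sum of the widths beyond the first [n0]. *)
Lemma tail_bound_of_extremal (r : nat) : (1 <= r)%nat -> exists C, 1 <= C /\
  forall N W p j X n0, LC N -> 0 < W -> (j < p)%nat -> 0 < X ->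
  4 * INR (fact (r * (p - j))) * (W * N j) < X ^ (r * (p - j)) ->
  C * W * N p < exp (INR n0) ->
  (forall delta J, 0 < delta -> exists F, tower F /\ spaced r F /\
    (forall n x, Rabs (F (r * n)%nat x) <= W * N n) /\
    (forall i, (i <= J)%nat -> Rabs (F (r * i)%nat 0 - (if Nat.eqb i p then 1 else 0)) <= delta)) ->
  forall Q, INR r * bsum (fun k => beta r N (S (p + k))) Q
    <= INR n0 * beta r N (S p) + exp 1 * X.
Proof.
  intros hr; destruct (fine_bound r hr) as [C [HC HF0]].
  (* Bang's bound is $2CWN_p e^{-n_0}$, to be pushed below the drop $3/4-1/2=1/4$; hence 8. *)
  exists (8 * C); split; [lra|].
  intros N W p j X n0 hN HW Hjp HX HXd Hn0 Hf Q.
  set (d := (r * (p - j))%nat) in *.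
  assert (Hd : (1 <= d)%nat) by (unfold d; nia).
  set (m := (r * Q)%nat).
  (* The factor 2 is for [U 0] below, a difference of two values of the same derivative. *)
  set (A := fun i => 2 * C * W * fine_weight r N (r * p + i)).
  set (al := fun i => beta r N (S ((r * p + i) / r))).
  assert (Eal : forall i, al i = beta r N (S (p + i / r))).
  { intros i; unfold al; rewrite div_add_r by exact hr; reflexivity. }
  assert (Hal : forall i, 0 < al i) by (intros; apply beta_pos).
  assert (HA : forall i, 0 < A i).
  { intros i; assert (P := fine_weight_pos r N (r * p + i)).
    unfold A; apply Rmult_lt_0_compat; [|auto]; nra. }
  assert (HA0 : A 0%nat = 2 * C * W * N p).
  { unfold A; rewrite (fine_weight_block r N hr hN p 0) by lia; simpl; field. }
  assert (HAmono : forall i, A 0%nat <= A i).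
  { intros i; unfold A; apply Rmult_le_compat_l; [nra|]; apply fine_weight_mono; auto; lia. }
  assert (HNj : 0 < W * N j) by (apply Rmult_lt_0_compat; [auto|apply weight_pos; auto]).
  (* The three bounds keep the derivative of order [r * p] at [0] above 3/4, meet the condition of
     [tower_drop], and give the flatness at all orders below [m] from which Bang's lemma starts. *)
  set (delta := Rmin (1 / 4) (Rmin (W * N j * exp (- X)) (A 0%nat * exp (- INR m)))).
  assert (Hdelta : 0 < delta).
  { unfold delta; repeat apply Rmin_pos; [lra| |];
    apply Rmult_lt_0_compat; auto; apply exp_pos. }
  assert (Hd1 : delta <= 1 / 4) by apply Rmin_l.
  assert (Hd2 : delta <= W * N j * exp (- X))
    by (unfold delta; eapply Rle_trans; [apply Rmin_r|apply Rmin_l]).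
  assert (Hd3 : delta <= A 0%nat * exp (- INR m))
    by (unfold delta; eapply Rle_trans; [apply Rmin_r|apply Rmin_r]).
  destruct (Hf delta (p + Q)%nat Hdelta) as [F [HF [HS [HB HV]]]].
  assert (Hfine := HF0 N W F hN HW HF HB).
  assert (Hflat : forall i, (i < r * (p + Q))%nat -> i <> (r * p)%nat -> Rabs (F i 0) <= delta).
  { intros i Hi Hne; rewrite (Nat.div_mod_eq i r) in *.
    set (a := (i / r)%nat) in *; set (b := (i mod r)%nat) in *.
    assert (Hb : (b < r)%nat) by (apply Nat.mod_upper_bound; lia).
    destruct (Nat.eq_dec b 0) as [E|E].
    - rewrite E, Nat.add_0_r in *.
      assert (a <> p) by (intros ->; lia).
      assert (Hap : (a <= p + Q)%nat) by nia.
      specialize (HV a Hap); rewrite (proj2 (Nat.eqb_neq a p)) in HV by auto.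
      rewrite Rminus_0_r in HV; exact HV.
    - rewrite HS by lia; rewrite Rabs_R0; lra. }
  assert (H1 : Rabs (F (r * p)%nat 0 - 1) <= delta).
  { specialize (HV p ltac:(lia)); rewrite Nat.eqb_refl in HV; exact HV. }
  destruct (tower_drop (fun i => F (r * j + i)%nat) d X (W * N j) delta) as [t [Ht HFt]]; auto.
  { apply tower_shift; auto. }
  { intros x; rewrite Nat.add_0_r; auto. }
  { intros i Hi; apply Hflat; unfold d in Hi; nia. }
  { apply Rle_trans with (W * N j * exp (- X) * exp X).
    - apply Rmult_le_compat_r; [left; apply exp_pos|exact Hd2].
    - rewrite Rmult_assoc, <- exp_plus, Rplus_opp_l, exp_0; lra. }
  cbv beta in HFt; replace (r * j + d)%nat with (r * p)%nat in HFt by (unfold d; nia).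
  (* Subtracting the derivative from its value at [0] removes the only order that is not flat there,
     and changes the higher orders by a sign only. *)
  set (U := fun i x => (-1) * F (r * p + i)%nat x + (if Nat.eqb i 0 then F (r * p)%nat 0 else 0)).
  assert (HU : tower U).
  { apply tower_plus; [apply tower_scal, (tower_shift F (r * p)), HF|].
    intros [|i] x; apply (is_derive_const (V := R_NormedModule)). }
  assert (Hblocks : bsum al m = INR r * bsum (fun k => beta r N (S (p + k))) Q).
  { unfold m; rewrite <- (bsum_blocks (fun k => beta r N (S (p + k)))) by exact hr.
    apply bsum_ext; intros i _; apply Eal. }
  assert (Hal0 : forall i, al i <= beta r N (S p)).
  { intros i; rewrite Eal; apply beta_mono; auto; lia. }
  assert (Hfirst : forall n, bsum al n <= INR n * beta r N (S p)).
  { intros n; rewrite <- bsum_const; apply bsum_le; auto. }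
  assert (HeX : 0 < exp 1 * X) by (apply Rmult_lt_0_compat; [apply exp_pos|auto]).
  rewrite <- Hblocks.
  (* If [m < n0], bounding each term by the first one is already enough. *)
  destruct (Nat.le_gt_cases n0 m) as [Hnm|Hnm].
  - apply Rnot_lt_le; intros Hcon.
    assert (B := bang U A al m HU HA Hal).
    assert (E0 : exp 1 * t <= bsum al m - bsum al n0).
    { specialize (Hfirst n0).
      assert (exp 1 * t <= exp 1 * X); [|lra].
      apply Rmult_le_compat_l; [left; apply exp_pos|lra]. }
    assert (B0 : Rabs (U 0%nat t) <= A 0%nat * exp (INR 0 - INR n0)).
    { apply B; auto; try lia; try lra; clear B.
      - intros i; unfold A, al; rewrite Nat.add_succ_r, fine_weight_S.
        assert (P := beta_pos r N (S ((r * p + i) / r))); field; lra.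
      - intros i k Hik; unfold al; apply beta_mono; auto.
        apply le_n_S, Nat.Div0.div_le_mono; lia.
      - assert (Hgen : forall i x, Rabs (F (r * p + i)%nat x) <= A i / 2).
        { intros i x; unfold A; eapply Rle_trans; [apply Hfine|]; right; field. }
        intros [|i] x; unfold U; simpl Nat.eqb; cbv iota.
        + assert (G1 := Hgen 0%nat x); assert (G2 := Hgen 0%nat 0).
          rewrite Nat.add_0_r in *.
          eapply Rle_trans; [apply Rabs_triang|].
          rewrite Rabs_mult, Rabs_m1; lra.
        + specialize (Hgen (S i) x); rewrite Rplus_0_r, Rabs_mult, Rabs_m1.
          specialize (HA (S i)); lra.
      - intros i Hi.
        assert (Hexp : A 0%nat * exp (- INR m) <= A i * exp (INR i - INR m)).
        { apply Rmult_le_compat; [left; auto|left; apply exp_pos|auto|].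
          assert (Pi := pos_INR i).
          destruct (Req_dec (INR i) 0) as [Z|Z]; [rewrite Z; right; f_equal; ring|].
          left; apply exp_increasing; lra. }
        destruct i as [|i]; unfold U; simpl Nat.eqb; cbv iota.
        + rewrite Nat.add_0_r.
          replace (-1 * F (r * p)%nat 0 + F (r * p)%nat 0) with 0 by ring.
          rewrite Rabs_R0; left; apply Rmult_lt_0_compat; [auto|apply exp_pos].
        + rewrite Rplus_0_r, Rabs_mult, Rabs_m1, Rmult_1_l.
          eapply Rle_trans; [apply Hflat|]; [unfold m in Hi; nia|lia|lra]. }
    unfold U in B0; rewrite Nat.add_0_r in B0; simpl Nat.eqb in B0; cbv iota in B0.
    simpl INR in B0; rewrite Rminus_0_l, exp_Ropp, HA0 in B0.
    apply Rabs_le_between in B0; apply Rabs_le_between in H1.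
    assert (Hlt : 2 * C * W * N p * / exp (INR n0) < 1 / 4).
    { apply (proj2 (Rlt_div_l _ _ _ (exp_pos (INR n0)))); lra. }
    lra.
  - eapply Rle_trans; [apply Hfirst|].
    assert (INR m * beta r N (S p) <= INR n0 * beta r N (S p)); [|lra].
    apply Rmult_le_compat_r; [left; apply beta_pos|apply le_INR; lia].
Qed.

Definition RD_Beurling (r : nat) (N : nat -> R) (F : nat -> R -> R) : Prop :=
  tower F /\ (forall x, 1 < Rabs x -> F 0%nat x = 0) /\ spaced r F /\
  (forall h, 0 < h -> exists A, forall n x, Rabs (F (r * n)%nat x) <= A * (h ^ n * N n)).

Definition RBorel (r : nat) (M N : nat -> R) : Prop :=
  forall a, RLambda M a ->
  exists F, RD_Beurling r N F /\ forall j, F (r * j)%nat 0 = a j.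

Lemma INR_above x : exists n, (1 <= n)%nat /\ x < INR n.
Proof.
  destruct (nfloor_ex (Rmax x 0) (Rmax_r _ _)) as [n [_ Hn]]; exists (S n); split; [lia|].
  rewrite S_INR; assert (H := Rmax_l x 0); lra.
Qed.

Lemma RLambda_perturb M a p c : (forall q, 0 < M q) -> RLambda M a ->
  RLambda M (fun j => a j + (if Nat.eqb j p then c else 0)).
Proof.
  intros HM Ha h Hh; destruct (Ha h Hh) as [A HA].
  exists (A + Rabs c / (h ^ p * M p)); intros j; specialize (HA j).
  assert (Hp : forall q, 0 < h ^ q * M q)
    by (intros; apply Rmult_lt_0_compat; [apply pow_lt|]; auto).
  eapply Rle_trans; [apply Rabs_triang|].
  rewrite Rmult_plus_distr_r; apply Rplus_le_compat; [exact HA|].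
  destruct (Nat.eqb_spec j p) as [->|_].
  - specialize (Hp p); right; field; split; [apply Rgt_not_eq, HM|].
    apply Rgt_not_eq, pow_lt, Hh.
  - rewrite Rabs_R0; apply Rmult_le_pos; [|left; auto].
    apply Rmult_le_pos; [apply Rabs_pos|left; apply Rinv_0_lt_compat; auto].
Qed.

(** The set of index [m] in Baire's argument collects the sequences realised with constant [m]. Both
    $a+c\,e_p$ and $a-c\,e_p$ lie in the ball it provides; half the difference of the two
    approximating functions, divided by $c$, forgets the unknown centre $a$. *)
Lemma extremal_functions r M N : (forall p, 0 < M p) -> (forall p, 0 < N p) ->
  RBorel r M N ->
  exists K h, 1 <= K /\ 0 < h /\ forall p delta J, 0 < delta ->
  exists F, tower F /\ spaced r F /\
    (forall n x, Rabs (F (r * n)%nat x) <= K / (h ^ p * M p) * N n) /\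
    (forall i, (i <= J)%nat -> Rabs (F (r * i)%nat 0 - (if Nat.eqb i p then 1 else 0)) <= delta).
Proof.
  intros HM HN HB.
  destruct (Lambda_baire M (fun m a => exists F, tower F /\ spaced r F /\
    (forall n x, Rabs (F (r * n)%nat x) <= INR m * N n) /\
    forall j, F (r * j)%nat 0 = a j) HM) as [m [a [rho [h [Ha [Hr [Hh H]]]]]]].
  { intros a Ha; destruct (HB a Ha) as [F [[H1 [_ [H3 H4]]] H5]].
    destruct (H4 1 Rlt_0_1) as [A HA]; destruct (INR_above A) as [m [_ Hm]].
    exists m, F; split; [|split; [|split]]; auto.
    intros n x; eapply Rle_trans; [apply HA|]; rewrite pow1, Rmult_1_l.
    apply Rmult_le_compat_r; [left; auto|lra]. }
  exists (INR m / rho + 1), h; split.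
  { assert (0 <= INR m / rho); [|lra].
    apply Rmult_le_pos; [apply pos_INR|left; apply Rinv_0_lt_compat; auto]. }
  split; [exact Hh|].
  intros p delta J Hd.
  assert (Hhp : forall q, 0 < h ^ q * M q)
    by (intros; apply Rmult_lt_0_compat; [apply pow_lt|]; auto).
  (* The largest change of the [p]-th coordinate that stays in the ball; dividing by it yields the
     factor [1 / (h ^ p * M p)]. *)
  set (c := rho * (h ^ p * M p)).
  assert (Hc : 0 < c) by (apply Rmult_lt_0_compat; auto).
  assert (Hap : forall e, Rabs e = c -> exists F, tower F /\ spaced r F /\
    (forall n x, Rabs (F (r * n)%nat x) <= INR m * N n) /\
    forall j, (j <= J)%nat ->
      Rabs (F (r * j)%nat 0 - (a j + (if Nat.eqb j p then e else 0))) <= delta * c).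
  { intros e He.
    destruct (H _ (RLambda_perturb M a p e HM Ha)) with (J := J) (delta := delta * c)
      as [a' [[F [H1 [H2 [H3 H4]]]] H5]].
    - intros j; replace (a j + (if Nat.eqb j p then e else 0) - a j)
        with (if Nat.eqb j p then e else 0) by ring.
      destruct (Nat.eqb_spec j p) as [->|_]; [rewrite He; apply Rle_refl|].
      rewrite Rabs_R0; left; apply Rmult_lt_0_compat; auto.
    - apply Rmult_lt_0_compat; auto.
    - exists F; split; [|split; [|split]]; auto; intros j Hj; rewrite H4; auto. }
  destruct (Hap c) as [F [F1 [F2 [F3 F4]]]]; [apply Rabs_pos_eq; lra|].
  destruct (Hap (- c)) as [G [G1 [G2 [G3 G4]]]]; [rewrite Rabs_Ropp; apply Rabs_pos_eq; lra|].
  exists (fun i x => / (2 * c) * (F i x + (-1) * G i x)); split; [|split; [|split]].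
  - apply (tower_scal (/ (2 * c)) (fun i x => F i x + (-1) * G i x)).
    apply tower_plus; [auto|apply tower_scal; auto].
  - intros n j Hj; rewrite F2, G2 by auto; ring.
  - intros n x; specialize (F3 n x); specialize (G3 n x).
    rewrite Rabs_mult, Rabs_pos_eq by (left; apply Rinv_0_lt_compat; lra).
    apply Rle_trans with (/ (2 * c) * (2 * (INR m * N n))).
    + apply Rmult_le_compat_l; [left; apply Rinv_0_lt_compat; lra|].
      eapply Rle_trans; [apply Rabs_triang|]; rewrite Rabs_mult, Rabs_m1; lra.
    + replace (/ (2 * c) * (2 * (INR m * N n))) with (INR m / rho / (h ^ p * M p) * N n).
      * apply Rmult_le_compat_r; [left; auto|].
        apply Rmult_le_compat_r; [left; apply Rinv_0_lt_compat; auto|lra].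
      * unfold c; field; specialize (HM p); assert (P := pow_lt h p Hh); repeat split; lra.
  - intros i Hi; specialize (F4 i Hi); specialize (G4 i Hi).
    set (v := if Nat.eqb i p then 1 else 0).
    replace (/ (2 * c) * (F (r * i)%nat 0 + -1 * G (r * i)%nat 0) - v) with
      (/ (2 * c) * ((F (r * i)%nat 0 - (a i + (if Nat.eqb i p then c else 0))) -
        (G (r * i)%nat 0 - (a i + (if Nat.eqb i p then - c else 0))))).
    + rewrite Rabs_mult, Rabs_pos_eq by (left; apply Rinv_0_lt_compat; lra).
      apply Rle_trans with (/ (2 * c) * (delta * c + delta * c)).
      * apply Rmult_le_compat_l; [left; apply Rinv_0_lt_compat; lra|].
        eapply Rle_trans; [apply Rabs_triang|]; rewrite Rabs_Ropp; lra.
      * right; field; lra.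
    + unfold v; destruct (Nat.eqb i p); field; lra.
Qed.

Lemma fact_le_pow n k : (n <= k)%nat -> INR (fact n) <= INR k ^ n.
Proof.
  intros H; induction n as [|n IH]; [simpl; lra|].
  rewrite fact_simpl, mult_INR; simpl pow.
  apply Rmult_le_compat; [apply pos_INR|apply pos_INR|apply le_INR; auto|apply IH; lia].
Qed.

Lemma series_bounded a B : (forall i, 0 <= a i) -> (forall n, bsum a n <= B) ->
  ex_series a /\ Series a <= B.
Proof.
  intros Ha HB.
  assert (H : ex_finite_lim_seq (sum_n a)).
  { apply ex_finite_lim_seq_incr with B; intros n; rewrite !sum_n_bsum; [|auto].
    simpl; specialize (Ha (S n)); lra. }
  destruct H as [l Hl]; assert (Hs : is_series a l) by exact Hl; split; [exists l; exact Hs|].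
  rewrite (is_series_unique _ _ Hs).
  refine (is_lim_seq_le _ (fun _ => B) _ _ _ Hl (is_lim_seq_const _)).
  intros n; rewrite sum_n_bsum; auto.
Qed.

Lemma bsum_le_Series a n : (forall i, 0 <= a i) -> ex_series a -> bsum a n <= Series a.
Proof.
  intros Ha [l Hl]; rewrite (is_series_unique _ _ Hl).
  apply Rle_trans with (bsum a (S n)); [simpl; specialize (Ha n); lra|].
  rewrite <- sum_n_bsum; apply (is_lim_seq_incr_compare _ _ Hl).
  intros k; rewrite !sum_n_bsum; simpl; specialize (Ha (S k)); lra.
Qed.

(** The sum of all the positive candidates bounds each of them, and the index [0] is a candidate; so
    [Lub_Rbar] is finite and [real] returns it. *)
Lemma lambda_ps_lub M N p s : (1 <= p)%nat ->
  let y j := Rpower (M p / (INR s ^ p * N j)) (1 / INR (p - j)) in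
  (forall j, (j < p)%nat -> y j <= lambda_ps M N p s) /\
  (forall b, (forall j, (j < p)%nat -> y j <= b) -> lambda_ps M N p s <= b).
Proof.
  intros Hp y; unfold lambda_ps.
  set (E := fun v => exists j, (j < p)%nat /\ v = Rpower (M p / (INR s ^ p * N j)) (1 / INR (p - j))).
  destruct (Lub_Rbar_correct E) as [L1 L2].
  assert (Hbd : forall b, (forall j, (j < p)%nat -> y j <= b) -> Rbar_le (Lub_Rbar E) b).
  { intros b Hb; apply L2; intros v [j [Hj ->]]; apply Hb, Hj. }
  assert (Hex : exists b, forall j, (j < p)%nat -> y j <= b).
  { exists (bsum y p); intros j Hj; clear - Hj.
    assert (Hy : forall i, 0 <= y i) by (intros; left; apply Rpower_pos).
    apply Rle_trans with (bsum y (S j)); [|apply bsum_mono; auto].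
    simpl; assert (Q := bsum_nonneg y j Hy); lra. }
  assert (Hy : forall j, (j < p)%nat -> Rbar_le (y j) (Lub_Rbar E)).
  { intros j Hj; apply L1; exists j; auto. }
  destruct Hex as [b Hb]; assert (Hb' := Hbd b Hb); assert (H0 := Hy 0%nat ltac:(lia)).
  destruct (Lub_Rbar E) as [l| |]; simpl in *; try contradiction.
  split; auto.
Qed.

Theorem necessity r M N : (1 <= r)%nat -> LC M -> LC N ->
  (exists C0, 1 <= C0 /\ forall p, M p <= C0 ^ p * N p) ->
  RBorel r M N -> SV r M N.
Proof.
  intros hr hM hN [C0 [HC0 HMN]] HB.
  assert (HM : forall p, 0 < M p) by apply hM.
  assert (HN : forall p, 0 < N p) by apply hN.
  destruct (extremal_functions r M N HM HN HB) as [K [h [HK [Hh HF]]]].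
  destruct (tail_bound_of_extremal r hr) as [C [HC HT]].
  (* [s > / h] lets [s ^ p] replace [/ h ^ p] in the extremal functions; [s > C0] gives
     [M p <= s ^ p * N p], hence [y >= 1] below. *)
  destruct (INR_above (Rmax C0 (/ h))) as [s [Hs Hsmax]].
  assert (Hs0 : C0 < INR s) by (eapply Rle_lt_trans; [apply Rmax_l|exact Hsmax]).
  assert (Hsh : / h < INR s) by (eapply Rle_lt_trans; [apply Rmax_r|exact Hsmax]).
  assert (Hsp : forall p, 0 < INR s ^ p) by (intros; apply pow_lt; lra).
  (* The summands pay, in units of [p / Y], for the term [beta r N p], for the [S n] terms skipped
     in Bang's lemma (the next two), and for [exp 1 * X]. *)
  set (A := 1 + (ln (C * K) + 1) + INR r + exp 1 * (INR r * (5 * K + 1))).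
  assert (Hln : 0 <= ln (C * K)) by (rewrite <- ln_1; apply ln_le; nra).
  assert (HR := INR_gt_0 r hr); assert (He := exp_pos 1).
  assert (Hr5 : 0 <= exp 1 * (INR r * (5 * K + 1))).
  { apply Rmult_le_pos; [lra|]; apply Rmult_le_pos; lra. }
  assert (HA0 : 0 <= A) by (unfold A; lra).
  (* One candidate [j] and one partial sum at a time; the supremum and the series are formed only at
     the end. *)
  assert (Hkey : forall p j Q, (j < p)%nat ->
    Rpower (Rpower (M p / (INR s ^ p * N j)) (1 / INR (p - j))) (1 / INR r) *
    bsum (fun i => beta r N (p + i)) Q <= A * INR p).
  { intros p j Q Hjp.
    set (Y := Rpower _ (1 / INR r)).
    assert (HY : 0 < Y) by apply Rpower_pos.
    set (d := (r * (p - j))%nat).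
    assert (Hd : (1 <= d)%nat) by (unfold d; nia).
    assert (Hz : 0 < M p / (INR s ^ p * N j)).
    { apply Rdiv_lt_0_compat; [auto|]; apply Rmult_lt_0_compat; auto. }
    assert (HYd : Y ^ d = M p / (INR s ^ p * N j)).
    { unfold Y, d; rewrite pow_mult, Rpower_root_pow by (auto; apply Rpower_pos).
      apply Rpower_root_pow; [lia|exact Hz]. }
    assert (Hb := beta_pos r N p).
    set (W := K * INR s ^ p / M p).
    assert (HW : 0 < W) by (apply Rdiv_lt_0_compat; [apply Rmult_lt_0_compat; [lra|]|]; auto).
    assert (HWN : W * N p = K * (INR s ^ p * N p / M p))
      by (unfold W; assert (P := HM p); field; lra).
    (* By log-convexity $N_p/N_j \le \nu_p^{p-j}$, and $\nu_p = \beta_p^{-r}$. *)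
    assert (Hratio : INR s ^ p * N p / M p <= (/ (beta r N p * Y)) ^ d).
    { replace (INR s ^ p * N p / M p) with (N p / N j / Y ^ d).
      - rewrite Rinv_mult, Rpow_mult_distr, (pow_inv Y).
        apply Rmult_le_compat_r; [left; apply Rinv_0_lt_compat, pow_lt; auto|].
        apply Rle_div_l; [apply HN|]; unfold d.
        rewrite pow_mult, pow_inv, beta_pow, Rinv_inv by auto.
        rewrite Rmult_comm; apply weight_ratio_le; auto; lia.
      - rewrite HYd; field; repeat split; apply Rgt_not_eq; first [apply HM|apply HN|apply Hsp]. }
    assert (Hone : 1 <= INR s ^ p * N p / M p).
    { apply (proj1 (Rle_div_r _ _ _ (HM p))); rewrite Rmult_1_l.
      eapply Rle_trans; [apply HMN|]; apply Rmult_le_compat_r; [left; auto|].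
      apply pow_incr; lra. }
    set (y := / (beta r N p * Y)) in *.
    assert (Hy0 : 0 < y) by (apply Rinv_0_lt_compat, Rmult_lt_0_compat; auto).
    assert (Hby : beta r N p * y = / Y) by (unfold y; field; lra).
    assert (Hy1 : 1 <= y).
    { apply (pow_le_reg _ _ d Hd); [lra|]; rewrite pow1; lra. }
    assert (HiY : 0 < / Y) by (apply Rinv_0_lt_compat; auto).
    assert (HbY : beta r N p <= / Y) by (rewrite <- Hby; nra).
    (* From $\ln y\le y$. Multiplied by [beta r N p] the right side becomes [INR d / Y], so the
       logarithmically many skipped terms cost no more than the main one. *)
    assert (Hlnr : ln (INR s ^ p * N p / M p) <= INR d * y).
    { apply Rle_trans with (ln (y ^ d)); [apply ln_le; lra|].
      rewrite ln_pow by auto; apply Rmult_le_compat_l; [apply pos_INR|].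
      assert (Q0 := exp_ineq1_le (ln y)); rewrite exp_ln in Q0 by auto; lra. }
    assert (HlnW : ln (C * W * N p) = ln (C * K) + ln (INR s ^ p * N p / M p)).
    { rewrite <- ln_mult by nra; f_equal; rewrite Rmult_assoc, HWN; ring. }
    assert (Hln2 : 0 <= ln (INR s ^ p * N p / M p)) by (rewrite <- ln_1; apply ln_le; lra).
    assert (HCW : 0 < C * W * N p).
    { apply Rmult_lt_0_compat; [apply Rmult_lt_0_compat; [lra|exact HW]|apply HN]. }
    destruct (nfloor_ex (ln (C * W * N p))) as [n [Hn1 Hn2]]; [lra|].
    (* Since $W N_j = K/Y^d$ and $d!\le d^d$, any multiple of $d/Y$ by a number above both 1 and
       $4K$ satisfies the condition on [X]. *)
    set (X := INR d * (5 * K + 1) / Y).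
    assert (Hdpos := INR_gt_0 d Hd).
    assert (HX : 0 < X) by (apply Rdiv_lt_0_compat; nra).
    destruct p as [|p']; [lia|]; set (p := S p') in *.
    assert (HT' := HT N W p j X (S n) hN HW Hjp HX).
    destruct Q as [|Q].
    { simpl bsum; rewrite Rmult_0_r; apply Rmult_le_pos; [exact HA0|apply pos_INR]. }
    assert (Htail : INR r * bsum (fun k => beta r N (S (p + k))) Q <=
      INR (S n) * beta r N (S p) + exp 1 * X).
    { apply HT'; clear HT'.
      - fold d.
        replace (4 * INR (fact d) * (W * N j)) with (INR (fact d) * (4 * K) / Y ^ d).
        + unfold X, Rdiv; rewrite !Rpow_mult_distr, pow_inv.
          apply Rmult_lt_compat_r; [apply Rinv_0_lt_compat, pow_lt; auto|].
          apply Rle_lt_trans with (INR d ^ d * (4 * K)).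
          * apply Rmult_le_compat_r; [lra|]; apply fact_le_pow; lia.
          * apply Rmult_lt_compat_l; [apply pow_lt; auto|].
            apply Rlt_le_trans with ((5 * K + 1) ^ 1); [simpl; lra|].
            apply Rle_pow; [lra|exact Hd].
        + rewrite HYd; unfold W; field; repeat split; apply Rgt_not_eq; first [apply HM|apply HN|apply Hsp].
      - rewrite <- (exp_ln (C * W * N p)) by auto; apply exp_increasing; rewrite S_INR; lra.
      - intros delta J Hdelta; destruct (HF p delta J Hdelta) as [F [F1 [F2 [F3 F4]]]].
        exists F; split; [|split; [|split]]; auto.
        intros i x; eapply Rle_trans; [apply F3|].
        apply Rmult_le_compat_r; [left; auto|].
        assert (Hhp : 0 < h ^ p) by (apply pow_lt; auto).
        unfold W, Rdiv; rewrite Rinv_mult, <- Rmult_assoc.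
        apply Rmult_le_compat_r; [left; apply Rinv_0_lt_compat; auto|].
        apply Rmult_le_compat_l; [lra|]; rewrite <- pow_inv; apply pow_incr.
        split; [left; apply Rinv_0_lt_compat; auto|lra]. }
    (* Condition [SV] sums from [p] on, the tail bound only from [S p]; the term at [p] is at most
       [/ Y] because [y >= 1]. *)
    replace (S Q) with (1 + Q)%nat by lia; rewrite bsum_add; simpl (bsum _ 1).
    rewrite Nat.add_0_r, Rplus_0_l.
    rewrite (bsum_ext (fun i => beta r N (p + (1 + i))%nat) (fun k => beta r N (S (p + k))))
      by (intros; f_equal; lia).
    set (T := bsum _ Q) in *.
    assert (HT0 : 0 <= T) by (apply bsum_nonneg; intros; left; apply beta_pos).
    assert (HrT : T <= INR r * T).
    { assert (1 <= INR r) by (apply (le_INR 1); exact hr); nra. }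
    assert (Hbm : beta r N (S p) <= beta r N p) by (apply beta_mono; auto; lia).
    assert (Hnb : INR (S n) * beta r N (S p) <= (ln (C * K) + 1 + INR d * y) * beta r N p).
    { apply Rmult_le_compat; [apply pos_INR|left; apply beta_pos| |exact Hbm].
      rewrite S_INR; lra. }
    assert (Hnb2 : (ln (C * K) + 1 + INR d * y) * beta r N p <= (ln (C * K) + 1 + INR d) / Y).
    { replace ((ln (C * K) + 1 + INR d * y) * beta r N p) with
        ((ln (C * K) + 1) * beta r N p + INR d * (beta r N p * y)) by ring.
      rewrite Hby; unfold Rdiv; rewrite (Rmult_plus_distr_r _ _ (/ Y)).
      apply Rplus_le_compat_r, Rmult_le_compat_l; lra. }
    assert (Hsum : beta r N p + T <=
      (1 + (ln (C * K) + 1 + INR d) + exp 1 * (INR d * (5 * K + 1))) / Y).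
    { unfold X in Htail; unfold Rdiv in *; lra. }
    assert (Hdp : INR d <= INR r * INR p).
    { rewrite <- mult_INR; apply le_INR; unfold d; nia. }
    assert (Hp1 : 1 <= INR p) by (apply (le_INR 1); lia).
    apply Rle_trans with (1 + (ln (C * K) + 1 + INR d) + exp 1 * (INR d * (5 * K + 1))).
    - apply (proj2 (Rle_div_r _ _ _ HY)) in Hsum; fold p; lra.
    - unfold A.
      assert (exp 1 * (INR d * (5 * K + 1)) <= exp 1 * (INR r * (5 * K + 1)) * INR p).
      { rewrite Rmult_assoc; apply Rmult_le_compat_l; [lra|].
        replace (INR r * (5 * K + 1) * INR p) with (INR r * INR p * (5 * K + 1)) by ring.
        apply Rmult_le_compat_r; lra. }
      assert (0 <= (2 + ln (C * K)) * (INR p - 1)) by (apply Rmult_le_pos; lra).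
      lra. }
  assert (Hb0 : forall p i, 0 <= beta r N (p + i)) by (intros; left; apply beta_pos).
  assert (Hser : forall p, (1 <= p)%nat -> ex_series (fun i => beta r N (p + i))).
  { intros p Hp.
    destruct (series_bounded (fun i => beta r N (p + i))
      (A * INR p / Rpower (Rpower (M p / (INR s ^ p * N 0%nat)) (1 / INR (p - 0))) (1 / INR r))) as [E _]; auto.
    intros Q; apply Rle_div_r; [apply Rpower_pos|].
    rewrite Rmult_comm; apply Hkey; lia. }
  exists s; split; [exact Hs|]; split; [exact Hser|].
  exists A; intros p Hp.
  change (Rpower (lambda_ps M N p s) (1 / INR r) / INR p *
    Series (fun i => beta r N (p + i)) <= A).
  set (S0 := Series _).
  assert (HS0 : 0 < S0).
  { eapply Rlt_le_trans; [|apply (bsum_le_Series _ 1); auto].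
    simpl; rewrite Rplus_0_l; apply beta_pos. }
  destruct (lambda_ps_lub M N p s Hp) as [L1 L2].
  assert (Hl0 : 0 < lambda_ps M N p s).
  { eapply Rlt_le_trans; [apply Rpower_pos|apply (L1 0%nat); lia]. }
  assert (Hp0 := INR_gt_0 p Hp).
  assert (Hq : 0 <= A * INR p / S0).
  { apply Rmult_le_pos; [nra|left; apply Rinv_0_lt_compat; auto]. }
  (* The bound is taken to the power [r] so that it applies to the candidates themselves, and the
     supremum is formed before the root. *)
  assert (Hl : lambda_ps M N p s <= (A * INR p / S0) ^ r).
  { apply L2; intros j Hj.
    rewrite <- (Rpower_root_pow (Rpower (M p / (INR s ^ p * N j)) _) r hr) by apply Rpower_pos.
    apply pow_incr; split; [left; apply Rpower_pos|].
    apply (proj1 (Rle_div_r _ _ _ HS0)).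
    set (Y := Rpower _ (1 / INR r)).
    assert (HY : 0 < Y) by apply Rpower_pos.
    destruct (series_bounded (fun i => beta r N (p + i)) (A * INR p / Y)) as [_ E]; auto.
    - intros Q; apply (proj1 (Rle_div_r _ _ _ HY)); rewrite Rmult_comm; apply Hkey, Hj.
    - apply (proj2 (Rle_div_r _ _ _ HY)) in E; fold S0 in E; lra. }
  assert (Hroot : Rpower (lambda_ps M N p s) (1 / INR r) <= A * INR p / S0).
  { apply (pow_le_reg _ _ r hr Hq); rewrite Rpower_root_pow; auto. }
  apply (proj2 (Rle_div_r _ _ _ HS0)) in Hroot.
  replace (Rpower (lambda_ps M N p s) (1 / INR r) / INR p * S0) with
    (Rpower (lambda_ps M N p s) (1 / INR r) * S0 / INR p) by (field; lra).
  apply (proj2 (Rle_div_l _ _ _ Hp0)); exact Hroot.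
Qed.

(** * Cutoff functions by iterated averaging *)

Definition lipschitz (L : R) (f : R -> R) : Prop :=
  forall x y, Rabs (f y - f x) <= L * Rabs (y - x).

(** Convolution with the normalised indicator of $[-w/2,w/2]$, rescaled to the unit interval so that
    sup bounds and Lipschitz constants pass through unchanged. *)
Definition average (w : R) (f : R -> R) (x : R) : R :=
  RInt (fun s => f (x + w * (s - 1 / 2))) 0 1.

Definition difference (w : R) (f : R -> R) (x : R) : R :=
  (f (x + w / 2) - f (x - w / 2)) / w.

Lemma lipschitz_continuous L f x : lipschitz L f -> continuous f x.
Proof.
  intros H; apply continuity_pt_filterlim; intros eps Heps.
  assert (HL : 0 <= L).
  { specialize (H 0 1); rewrite Rminus_0_r, Rabs_R1 in H.
    assert (P := Rabs_pos (f 1 - f 0)); lra. }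
  exists (eps / (L + 1)); split; [apply Rdiv_lt_0_compat; lra|].
  intros y [_ Hy]; simpl in *; unfold R_dist in *.
  eapply Rle_lt_trans; [apply H|].
  apply Rle_lt_trans with (L * (eps / (L + 1))).
  - apply Rmult_le_compat_l; lra.
  - replace (L * (eps / (L + 1))) with (eps - eps / (L + 1)) by (field; lra).
    assert (0 < eps / (L + 1)) by (apply Rdiv_lt_0_compat; lra); lra.
Qed.

Lemma average_integrable L w f x : lipschitz L f ->
  ex_RInt (fun s => f (x + w * (s - 1 / 2))) 0 1.
Proof.
  intros H; apply (ex_RInt_continuous (V := R_CompleteNormedModule)); intros s _.
  apply (continuous_comp (fun s => x + w * (s - 1 / 2)) f).
  - apply (ex_derive_continuous (fun s => x + w * (s - 1 / 2))); auto_derive; auto.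
  - apply (lipschitz_continuous L), H.
Qed.

Lemma average_ext w f g x : (forall y, f y = g y) -> average w f x = average w g x.
Proof. intros H; apply RInt_ext; intros; apply H. Qed.

Lemma average_close L w f x c e : lipschitz L f -> 
  (forall s, 0 <= s <= 1 -> Rabs (f (x + w * (s - 1 / 2)) - c) <= e) ->
  Rabs (average w f x - c) <= e.
Proof.
  intros HL H; assert (Hi := average_integrable L w f x HL).
  assert (Hc : is_RInt (fun _ => c) 0 1 c).
  { assert (Q := is_RInt_const (V := R_NormedModule) 0 1 c).
    refine (eq_ind _ (is_RInt (fun _ => c) 0 1) Q c _).
    unfold scal; simpl; unfold mult; simpl; ring. }
  assert (Hd := is_RInt_minus _ _ _ _ _ _ (RInt_correct _ _ _ Hi) Hc).
  replace e with ((1 - 0) * e) by ring.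
  apply (norm_RInt_le_const (V := R_NormedModule)
    (fun s => minus (f (x + w * (s - 1 / 2))) c) 0 1 (average w f x - c) e); [lra| |exact Hd].
  intros s Hs; apply (H s Hs).
Qed.

Lemma average_bound L w f B x : lipschitz L f -> (forall y, Rabs (f y) <= B) ->
  Rabs (average w f x) <= B.
Proof.
  intros HL H; rewrite <- (Rminus_0_r (average w f x)).
  apply (average_close L); auto; intros s _; rewrite Rminus_0_r; auto.
Qed.

Lemma average_const L w f a b c x : lipschitz L f -> 0 < w ->
  (forall y, a <= y <= b -> f y = c) -> a + w / 2 <= x <= b - w / 2 ->
  average w f x = c.
Proof.
  intros HL Hw H Hx; apply Rminus_diag_uniq.
  destruct (Req_dec (average w f x - c) 0) as [E|E]; [exact E|exfalso].
  apply Rabs_pos_lt in E; apply (Rlt_not_le _ _ E).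
  apply (average_close L); auto; intros s Hs; rewrite H by nra.
  rewrite Rminus_diag, Rabs_R0; lra.
Qed.

Lemma average_lipschitz L w f : lipschitz L f -> lipschitz L (average w f).
Proof.
  intros HL x y.
  assert (Hx := RInt_correct _ _ _ (average_integrable L w f x HL)).
  assert (Hy := RInt_correct _ _ _ (average_integrable L w f y HL)).
  assert (Hd := is_RInt_minus _ _ _ _ _ _ Hy Hx).
  replace (L * Rabs (y - x)) with ((1 - 0) * (L * Rabs (y - x))) by ring.
  refine (norm_RInt_le_const (V := R_NormedModule) _ 0 1 _ (L * Rabs (y - x)) _ _ Hd); [lra|].
  intros s _; eapply Rle_trans; [apply HL|].
  right; f_equal; f_equal; ring.
Qed.

Lemma average_near L w f x : lipschitz L f -> 0 < w ->
  Rabs (average w f x - f x) <= L * w.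
Proof.
  intros HL Hw; apply (average_close L); auto; intros s Hs.
  eapply Rle_trans; [apply HL|].
  assert (HL0 : 0 <= L).
  { specialize (HL 0 1); rewrite Rminus_0_r, Rabs_R1 in HL.
    assert (P := Rabs_pos (f 1 - f 0)); lra. }
  apply Rmult_le_compat_l; [exact HL0|]; apply Rabs_le; nra.
Qed.

Lemma difference_bound w f B x : 0 < w -> (forall y, Rabs (f y) <= B) ->
  Rabs (difference w f x) <= 2 / w * B.
Proof.
  intros Hw H; unfold difference, Rdiv.
  rewrite Rabs_mult, (Rabs_pos_eq (/ w)) by (left; apply Rinv_0_lt_compat; auto).
  replace (2 * / w * B) with ((B + B) * / w) by ring.
  apply Rmult_le_compat_r; [left; apply Rinv_0_lt_compat; auto|].
  eapply Rle_trans; [apply Rabs_triang|]; rewrite Rabs_Ropp; apply Rplus_le_compat; apply H.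
Qed.

Lemma difference_lipschitz L w f : 0 < w -> lipschitz L f ->
  lipschitz (2 / w * L) (difference w f).
Proof.
  intros Hw HL x y; unfold difference.
  replace ((f (y + w / 2) - f (y - w / 2)) / w - (f (x + w / 2) - f (x - w / 2)) / w) with
    (((f (y + w / 2) - f (x + w / 2)) - (f (y - w / 2) - f (x - w / 2))) * / w) by (field; lra).
  rewrite Rabs_mult, (Rabs_pos_eq (/ w)) by (left; apply Rinv_0_lt_compat; auto).
  replace (2 / w * L * Rabs (y - x)) with ((L * Rabs (y - x) + L * Rabs (y - x)) * / w)
    by (field; lra).
  apply Rmult_le_compat_r; [left; apply Rinv_0_lt_compat; auto|].
  eapply Rle_trans; [apply Rabs_triang|]; rewrite Rabs_Ropp.
  apply Rplus_le_compat; (eapply Rle_trans; [apply HL|]);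
    right; f_equal; f_equal; ring.
Qed.

Lemma average_derive_inside L w f g x : 0 < w -> lipschitz L g ->
  (forall y, is_derive f y (g y)) -> average w g x = difference w f x.
Proof.
  intros Hw HL H; apply is_RInt_unique.
  assert (D : forall s, is_derive (fun s => f (x + w * (s - 1 / 2)) / w) s
    (g (x + w * (s - 1 / 2)))).
  { intros s; auto_derive; [eexists; apply H|].
    rewrite (is_derive_unique _ _ _ (H _)); unfold Rminus; field; lra. }
  assert (I := is_RInt_derive (V := R_CompleteNormedModule) _ _ 0 1 (fun s _ => D s)).
  unfold difference.
  replace ((f (x + w / 2) - f (x - w / 2)) / w) with
    (minus (f (x + w * (1 - 1 / 2)) / w) (f (x + w * (0 - 1 / 2)) / w)).
  - apply I; intros s _.
    apply (continuous_comp (fun s => x + w * (s - 1 / 2)) g).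
    + apply (ex_derive_continuous (fun s => x + w * (s - 1 / 2))); auto_derive; auto.
    + apply (lipschitz_continuous L), HL.
  - unfold minus, plus, opp; simpl.
    replace (x + w * (1 - 1 / 2)) with (x + w / 2) by field.
    replace (x + w * (0 - 1 / 2)) with (x - w / 2) by field.
    field; lra.
Qed.

(** As [f] is only continuous, it is replaced by a primitive [P]: the average of [f] is the
    difference quotient of [P], which can be differentiated. *)
Lemma average_derive L w f x : 0 < w -> lipschitz L f ->
  is_derive (average w f) x (difference w f x).
Proof.
  intros Hw HL; set (P := fun y => RInt f 0 y).
  assert (HP : forall y, is_derive P y (f y)).
  { intros y; apply (is_derive_RInt f P 0 y).
    - exists (mkposreal 1 Rlt_0_1); intros z _.
      apply (RInt_correct (V := R_CompleteNormedModule) f 0 z).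
      apply (ex_RInt_continuous (V := R_CompleteNormedModule)).
      intros; apply (lipschitz_continuous L), HL.
    - apply (lipschitz_continuous L), HL. }
  apply (is_derive_ext (difference w P)).
  { intros y; symmetry; apply (average_derive_inside L); auto. }
  unfold difference; auto_derive; [repeat split; eexists; apply HP|].
  rewrite !(is_derive_unique _ _ _ (HP _)); unfold Rminus; field; lra.
Qed.

Lemma difference_derive w f g x : (forall y, is_derive f y (g y)) ->
  is_derive (difference w f) x (difference w g x).
Proof.
  intros H; unfold difference; auto_derive; [repeat split; eexists; apply H|].
  rewrite !(is_derive_unique _ _ _ (H _)); unfold Rdiv, Rminus; ring.
Qed.

(* A flag [true] at index [i] means that the average of width [w i] has been
   differentiated into a difference quotient. *)
Fixpoint smoothing (w : nat -> R) (S : nat -> bool) (f : R -> R) (n : nat) : R -> R :=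
  match n with
  | O => f
  | Datatypes.S m =>
      (if S m then difference (w m) else average (w m)) (smoothing w S f m)
  end.

(** What step [i] costs, both in sup norm and in Lipschitz constant. *)
Definition flag_factor (w : nat -> R) (S : nat -> bool) (i : nat) : R :=
  if S i then 2 / w i else 1.

Section Smoothing.

Variables (w : nat -> R) (f : R -> R) (X L : R).
Hypotheses (hw : forall i, 0 < w i) (hX : forall n, bsum w n <= X).
Hypotheses (hL : lipschitz L f) (hf : forall x, Rabs (f x) <= 1).

Lemma smoothing_ext S S' n x : (forall i, (i < n)%nat -> S i = S' i) ->
  smoothing w S f n x = smoothing w S' f n x.
Proof.
  revert x; induction n as [|n IH]; intros x H; [reflexivity|].
  simpl; rewrite <- (H n) by lia.
  assert (E : forall y, smoothing w S f n y = smoothing w S' f n y)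
    by (intros; apply IH; intros; apply H; lia).
  destruct (S n); [unfold difference; rewrite !E; reflexivity|apply average_ext, E].
Qed.

Lemma smoothing_lipschitz S n :
  lipschitz (bprod (flag_factor w S) n * L) (smoothing w S f n).
Proof.
  induction n as [|n IH]; simpl; [rewrite Rmult_1_l; exact hL|].
  rewrite (Rmult_comm _ (flag_factor w S n)), Rmult_assoc.
  unfold flag_factor at 1; destruct (S n).
  - apply difference_lipschitz; auto.
  - rewrite Rmult_1_l; apply average_lipschitz, IH.
Qed.

Lemma smoothing_bound S n x : Rabs (smoothing w S f n x) <= bprod (flag_factor w S) n.
Proof.
  revert x; induction n as [|n IH]; intros x; simpl; [apply hf|].
  rewrite Rmult_comm; unfold flag_factor at 1; destruct (S n).
  - apply difference_bound; auto.
  - rewrite Rmult_1_l; apply (average_bound _ _ _ _ _ (smoothing_lipschitz S n)), IH.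
Qed.

(** A derivative can be absorbed by any average not yet differentiated, whatever its position: later
    differences commute with it, and for later averages the fundamental theorem of calculus moves it
    inside. This freedom is what [cutoff] exploits. *)
Lemma smoothing_derive S S' i0 n x : (i0 < n)%nat -> S i0 = false -> S' i0 = true ->
  (forall i, i <> i0 -> S i = S' i) ->
  is_derive (smoothing w S f n) x (smoothing w S' f n x).
Proof.
  intros Hi0 HS HS' HSS; revert x; induction Hi0 as [|n Hi IH]; intros x; simpl.
  - rewrite HS, HS'.
    replace (difference (w i0) (smoothing w S' f i0) x)
      with (difference (w i0) (smoothing w S f i0) x).
    + apply (average_derive _ _ _ _ (hw i0) (smoothing_lipschitz S i0)).
    + unfold difference; rewrite !(smoothing_ext S S' i0) by (intros; apply HSS; lia).
      reflexivity.
  - rewrite <- (HSS n) by lia; destruct (S n).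
    + apply difference_derive, IH.
    + rewrite (average_derive_inside _ _ _ _ _ (hw n) (smoothing_lipschitz S' n) IH).
      apply (average_derive _ _ _ _ (hw n) (smoothing_lipschitz S n)).
Qed.

(** Away from the ends by the total width of the boxes, averages reproduce a constant and a single
    difference kills it. The value 1 gives the plateau at the origin, the value 0 the support. *)
Lemma smoothing_const S a b c n x : (forall y, a <= y <= b -> f y = c) ->
  a + bsum w n <= x <= b - bsum w n ->
  (exists i, (i < n)%nat /\ S i = true) /\ smoothing w S f n x = 0 \/
  (forall i, (i < n)%nat -> S i = false) /\ smoothing w S f n x = c.
Proof.
  intros Hf; revert x; induction n as [|n IH]; intros x Hx; simpl in *.
  - right; split; [lia|apply Hf; lra].
  - assert (Hn := hw n); destruct (S n) eqn:E.
    + left; split; [exists n; auto|].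
      unfold difference.
      destruct (IH (x + w n / 2)) as [[H1 E1]|[H1 E1]]; [lra| |];
      (destruct (IH (x - w n / 2)) as [[H2 E2]|[H2 E2]]; [lra| |]);
      rewrite E1, E2.
      * field; lra.
      * destruct H1 as [i [Hi Hs]]; rewrite H2 in Hs by auto; discriminate.
      * destruct H2 as [i [Hi Hs]]; rewrite H1 in Hs by auto; discriminate.
      * field; lra.
    + assert (Hz : forall v, (forall y, a + bsum w n <= y <= b - bsum w n ->
        smoothing w S f n y = v) -> average (w n) (smoothing w S f n) x = v).
      { intros v Hv; apply (average_const _ _ _ _ _ _ _ (smoothing_lipschitz S n) Hn Hv); lra. }
      destruct (IH x) as [[H1 E1]|[H1 E1]]; [lra| |].
      * left; split; [destruct H1 as [i [Hi Hs]]; exists i; split; [lia|auto]|].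
        apply Hz; intros y Hy; destruct (IH y Hy) as [[_ E2]|[H2 _]]; [exact E2|].
        destruct H1 as [i [Hi Hs]]; rewrite H2 in Hs by auto; discriminate.
      * right; split.
        { intros i Hi; destruct (Nat.eq_dec i n) as [->|Hne]; [exact E|apply H1; lia]. }
        apply Hz; intros y Hy; destruct (IH y Hy) as [[H2 _]|[_ E2]]; [|exact E2].
        destruct H2 as [i [Hi Hs]]; rewrite H1 in Hs by auto; discriminate.
Qed.

Lemma flag_factor_tail S k n : (forall i, (k <= i)%nat -> S i = false) ->
  bprod (flag_factor w S) (k + n) = bprod (flag_factor w S) k.
Proof.
  intros H; rewrite bprod_add, (bprod_ext (fun i => flag_factor w S (k + i)) (fun _ => 1)).
  - rewrite bprod_const, pow1; ring.
  - intros i _; unfold flag_factor; rewrite H by lia; reflexivity.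
Qed.

Definition smooth_limit (S : nat -> bool) (x : R) : R :=
  real (Lim_seq (fun n => smoothing w S f n x)).

(** Past [k] only averages occur; each moves the function by at most a fixed Lipschitz constant
    times its width, and the widths are summable. Without such a [k], [smooth_limit] may be a
    default value. *)
Lemma smooth_limit_correct S k x : (forall i, (k <= i)%nat -> S i = false) ->
  is_lim_seq (fun n => smoothing w S f n x) (smooth_limit S x).
Proof.
  intros HS.
  set (B := bprod (flag_factor w S) k * L).
  assert (Hw : ex_finite_lim_seq (bsum w)).
  { apply ex_finite_lim_seq_incr with X; [|exact hX].
    intros n; simpl; specialize (hw n); lra. }
  destruct Hw as [W HW].
  assert (Hinc : forall n, bsum w n <= W).
  { apply (is_lim_seq_incr_compare _ _ HW); intros n; simpl; specialize (hw n); lra. }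
  assert (HB : 0 <= B).
  { assert (H := smoothing_lipschitz S k 0 1); fold B in H.
    rewrite Rminus_0_r, Rabs_R1 in H.
    assert (P := Rabs_pos (smoothing w S f k 1 - smoothing w S f k 0)); lra. }
  destruct (cauchy_limit (fun n => smoothing w S f (k + n) x)
    (fun n => B * (W - bsum w (k + n)))) as [l [Hl _]].
  - replace (Finite 0) with (Rbar_mult B (W - W)) by (simpl; f_equal; ring).
    apply is_lim_seq_scal_l, is_lim_seq_minus'; [apply is_lim_seq_const|].
    apply (is_lim_seq_incr_n _ k) in HW; eapply is_lim_seq_ext; [|exact HW].
    intros n; simpl; f_equal; lia.
  - intros n j.
    assert (Hj : Rabs (smoothing w S f (k + (n + j)) x - smoothing w S f (k + n) x) <=
      B * (bsum w (k + (n + j)) - bsum w (k + n))).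
    { induction j as [|j IH].
      - rewrite Nat.add_0_r, !Rminus_diag, Rabs_R0; lra.
      - rewrite !Nat.add_succ_r; simpl; rewrite HS by lia.
        assert (A := average_near _ (w (k + (n + j))) _ x
          (smoothing_lipschitz S (k + (n + j))) (hw _)).
        rewrite (flag_factor_tail S k (n + j) HS) in A; fold B in A.
        match goal with |- Rabs (?a - ?c) <= _ =>
          match type of A with Rabs (_ - ?b) <= _ =>
            replace (a - c) with ((a - b) + (b - c)) by ring end end.
        eapply Rle_trans; [apply Rabs_triang|]; lra. }
    eapply Rle_trans; [exact Hj|]; apply Rmult_le_compat_l; [exact HB|].
    specialize (Hinc (k + (n + j))%nat); lra.
  - assert (H : is_lim_seq (fun n => smoothing w S f n x) l).
    { apply (is_lim_seq_incr_n _ k); eapply is_lim_seq_ext; [|exact Hl].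
      intros n; simpl; f_equal; lia. }
    unfold smooth_limit; rewrite (is_lim_seq_unique _ _ H); exact H.
Qed.

Lemma smooth_limit_ext S S' x : (forall i, S i = S' i) -> smooth_limit S x = smooth_limit S' x.
Proof.
  intros H; unfold smooth_limit; f_equal; apply Lim_seq_ext; intros n.
  apply smoothing_ext; auto.
Qed.

Lemma smooth_limit_bound S k x : (forall i, (k <= i)%nat -> S i = false) ->
  Rabs (smooth_limit S x) <= bprod (flag_factor w S) k.
Proof.
  intros HS.
  assert (H := is_lim_seq_abs _ _ (smooth_limit_correct S k x HS)).
  apply (is_lim_seq_incr_n _ k) in H.
  refine (is_lim_seq_le _ (fun _ => bprod (flag_factor w S) k) _ _ _ H (is_lim_seq_const _)).
  intros n; rewrite <- (flag_factor_tail S k n HS), (Nat.add_comm n k).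
  apply smoothing_bound.
Qed.

(** The Lipschitz constant of the derivative does not change past [k], so the quadratic remainder is
    uniform over the stages and survives the limit. *)
Lemma smooth_limit_derive S S' i0 k x :
  S i0 = false -> S' i0 = true -> (forall i, i <> i0 -> S i = S' i) ->
  (forall i, (k <= i)%nat -> S' i = false) ->
  is_derive (smooth_limit S) x (smooth_limit S' x).
Proof.
  intros H0 H1 HSS HS'.
  assert (Hk : (i0 < k)%nat).
  { destruct (Nat.le_gt_cases k i0) as [Q|Q]; [|exact Q].
    rewrite HS' in H1 by auto; discriminate. }
  assert (HS : forall i, (k <= i)%nat -> S i = false)
    by (intros; rewrite HSS by lia; auto).
  set (B := bprod (flag_factor w S') k * L).
  apply (is_derive_quadratic _ x _ B); intros y.
  assert (Hlim : is_lim_seq (fun n => Rabs (smoothing w S f (n + k) y - smoothing w S f (n + k) x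
      - (y - x) * smoothing w S' f (n + k) x))
    (Rabs (smooth_limit S y - smooth_limit S x - (y - x) * smooth_limit S' x))).
  { assert (Hk' : forall T z, (forall i, (k <= i)%nat -> T i = false) ->
      is_lim_seq (fun n => smoothing w T f (n + k) z) (smooth_limit T z)).
    { intros T z HT; apply (is_lim_seq_incr_n (fun n => smoothing w T f n z) k).
      apply (smooth_limit_correct T k z HT). }
    apply (is_lim_seq_abs _ (Finite _)).
    apply is_lim_seq_minus'; [apply is_lim_seq_minus'; auto|].
    apply (is_lim_seq_scal_l _ _ (Finite _)); auto. }
  refine (is_lim_seq_le _ (fun _ => B * (y - x) ^ 2) _ _ _ Hlim (is_lim_seq_const _)).
  intros n; apply (lipschitz_derive_quadratic (smoothing w S f (n + k))).
  - intros z; apply (smoothing_derive S S' i0); auto; lia.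
  - rewrite Nat.add_comm; unfold B; rewrite <- (flag_factor_tail S' k n HS').
    apply smoothing_lipschitz.
Qed.

Lemma smooth_limit_const S k a b c x : (forall i, (k <= i)%nat -> S i = false) ->
  (forall y, a <= y <= b -> f y = c) -> a + X <= x <= b - X ->
  (exists i, S i = true) /\ smooth_limit S x = 0 \/
  (forall i, S i = false) /\ smooth_limit S x = c.
Proof.
  intros HS Hf Hx.
  assert (Hall : forall n, a + bsum w n <= x <= b - bsum w n)
    by (intros n; specialize (hX n); lra).
  assert (Hl := smooth_limit_correct S k x HS); apply (is_lim_seq_incr_n _ k) in Hl.
  destruct (smoothing_const S a b c k x Hf (Hall k)) as [[[i [Hi E]] _]|[E _]].
  - left; split; [exists i; exact E|].
    apply is_lim_seq_unique in Hl.
    rewrite (Lim_seq_ext _ (fun _ => 0)), Lim_seq_const in Hl by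
      (intros n; destruct (smoothing_const S a b c (n + k) x Hf (Hall _)) as [[_ Q]|[Q _]];
       [exact Q|rewrite Q in E by lia; discriminate]).
    injection Hl; auto.
  - assert (Ef : forall i, S i = false).
    { intros i; destruct (Nat.le_gt_cases k i); auto. }
    right; split; [exact Ef|].
    apply is_lim_seq_unique in Hl.
    rewrite (Lim_seq_ext _ (fun _ => c)), Lim_seq_const in Hl by
      (intros n; destruct (smoothing_const S a b c (n + k) x Hf (Hall _)) as [[[i [_ Q]] _]|[_ Q]];
       [rewrite Ef in Q; discriminate|exact Q]).
    injection Hl; auto.
Qed.

End Smoothing.

(** Equal to 1 on $[-X,X]$ and to 0 outside $[-2X,2X]$: boxes of total width at most [X] keep the
    value 1 at the origin and the support in $[-3X,3X]$. *)
Definition trapezoid (X x : R) : R := Rmax 0 (Rmin 1 (2 - Rabs x / X)).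

Lemma trapezoid_lipschitz X : 0 < X -> lipschitz (/ X) (trapezoid X).
Proof.
  intros HX x y; unfold trapezoid, Rdiv.
  assert (H : Rabs (Rabs y * / X - Rabs x * / X) <= / X * Rabs (y - x)).
  { replace (Rabs y * / X - Rabs x * / X) with (/ X * (Rabs y - Rabs x)) by ring.
    rewrite Rabs_mult, (Rabs_pos_eq (/ X)) by (left; apply Rinv_0_lt_compat; auto).
    apply Rmult_le_compat_l; [left; apply Rinv_0_lt_compat; auto|apply Rabs_triang_inv2]. }
  eapply Rle_trans; [|exact H].
  set (u := Rabs x * / X); set (v := Rabs y * / X).
  assert (A1 := Rle_abs (v - u)); assert (A2 := Rle_abs (- (v - u))); rewrite Rabs_Ropp in A2.
  apply Rabs_le; unfold Rmax, Rmin; repeat destruct Rle_dec; lra.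
Qed.

(** The last clause holds for every splitting of the order as [a + b]: the derivatives may be
    charged to the first [a] boxes and to [b] boxes further on, skipping those in between. *)
Lemma cutoff (w : nat -> R) (X : R) : (forall i, 0 < w i) -> 0 < X -> (forall n, bsum w n <= X) ->
  exists F, tower F /\ F 0%nat 0 = 1 /\ (forall m, (1 <= m)%nat -> F m 0 = 0) /\
    (forall m x, 3 * X <= Rabs x -> F m x = 0) /\
    forall a b k x, (a <= k)%nat ->
      Rabs (F (a + b)%nat x) <=
        bprod (fun i => 2 / w i) a * bprod (fun i => 2 / w (k + i)%nat) b.
Proof.
  intros hw HX hX.
  assert (hL := trapezoid_lipschitz X HX).
  assert (HiX : 0 < / X) by (apply Rinv_0_lt_compat; auto).
  assert (hf : forall x, Rabs (trapezoid X x) <= 1).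
  { intros x; apply Rabs_le; unfold trapezoid, Rmax, Rmin.
    repeat destruct Rle_dec; lra. }
  set (Q := fun k a b i => (Nat.ltb i a || (Nat.leb k i && Nat.ltb i (k + b)))%bool).
  assert (HQ : forall k a b i, Q k a b i = true <-> (i < a \/ k <= i < k + b)%nat).
  { intros; unfold Q; rewrite Bool.orb_true_iff, Bool.andb_true_iff, !Nat.ltb_lt, Nat.leb_le; lia. }
  assert (HQf : forall k a b i, Q k a b i = false <-> ~ (i < a \/ k <= i < k + b)%nat).
  { intros; rewrite <- HQ; destruct (Q k a b i); split; congruence. }
  set (phi := smooth_limit w (trapezoid X)).
  set (F := fun m => phi (Q 0%nat 0%nat m)).
  assert (HF : tower F).
  { intros m x; apply (smooth_limit_derive w _ X _ hw hX hL _ _ m (S m)).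
    - apply HQf; lia.
    - apply HQ; lia.
    - intros i Hi; destruct (Q 0%nat 0%nat (S m) i) eqn:E.
      + apply HQ in E; apply HQ; lia.
      + apply HQf in E; apply HQf; lia.
    - intros i Hi; apply HQf; lia. }
  assert (Hsup : forall m i, (m <= i)%nat -> Q 0%nat 0%nat m i = false)
    by (intros; apply HQf; lia).
  assert (Hin : forall y, - X <= y <= X -> trapezoid X y = 1).
  { intros y Hy; assert (Rabs y / X <= 1).
    { apply Rle_div_l; [auto|]; rewrite Rmult_1_l; apply Rabs_le, Hy. }
    unfold trapezoid; rewrite Rmin_left, Rmax_right; lra. }
  assert (Hout : forall y, 2 * X <= Rabs y -> trapezoid X y = 0).
  { intros y Hy; assert (2 <= Rabs y / X) by (apply Rle_div_r; auto).
    unfold trapezoid; rewrite Rmin_right, Rmax_left; lra. }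
  exists F; split; [exact HF|]; split; [|split; [|split]].
  - destruct (smooth_limit_const w _ X _ hw hX hL (Q 0 0 0)%nat 0 (- X) X 1 0 (Hsup 0%nat) Hin)
      as [[[i Hi] _]|[_ E]]; [lra| |exact E].
    rewrite Hsup in Hi by lia; discriminate.
  - intros m Hm.
    destruct (smooth_limit_const w _ X _ hw hX hL (Q 0 0 m)%nat m (- X) X 1 0 (Hsup m) Hin)
      as [[_ E]|[E _]]; [lra|exact E|].
    specialize (E 0%nat); rewrite (proj2 (HQ 0 0 m 0)%nat) in E by lia; discriminate.
  - intros m x Hx.
    assert (HXx : forall a b, (forall y, a <= y <= b -> 2 * X <= Rabs y) ->
      a + X <= x <= b - X -> F m x = 0).
    { intros a b Hab Hxab.
      destruct (smooth_limit_const w _ X _ hw hX hL (Q 0 0 m)%nat m a b 0 x (Hsup m))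
        as [[_ E]|[_ E]]; auto. }
    unfold Rabs in Hx; destruct (Rcase_abs x) as [Hneg|Hpos].
    + apply (HXx (x - X) (- (2 * X))); [|lra].
      intros y Hy; rewrite <- Rabs_Ropp; eapply Rle_trans; [|apply Rle_abs]; lra.
    + apply (HXx (2 * X) (x + X)); [|lra].
      intros y Hy; eapply Rle_trans; [|apply Rle_abs]; lra.
  - intros a b k x Hak.
    (* Both sides are derivatives of the same order of one function, though the flags sit at
       different boxes; induction on [b] and uniqueness of derivatives identify them. *)
    assert (E : forall x, phi (Q k a b) x = F (a + b)%nat x).
    { clear x; induction b as [|b IH]; intros x.
      - apply smooth_limit_ext; intros i.
        destruct (Q 0 0 (a + 0) i)%nat eqn:E.
        + apply HQ in E; apply HQ; lia.
        + apply HQf in E; apply HQf; lia.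
      - assert (D : is_derive (phi (Q k a b)) x (phi (Q k a (S b)) x)).
        { apply (smooth_limit_derive w _ X _ hw hX hL _ _ (k + b) (S (k + b))).
          - apply HQf; lia.
          - apply HQ; lia.
          - intros i Hi; destruct (Q k a (S b) i) eqn:E.
            + apply HQ in E; apply HQ; lia.
            + apply HQf in E; apply HQf; lia.
          - intros i Hi; apply HQf; lia. }
        apply (is_derive_ext _ _ _ _ IH) in D.
        rewrite Nat.add_succ_r, <- (is_derive_unique _ _ _ D).
        apply is_derive_unique, HF. }
    rewrite <- E.
    eapply Rle_trans; [apply (smooth_limit_bound w _ X _ hw hX hL hf _ (k + b))|].
    { intros i Hi; apply HQf; lia. }
    rewrite bprod_add; replace k with (a + (k - a))%nat at 2 by lia.
    rewrite bprod_add, (bprod_ext (fun i => flag_factor w (Q k a b) (a + i)) (fun _ => 1)).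
    + rewrite bprod_const, pow1, Rmult_1_r; right; f_equal; apply bprod_ext; intros i Hi;
        unfold flag_factor; rewrite (proj2 (HQ _ _ _ _)) by lia; reflexivity.
    + intros i Hi; unfold flag_factor; rewrite (proj2 (HQf _ _ _ _)) by lia; reflexivity.
Qed.

(** * Slowly growing sequences *)

Lemma lim_p_infty_iff u :
  is_lim_seq u p_infty <-> forall H, exists n, forall k, (n <= k)%nat -> H < u k.
Proof. rewrite <- is_lim_seq_spec; reflexivity. Qed.

(** The infimum of [u] over the indices from [k] on. *)
Lemma monotone_minorant u : is_lim_seq u p_infty -> (forall k, 1 <= u k) ->
  exists g, (forall k, 1 <= g k <= u k) /\ (forall k, g k <= g (S k)) /\ is_lim_seq g p_infty.
Proof.
  intros Hu H1; rewrite lim_p_infty_iff in Hu.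
  set (E := fun k v => exists q, (k <= q)%nat /\ v = u q).
  assert (HE : forall k b, (forall q, (k <= q)%nat -> b <= u q) ->
    b <= real (Glb_Rbar (E k)) <= u k).
  { intros k b Hb; destruct (Glb_Rbar_correct (E k)) as [G1 G2].
    assert (A1 : Rbar_le b (Glb_Rbar (E k))).
    { apply G2; intros v [q [Hq ->]]; apply Hb, Hq. }
    assert (A2 : Rbar_le (Glb_Rbar (E k)) (u k)).
    { apply G1; exists k; auto. }
    destruct (Glb_Rbar (E k)); simpl in *; try contradiction; auto. }
  exists (fun k => real (Glb_Rbar (E k))); split; [|split].
  - intros k; apply HE; auto.
  - intros k; apply HE; intros q Hq.
    destruct (Glb_Rbar_correct (E k)) as [G1 _].
    assert (A1 : Rbar_le (Glb_Rbar (E k)) (u q)) by (apply G1; exists q; split; [lia|auto]).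
    destruct (HE k 1) as [A2 A3]; [auto|].
    destruct (Glb_Rbar (E k)); simpl in *; auto.
    + specialize (H1 q); lra.
    + specialize (H1 q); lra.
  - apply lim_p_infty_iff; intros H; destruct (Hu (H + 1)) as [n Hn]; exists n.
    intros k Hk; assert (Q := HE k (H + 1)); destruct Q as [Q _]; [|lra].
    intros q Hq; left; apply Hn; lia.
Qed.

(** [c] grows as fast as it may under two caps: the ratio of consecutive terms of [e], and the
    increasing minorant [g] of [u]. *)
Lemma slow_sequence e u :
  (forall k, 0 < e k <= e (S k)) -> is_lim_seq e p_infty -> is_lim_seq u p_infty ->
  exists c, (forall k, 1 <= c k <= c (S k)) /\ is_lim_seq c p_infty /\
    (forall k, c (S k) / e (S k) <= c k / e k) /\
    exists k0, forall k, (k0 <= k)%nat -> c k <= u k.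
Proof.
  intros He Le Lu.
  assert (Lu' : is_lim_seq (fun k => Rmax (u k) 1) p_infty).
  { apply (is_lim_seq_le_p_loc u); [|exact Lu]; exists 0%nat; intros; apply Rmax_l. }
  destruct (monotone_minorant _ Lu' (fun k => Rmax_r _ _)) as [g [G1 [G2 G3]]].
  set (c := fix c k := match k with O => g 0%nat
    | S m => Rmin (c m * (e (S m) / e m)) (g (S m)) end).
  assert (Hcg : forall k, c k <= g k) by (intros [|k]; simpl; [lra|apply Rmin_r]).
  assert (Hrho : forall k, 1 <= e (S k) / e k).
  { intros k; apply Rle_div_r; [apply He|]; rewrite Rmult_1_l; apply He. }
  assert (Hc1 : forall k, 1 <= c k).
  { induction k as [|k IH]; simpl; [apply G1|].
    specialize (Hrho k); apply Rmin_glb; [nra|apply G1]. }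
  assert (Hcm : forall k, c k <= c (S k)).
  { intros k; simpl; specialize (Hrho k); specialize (Hc1 k); apply Rmin_glb; [nra|].
    eapply Rle_trans; [apply Hcg|apply G2]. }
  exists c; split; [auto|split; [|split]].
  - apply lim_p_infty_iff; intros H; rewrite lim_p_infty_iff in G3, Le.
    destruct (G3 H) as [n Hn].
    assert (P := He n); assert (Q := Hc1 n).
    set (kap := c n / e n); assert (Hkap : 0 < kap) by (apply Rdiv_lt_0_compat; lra).
    destruct (Le (H / kap)) as [m Hm].
    exists (n + m)%nat; intros k Hk.
    (* From [n] on, either [g] was the active cap at some index, and then [c] is at least [g n] ever
       after, or [c] has grown in proportion to [e]. *)
    assert (Hmin : forall i, Rmin (Rmin (g n) (g (n + i)%nat)) (kap * e (n + i)%nat) <= c (n + i)%nat).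
    { induction i as [|i IH].
      - rewrite Nat.add_0_r; eapply Rle_trans; [apply Rmin_r|].
        unfold kap; right; field; lra.
      - rewrite Nat.add_succ_r; simpl c.
        assert (P' := He (n + i)%nat); assert (Q' := Hrho (n + i)%nat).
        assert (G2' := G2 (n + i)%nat); assert (G1' := G1 n); assert (G1'' := G1 (n + i)%nat).
        assert (E : kap * e (S (n + i)) = kap * e (n + i)%nat * (e (S (n + i)) / e (n + i)%nat))
          by (field; lra).
        rewrite E; apply Rmin_glb; [|eapply Rle_trans; [apply Rmin_l|apply Rmin_r]].
        apply Rle_trans with (Rmin (Rmin (g n) (g (n + i)%nat)) (kap * e (n + i)%nat)
          * (e (S (n + i)) / e (n + i)%nat)); [|apply Rmult_le_compat_r; lra].
        assert (Hgi : forall j, g n <= g (n + j)%nat).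
        { induction j as [|j IHj]; [rewrite Nat.add_0_r; lra|].
          rewrite Nat.add_succ_r; eapply Rle_trans; [exact IHj|apply G2]. }
        rewrite (Rmin_left (g n) (g (n + i)%nat)) by apply Hgi.
        rewrite (Rmin_left (g n) (g (S (n + i)))) by (rewrite <- Nat.add_succ_r; apply Hgi).
        set (z := kap * e (n + i)%nat) in *; assert (0 < z) by (apply Rmult_lt_0_compat; lra).
        set (rho := e (S (n + i)) / e (n + i)%nat) in *.
        unfold Rmin; repeat destruct Rle_dec; nra. }
    specialize (Hmin (k - n)%nat); replace (n + (k - n))%nat with k in Hmin by lia.
    eapply Rlt_le_trans; [|exact Hmin].
    apply Rmin_glb_lt; [apply Rmin_glb_lt; apply Hn; lia|].
    specialize (Hm k ltac:(lia)); apply (proj1 (Rlt_div_l _ _ _ Hkap)) in Hm; lra.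
  - intros k; simpl c.
    assert (P := He k); assert (P' := He (S k)).
    apply Rle_div_l; [lra|]; eapply Rle_trans; [apply Rmin_l|]; right; field; lra.
  - rewrite lim_p_infty_iff in Lu; destruct (Lu 1) as [k0 Hk0]; exists k0.
    intros k Hk; specialize (Hk0 k Hk); eapply Rle_trans; [apply Hcg|].
    eapply Rle_trans; [apply G1|]; rewrite Rmax_left; lra.
Qed.

(* With [tau] the tail sums of [b], weights [c <= const / sqrt tau] barely
   increase the tails: [b k / sqrt (tau k)] telescopes. *)
Lemma slow_weights b u : (forall k, 0 < b k) -> ex_series b -> is_lim_seq u p_infty ->
  exists c, (forall k, 1 <= c k <= c (S k)) /\ is_lim_seq c p_infty /\
    (forall p n, bsum (fun i => c (p + i)%nat * b (p + i)%nat) n <=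
      2 * c p * Series (fun i => b (p + i)%nat)) /\
    exists k0, forall k, (k0 <= k)%nat -> c k <= u k.
Proof.
  intros Hb [l Hl] Hu.
  assert (Hlim : is_lim_seq (bsum b) l).
  { apply is_lim_seq_incr_1; eapply is_lim_seq_ext; [|exact Hl]; intros; apply sum_n_bsum. }
  assert (Hlt : forall k, bsum b k < l).
  { intros k; apply Rlt_le_trans with (bsum b (S k)); [simpl; specialize (Hb k); lra|].
    apply (is_lim_seq_incr_compare _ _ Hlim); intros n; simpl; specialize (Hb n); lra. }
  set (tau := fun k => l - bsum b k).
  assert (Ht : forall k, 0 < tau k) by (intros k; unfold tau; specialize (Hlt k); lra).
  assert (HtS : forall k, tau k = b k + tau (S k)) by (intros; unfold tau; simpl; ring).
  assert (Htau : forall p, tau p = Series (fun i => b (p + i)%nat)).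
  { intros [|p].
    - change (tau 0%nat = Series b); rewrite (is_series_unique _ _ Hl); unfold tau; simpl; ring.
    - assert (E := Series_incr_n b (S p) ltac:(lia) (ex_intro _ l Hl)).
      rewrite (is_series_unique _ _ Hl) in E; simpl pred in E.
      rewrite sum_f_R0_bsum in E.
      unfold tau; rewrite E; ring. }
  assert (Hs : forall k, 0 < sqrt (tau k)) by (intros; apply sqrt_lt_R0; auto).
  assert (Hss : forall k, sqrt (tau (S k)) < sqrt (tau k)).
  { intros k; apply sqrt_lt_1_alt; split; [left; auto|]; rewrite (HtS k); specialize (Hb k); lra. }
  assert (Hsq : forall k, sqrt (tau k) * sqrt (tau k) = tau k)
    by (intros; apply sqrt_def; left; auto).
  destruct (slow_sequence (fun k => / sqrt (tau k)) u) as [c [C1 [C2 [C3 C4]]]]; auto.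
  { intros k; split; [apply Rinv_0_lt_compat; auto|].
    apply Rinv_le_contravar; [auto|left; auto]. }
  { apply lim_p_infty_iff; intros H.
    assert (Hd : 0 < / (Rabs H + 1) ^ 2).
    { apply Rinv_0_lt_compat, pow_lt; assert (P := Rabs_pos H); lra. }
    destruct (proj2 (is_lim_seq_spec _ _) Hlim (mkposreal _ Hd)) as [n Hn]; exists n.
    intros k Hk; specialize (Hn k Hk); simpl in Hn.
    assert (Ht' : tau k < / (Rabs H + 1) ^ 2).
    { unfold tau; apply Rabs_def2 in Hn; simpl; lra. }
    assert (P := Rabs_pos H); assert (P' := Rle_abs H).
    apply Rle_lt_trans with (Rabs H); [exact P'|].
    apply Rlt_trans with (Rabs H + 1); [lra|].
    rewrite <- (Rinv_inv (Rabs H + 1)); apply Rinv_lt_contravar.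
    - apply Rmult_lt_0_compat; [auto|apply Rinv_0_lt_compat; lra].
    - apply (pow_lt_reg _ _ 2); [left; apply Rinv_0_lt_compat; lra|].
      rewrite pow_inv; replace (sqrt (tau k) ^ 2) with (sqrt (tau k) * sqrt (tau k)) by ring; rewrite Hsq.
      exact Ht'. }
  exists c; split; [exact C1|split; [exact C2|split; [|exact C4]]].
  intros p n; rewrite <- Htau.
  assert (Hdec : forall i, c (p + i)%nat * sqrt (tau (p + i)%nat) <= c p * sqrt (tau p)).
  { induction i as [|i IH]; [rewrite Nat.add_0_r; lra|].
    rewrite Nat.add_succ_r; eapply Rle_trans; [|exact IH].
    specialize (C3 (p + i)%nat); unfold Rdiv in C3; rewrite !Rinv_inv in C3; exact C3. }
  assert (Hsum : bsum (fun i => c (p + i)%nat * b (p + i)%nat) n <=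
    2 * (c p * sqrt (tau p)) * (sqrt (tau p) - sqrt (tau (p + n)%nat))).
  { induction n as [|n IH]; [simpl; rewrite Nat.add_0_r; lra|].
    simpl bsum; rewrite Nat.add_succ_r.
    set (k := (p + n)%nat) in *; specialize (Hdec n); fold k in Hdec.
    assert (H : c k * b k <= 2 * (c p * sqrt (tau p)) * (sqrt (tau k) - sqrt (tau (S k)))); [|lra].
    replace (b k) with ((sqrt (tau k) - sqrt (tau (S k))) * (sqrt (tau k) + sqrt (tau (S k))))
      by (apply Rplus_eq_reg_r with (tau (S k)); rewrite <- HtS;
          assert (E1 := Hsq k); assert (E2 := Hsq (S k)); lra).
    specialize (Hss k); assert (Hk := Hs (S k)); specialize (C1 k).
    apply Rle_trans with (2 * (c k * sqrt (tau k)) * (sqrt (tau k) - sqrt (tau (S k)))).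
    - assert (0 <= c k * (sqrt (tau k) - sqrt (tau (S k))) * (sqrt (tau k) - sqrt (tau (S k)))); [|lra].
      apply Rmult_le_pos; [apply Rmult_le_pos|]; lra.
    - apply Rmult_le_compat_r; lra. }
  eapply Rle_trans; [exact Hsum|].
  rewrite <- (Hsq p) at 3; specialize (Hs p); assert (Hp := Hs); assert (C1p := C1 p).
  assert (0 < sqrt (tau (p + n)%nat)) by (apply sqrt_lt_R0; auto).
  assert (0 <= 2 * (c p * sqrt (tau p)) * sqrt (tau (p + n)%nat)); [|lra].
  apply Rmult_le_pos; [|lra]; apply Rmult_le_pos; [lra|]; apply Rmult_le_pos; lra.
Qed.

(** Only finitely many factors exceed 1. With [v] a power of [c], this beats any geometric factor,
    as a bound for every [h] requires. *)
Lemma prod_decay v D : (forall i, 0 < v i) -> is_lim_seq v p_infty -> 0 < D ->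
  exists A, forall n, bprod (fun i => D / v i) n <= A.
Proof.
  intros Hv Lv HD; rewrite lim_p_infty_iff in Lv; destruct (Lv D) as [K HK].
  set (t := bprod (fun i => D / v i)).
  assert (Ht : forall n, 0 < t n) by (intros; apply bprod_pos; intros; apply Rdiv_lt_0_compat; auto).
  assert (Hle : forall n, (n <= K)%nat -> t n <= bsum t (S K)).
  { intros n Hn; apply Rle_trans with (bsum t (S n)).
    - simpl; assert (P := bsum_nonneg t n (fun i => Rlt_le _ _ (Ht i))); lra.
    - apply bsum_mono; [intros; left; auto|lia]. }
  exists (bsum t (S K)); intros n; fold (t n).
  destruct (Nat.le_gt_cases n K) as [Hn|Hn]; [auto|].
  replace n with (K + (n - K))%nat by lia; induction (n - K)%nat as [|k IH].
  - rewrite Nat.add_0_r; auto.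
  - rewrite Nat.add_succ_r; eapply Rle_trans; [|exact IH]; unfold t at 1; simpl; fold (t (K + k)%nat).
    assert (D / v (K + k)%nat <= 1).
    { apply Rle_div_l; [auto|]; specialize (HK (K + k)%nat ltac:(lia)); lra. }
    specialize (Ht (K + k)%nat); nra.
Qed.

Lemma Rpower_root_lim u n : (1 <= n)%nat -> (forall k, 0 < u k) -> is_lim_seq u p_infty ->
  is_lim_seq (fun k => Rpower (u k) (1 / INR n)) p_infty.
Proof.
  intros Hn Hu Lu; rewrite lim_p_infty_iff in *; intros H.
  destruct (Lu (Rabs H ^ n)) as [K HK]; exists K; intros k Hk.
  eapply Rle_lt_trans; [apply Rle_abs|].
  apply (pow_lt_reg _ _ n); [left; apply Rpower_pos|].
  rewrite Rpower_root_pow by auto; auto.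
Qed.

Lemma Lambda_root_growth M a : (forall p, 0 < M p) -> RLambda M a ->
  exists b, (forall p, 0 < b p) /\ is_lim_seq b p_infty /\
    forall p, (1 <= p)%nat -> Rabs (a p) * b p ^ p <= M p.
Proof.
  intros HM Ha.
  (* Where [a p = 0] any positive value tending to infinity serves. *)
  exists (fun p => if Req_EM_T (a p) 0 then INR p + 1 else Rpower (M p / Rabs (a p)) (1 / INR p)).
  split; [|split].
  - intros p; destruct (Req_EM_T (a p) 0); [assert (P := pos_INR p); lra|apply Rpower_pos].
  - apply lim_p_infty_iff; intros H.
    set (H' := Rabs H + 1); assert (HH : H < H') by (unfold H'; assert (P := Rle_abs H); lra).
    assert (HH0 : 0 < H') by (unfold H'; assert (P := Rabs_pos H); lra).
    (* The extra 2 produces a factor [2 ^ p] that eventually absorbs the constant [A]. *)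
    destruct (Ha (/ (2 * H'))) as [A HA]; [apply Rinv_0_lt_compat; lra|].
    destruct (INR_above (Rmax A H')) as [n [Hn1 Hn]]; exists n; intros p Hp.
    assert (Hnp : INR n <= INR p) by (apply le_INR; auto).
    assert (HAn := Rmax_l A H'); assert (HHn := Rmax_r A H').
    destruct (Req_EM_T (a p) 0) as [E|E]; [lra|].
    apply Rlt_trans with H'; [exact HH|].
    apply (pow_lt_reg _ _ p); [left; apply Rpower_pos|].
    assert (Ea : 0 < Rabs (a p)) by (apply Rabs_pos_lt, E).
    rewrite Rpower_root_pow by (try lia; apply Rdiv_lt_0_compat; auto).
    apply (proj1 (Rlt_div_r _ _ _ Ea)).
    specialize (HA p); specialize (HM p).
    assert (HP : 0 < H' ^ p) by (apply pow_lt; auto).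
    assert (H2 : 0 < 2 ^ p) by (apply pow_lt; lra).
    rewrite pow_inv, Rpow_mult_distr in HA.
    apply Rle_lt_trans with (H' ^ p * (A * (/ (2 ^ p * H' ^ p) * M p))).
    + apply Rmult_le_compat_l; [left; auto|exact HA].
    + replace (H' ^ p * (A * (/ (2 ^ p * H' ^ p) * M p))) with (A / 2 ^ p * M p) by (field; lra).
      assert (A / 2 ^ p < 1); [|nra].
      apply (proj2 (Rlt_div_l _ _ _ H2)); rewrite Rmult_1_l.
      assert (INR p < 2 ^ p); [|lra].
      change 2 with (INR 2); rewrite <- pow_INR; apply lt_INR, Nat.pow_gt_lin_r; lia.
  - intros p Hp; destruct (Req_EM_T (a p) 0) as [E|E].
    + rewrite E, Rabs_R0, Rmult_0_l; left; auto.
    + assert (Ea : 0 < Rabs (a p)) by (apply Rabs_pos_lt, E).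
      rewrite Rpower_root_pow by (auto; apply Rdiv_lt_0_compat; auto).
      right; field; lra.
Qed.

(** * Products and series of towers *)

(** The [m]-th derivative of the product of [F i] and [G j], expanded as a binary tree with [2 ^ m]
    leaves in place of binomial coefficients. *)
Fixpoint leibniz (F G : nat -> R -> R) (m i j : nat) (x : R) : R :=
  match m with
  | O => F i x * G j x
  | S m => leibniz F G m (S i) j x + leibniz F G m i (S j) x
  end.

Lemma leibniz_tower F G : tower F -> tower G -> tower (fun m => leibniz F G m 0 0).
Proof.
  intros HF HG.
  assert (H : forall m i j x, is_derive (leibniz F G m i j) x (leibniz F G (S m) i j x)).
  { induction m as [|m IH]; intros i j x; simpl.
    - apply (is_derive_mult (F i) (G j) x _ _ (HF i x) (HG j x) Rmult_comm).
    - apply (is_derive_plus (leibniz F G m (S i) j) (leibniz F G m i (S j))); apply IH. }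
  intros m x; apply H.
Qed.

Lemma leibniz_bound F G m x W :
  (forall i j, (i + j = m)%nat -> Rabs (F i x * G j x) <= W) ->
  Rabs (leibniz F G m 0 0 x) <= 2 ^ m * W.
Proof.
  intros H.
  assert (HW : forall k i j, (k + i + j = m)%nat -> Rabs (leibniz F G k i j x) <= 2 ^ k * W).
  { induction k as [|k IH]; intros i j Hk; simpl.
    - rewrite Rmult_1_l; apply H; lia.
    - eapply Rle_trans; [apply Rabs_triang|].
      assert (H1 := IH (S i) j ltac:(lia)); assert (H2 := IH i (S j) ltac:(lia)); lra. }
  apply HW; lia.
Qed.

Lemma leibniz_flat F G m x : (forall j, (1 <= j)%nat -> G j x = 0) ->
  leibniz F G m 0 0 x = F m x * G 0%nat x.
Proof.
  intros H.
  assert (HW : forall k i, leibniz F G k i 0 x = F (k + i)%nat x * G 0%nat x /\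
    forall j, (1 <= j)%nat -> leibniz F G k i j x = 0).
  { induction k as [|k IH]; intros i; simpl; [split; [reflexivity|]|split].
    - intros j Hj; rewrite H by auto; ring.
    - destruct (IH (S i)) as [-> _]; destruct (IH i) as [_ E]; rewrite E by lia.
      rewrite Nat.add_succ_r; ring.
    - intros j Hj; destruct (IH (S i)) as [_ E1]; destruct (IH i) as [_ E2].
      rewrite E1, E2 by lia; ring. }
  destruct (HW m 0%nat) as [E _]; rewrite Nat.add_0_r in E; exact E.
Qed.

(** The tower of $x^q/q!$. *)
Definition monomial (q i : nat) (x : R) : R :=
  if Nat.leb i q then x ^ (q - i) / INR (fact (q - i)) else 0.

Lemma monomial_tower q : tower (monomial q).
Proof.
  intros i x; unfold monomial.
  destruct (Nat.leb_spec i q) as [H|H].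
  - destruct (Nat.leb_spec (S i) q) as [H'|H'].
    + replace (q - i)%nat with (S (q - S i)) by lia; set (d := (q - S i)%nat).
      assert (Hf := INR_fact_neq_0 d); assert (Hp := pos_INR d).
      rewrite fact_simpl, mult_INR.
      replace (x ^ d / INR (fact d)) with
        (/ (INR (S d) * INR (fact d)) * (INR (S d) * 1 * x ^ pred (S d)))
        by (simpl pred; rewrite S_INR; field; split; lra).
      apply (is_derive_ext (fun x => / (INR (S d) * INR (fact d)) * x ^ S d));
        [intros t; apply Rmult_comm|].
      apply is_derive_scal, (is_derive_pow (fun x => x)), (is_derive_id (K := R_AbsRing)).
    + replace (q - i)%nat with 0%nat by lia.
      apply (is_derive_ext (fun _ => 1)); [intros; simpl; field|].
      apply (is_derive_const (V := R_NormedModule)).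
  - destruct (Nat.leb_spec (S i) q) as [H'|H']; [lia|].
    apply (is_derive_const (V := R_NormedModule)).
Qed.

Lemma monomial_0 q i : monomial q i 0 = if Nat.eqb i q then 1 else 0.
Proof.
  unfold monomial; destruct (Nat.eqb_spec i q) as [->|H].
  - rewrite Nat.leb_refl, Nat.sub_diag; simpl; field.
  - destruct (Nat.leb_spec i q) as [H'|H']; [|reflexivity].
    rewrite pow_i by lia; unfold Rdiv; ring.
Qed.

Lemma monomial_bound q i x X : Rabs x <= X -> (i <= q)%nat ->
  Rabs (monomial q i x) <= X ^ (q - i) / INR (fact (q - i)).
Proof.
  intros Hx Hi; unfold monomial; rewrite (proj2 (Nat.leb_le _ _) Hi).
  assert (Hf : 0 < / INR (fact (q - i))) by (apply Rinv_0_lt_compat, lt_0_INR, lt_O_fact).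
  unfold Rdiv; rewrite Rabs_mult, (Rabs_pos_eq (/ _)) by lra.
  apply Rmult_le_compat_r; [lra|].
  rewrite <- RPow_abs; apply pow_incr; split; [apply Rabs_pos|exact Hx].
Qed.

(** The quadratic remainders at order [m] are controlled by the derivatives of order [m + 2] and can
    be summed, which replaces an argument by uniform convergence. *)
Lemma tower_series (F : nat -> nat -> R -> R) (B : nat -> nat -> R) :
  (forall p, tower (F p)) -> (forall p m x, Rabs (F p m x) <= B m p) ->
  (forall m, ex_series (B m)) ->
  tower (fun m x => Series (fun p => F p m x)).
Proof.
  intros HF HB HS.
  assert (Hex : forall m x, ex_series (fun p => F p m x)).
  { intros m x; apply (ex_series_le (V := R_CompleteNormedModule) _ (B m)); [|auto].
    intros p; apply HB. }
  intros m x; apply (is_derive_quadratic _ _ _ (Series (B (S (S m))))); intros y.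
  rewrite <- Series_scal_l, <- Series_minus by auto.
  rewrite <- Series_minus; [|apply (ex_series_minus (V := R_NormedModule)); auto|
    apply (ex_series_scal (V := R_NormedModule) (y - x)); auto].
  rewrite <- Series_scal_r.
  assert (Hterm : forall p, Rabs (F p m y - F p m x - (y - x) * F p (S m) x) <=
    B (S (S m)) p * (y - x) ^ 2).
  { intros p; apply lipschitz_derive_quadratic; [apply HF|].
    apply tower_lipschitz; [apply HF|]; intros; apply HB. }
  assert (HBs : ex_series (fun p => B (S (S m)) p * (y - x) ^ 2))
    by (apply ex_series_scal_r; auto).
  assert (Hab : ex_series (fun p => Rabs (F p m y - F p m x - (y - x) * F p (S m) x))).
  { apply (ex_series_le (V := R_CompleteNormedModule) _ (fun p => B (S (S m)) p * (y - x) ^ 2)); auto.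
    intros p; eapply Rle_trans; [|apply Hterm]; apply Req_le, Rabs_Rabsolu. }
  eapply Rle_trans; [apply Series_Rabs, Hab|].
  apply Series_le; [|exact HBs]; intros p; split; [apply Rabs_pos|apply Hterm].
Qed.

Lemma Series_single j v : Series (fun p => if Nat.eqb p j then v else 0) = v.
Proof.
  apply is_series_unique.
  apply (is_lim_seq_ext_loc (fun _ => v) _ (Finite v)); [|apply is_lim_seq_const].
  exists j; intros n Hn; rewrite sum_n_bsum.
  assert (H : forall k, bsum (fun p => if Nat.eqb p j then v else 0) k =
    if Nat.ltb j k then v else 0).
  { induction k as [|k IH]; [reflexivity|]; simpl; rewrite IH.
    destruct (Nat.eqb_spec k j), (Nat.ltb_spec j k), (Nat.ltb_spec j (S k)); try lia; ring. }
  rewrite H; destruct (Nat.ltb_spec j (S n)); [reflexivity|lia].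
Qed.

(** Each integration from the point 1, where everything vanishes, covers a length of at most 2. *)
Lemma vanishing_tower_bound F m k B : tower F -> (forall i x, 1 <= Rabs x -> F i x = 0) ->
  (forall x, Rabs (F (m + k)%nat x) <= B) -> forall x, Rabs (F m x) <= 2 ^ k * B.
Proof.
  intros HF HV; revert B; induction k as [|k IH]; intros B HB x.
  - rewrite Nat.add_0_r in HB; simpl; rewrite Rmult_1_l; apply HB.
  - simpl; replace (2 * 2 ^ k * B) with (2 ^ k * (2 * B)) by ring; apply IH; clear x; intros x.
    assert (HB0 : 0 <= B) by (eapply Rle_trans; [apply Rabs_pos|apply (HB 0)]).
    destruct (Rle_or_lt 1 (Rabs x)) as [Hx|Hx].
    + rewrite HV by auto; rewrite Rabs_R0; lra.
    + assert (L := tower_lipschitz F (m + k) B HF).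
      rewrite Nat.add_succ_r in HB; specialize (L HB 1 x).
      rewrite (HV _ 1), Rminus_0_r in L by (rewrite Rabs_R1; lra).
      eapply Rle_trans; [exact L|]; rewrite (Rmult_comm 2 B).
      apply Rmult_le_compat_l; [exact HB0|].
      apply Rabs_def2 in Hx; apply Rabs_le; lra.
Qed.

(** * Sufficiency *)

(** The gain from widening the boxes of the indices [p + 1] to [p + n] by the factors [c]. *)
Definition damping (r : nat) (c : nat -> R) (p n : nat) : R :=
  bprod (fun k => / c (S (p + k)) ^ r) n.

Section Blocks.

Variables (r : nat) (N c : nat -> R).
Hypotheses (hr : (1 <= r)%nat) (hN : LC N) (hc : forall k, 1 <= c k <= c (S k)).

Lemma c_pow_pos k n : 0 < c k ^ n.
Proof. apply pow_lt; destruct (hc k); lra. Qed.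

Lemma c_mono i j : (i <= j)%nat -> c i <= c j.
Proof. induction 1 as [|j _ IH]; [lra|destruct (hc j); lra]. Qed.

Lemma damping_pos p n : 0 < damping r c p n.
Proof. apply bprod_pos; intros; apply Rinv_0_lt_compat, c_pow_pos. Qed.

Lemma damping_add p n : damping r c 0 (p + n) = damping r c 0 p * damping r c p n.
Proof. apply bprod_add. Qed.

Lemma damping_ge p n : (n <= p)%nat -> / c p ^ (r * n) <= damping r c 0 n.
Proof.
  intros H; rewrite pow_mult, <- pow_inv, <- bprod_const.
  apply bprod_le; intros i Hi; split; [apply Rinv_0_lt_compat, c_pow_pos|].
  apply Rinv_le_contravar; [apply c_pow_pos|].
  apply pow_incr; split; [destruct (hc (S (0 + i))); lra|apply c_mono; lia].
Qed.

Lemma block_product p m t : 0 < t ->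
  bprod (fun i => t / (c (S (p + i / r)) * beta r N (S (p + i / r)))) (r * m) =
  t ^ (r * m) * (N (p + m)%nat / N p * damping r c p m).
Proof.
  intros Ht.
  rewrite (bprod_blocks (fun k => t / (c (S (p + k)) * beta r N (S (p + k))))) by exact hr.
  rewrite <- bprod_pow, pow_mult, <- (bprod_const (t ^ r)).
  rewrite (weight_bprod N hN p m).
  assert (HNp := weight_pos N hN p).
  replace (N p * bprod (fun i => quotients N (S (p + i))) m / N p)
    with (bprod (fun i => quotients N (S (p + i))) m) by (field; lra).
  unfold damping; rewrite <- !bprod_mult; apply bprod_ext; intros i _.
  unfold Rdiv; rewrite Rpow_mult_distr, pow_inv, Rpow_mult_distr, beta_pow, Rinv_mult, Rinv_inv
    by auto; ring.
Qed.

Definition block_at (p : nat) (G : nat -> R -> R) : Prop :=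
  tower G /\ (forall m, G m 0 = if Nat.eqb m (r * p) then 1 else 0) /\
  (forall m x, 1 <= Rabs x -> G m x = 0).

Lemma cutoff_block p Phi X : tower Phi -> Phi 0%nat 0 = 1 ->
  (forall m, (1 <= m)%nat -> Phi m 0 = 0) ->
  (forall m x, 3 * X <= Rabs x -> Phi m x = 0) -> 3 * X <= 1 ->
  block_at p (fun m => leibniz (monomial (r * p)) Phi m 0 0).
Proof.
  intros H1 H2 H3 H4 HX; split; [|split].
  - apply leibniz_tower; [apply monomial_tower|exact H1].
  - intros m; rewrite leibniz_flat by exact H3; rewrite H2, monomial_0; ring.
  - intros m x Hx.
    assert (L := leibniz_bound (monomial (r * p)) Phi m x 0).
    rewrite Rmult_0_r in L; apply Rabs_eq_0, Rle_antisym; [|apply Rabs_pos].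
    apply L; intros i j _; rewrite H4, Rmult_0_r, Rabs_R0 by lra; lra.
Qed.

(** For the finitely many [p] to which the asymptotic choice of [c] does not apply. Shrinking all
    boxes by [eta] fits them into the unit interval, where the derivatives of the monomial are at
    most 1; the cost is only geometric in the order. *)
Lemma small_block p eta : 0 < eta <= 1 ->
  (forall n, bsum (fun i => eta * (c (S (i / r)) * beta r N (S (i / r)))) n <= 1 / 3) ->
  exists G, block_at p G /\
    forall n x, Rabs (G (r * n)%nat x) <= (4 / eta) ^ (r * n) * (N n * damping r c 0 n).
Proof.
  intros Heta HX; set (w := fun i => eta * (c (S (i / r)) * beta r N (S (i / r)))) in *.
  assert (Hw : forall i, 0 < w i).
  { intros i; unfold w; destruct (hc (S (i / r))) as [H _].
    assert (P := beta_pos r N (S (i / r))).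
    apply Rmult_lt_0_compat; [lra|]; apply Rmult_lt_0_compat; lra. }
  assert (Hw1 : forall i, 1 <= 2 / w i).
  { intros i; apply (proj1 (Rle_div_r _ _ _ (Hw i))); assert (H : bsum w i + w i <= 1 / 3) by exact (HX (S i)).
    assert (P := bsum_nonneg w i (fun j => Rlt_le _ _ (Hw j))); lra. }
  destruct (cutoff w (1 / 3) Hw ltac:(lra) HX) as [Phi [P1 [P2 [P3 [P4 P5]]]]].
  assert (HB : block_at p (fun m => leibniz (monomial (r * p)) Phi m 0 0))
    by (apply (cutoff_block p Phi (1 / 3)); auto; lra).
  eexists; split; [exact HB|].
  intros n x; cbv beta.
  replace ((4 / eta) ^ (r * n) * (N n * damping r c 0 n)) with
    (2 ^ (r * n) * bprod (fun i => 2 / w i) (r * n)).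
  2:{ assert (E := block_product 0 n (2 / eta)); rewrite (proj1 (proj2 hN)) in E.
      rewrite (bprod_ext _ (fun i => 2 / eta / (c (S (0 + i / r)) * beta r N (S (0 + i / r))))).
      - rewrite E by (apply Rdiv_lt_0_compat; lra).
        replace (4 / eta) with (2 * (2 / eta)) by (field; lra).
        rewrite Rpow_mult_distr; cbn [Nat.add]; unfold Rdiv; rewrite Rinv_1; ring.
      - intros i _; unfold w; cbn [Nat.add]; destruct (hc (S (i / r))) as [H _].
        assert (P := beta_pos r N (S (i / r))); field; repeat split; lra. }
  apply leibniz_bound; intros i j Hij.
  assert (Hw2 : forall m, 0 < bprod (fun i => 2 / w i) m)
    by (intros; apply bprod_pos; intros k; specialize (Hw1 k); lra).
  destruct (Rle_or_lt 1 (Rabs x)) as [Hx|Hx].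
  { rewrite P4, Rmult_0_r, Rabs_R0 by lra; left; auto. }
  assert (Hmono : bprod (fun i => 2 / w i) j <= bprod (fun i => 2 / w i) (r * n)).
  { rewrite <- Hij, Nat.add_comm, bprod_add.
    assert (H : 1 <= bprod (fun k => 2 / w (j + k)%nat) i).
    { rewrite <- (pow1 i), <- (bprod_const 1).
      apply bprod_le; intros k _; split; [lra|apply Hw1]. }
    specialize (Hw2 j); nra. }
  specialize (P5 0%nat j 0%nat x (le_n _)); simpl bprod in P5; rewrite Rmult_1_l in P5.
  cbn [Nat.add] in P5.
  rewrite Rabs_mult; apply Rle_trans with (1 * bprod (fun i => 2 / w i) j); [|lra].
  apply Rmult_le_compat; [apply Rabs_pos|apply Rabs_pos| |exact P5].
  destruct (Nat.le_gt_cases i (r * p)) as [Hi|Hi].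
  - eapply Rle_trans; [apply (monomial_bound _ _ x 1); [lra|exact Hi]|].
    rewrite pow1; apply Rle_div_l; [apply lt_0_INR, lt_O_fact|].
    rewrite Rmult_1_l; apply (le_INR 1), lt_O_fact.
  - unfold monomial; rewrite (proj2 (Nat.leb_gt _ _) Hi), Rabs_R0; lra.
Qed.

(** On a support of size $p/l$ a derivative of the monomial, of remaining degree $d$, is at most
    $(3\kappa p/l)^d/d!\le e^{3\kappa p}l^{-d}$. Each box of width $1/l$ costs $2l$, so the powers
    of $l$ cancel, up to $l^{-r(p-n)}$ when [n <= p]. *)
Lemma large_block p l kap : (1 <= p)%nat -> 0 < l -> 0 < kap ->
  (forall n, bsum (fun i => if Nat.ltb i (r * p) then / l
     else c (S (i / r)) * beta r N (S (i / r))) n <= kap * INR p / l) ->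
  3 * (kap * INR p / l) <= 1 ->
  exists G, block_at p G /\
    (forall n x, (n <= p)%nat -> Rabs (G (r * n)%nat x) <=
      exp (3 * kap * INR p) * 4 ^ (r * n) / l ^ (r * (p - n))) /\
    (forall m x, Rabs (G (r * (p + m))%nat x) <=
      exp (3 * kap * INR p) * 4 ^ (r * (p + m)) * (N (p + m)%nat / N p * damping r c p m)).
Proof.
  intros Hp Hl Hkap HX HX1; set (w := fun i => _) in HX; set (X := kap * INR p / l) in *.
  assert (Hp0 := INR_gt_0 p Hp).
  assert (HX0 : 0 < X) by (apply Rdiv_lt_0_compat; [apply Rmult_lt_0_compat|]; auto).
  assert (Hw : forall i, 0 < w i).
  { intros i; unfold w; destruct (Nat.ltb i (r * p)); [apply Rinv_0_lt_compat, Hl|].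
    destruct (hc (S (i / r))) as [H _]; assert (P := beta_pos r N (S (i / r))).
    apply Rmult_lt_0_compat; lra. }
  destruct (cutoff w X Hw HX0 HX) as [Phi [P1 [P2 [P3 [P4 P5]]]]].
  assert (HB : block_at p (fun m => leibniz (monomial (r * p)) Phi m 0 0))
    by (apply (cutoff_block p Phi X); auto; lra).
  set (E := exp (3 * kap * INR p)).
  assert (HE : 0 < E) by apply exp_pos.
  assert (Hli : forall n, 0 < l ^ n) by (intros; apply pow_lt; auto).
  assert (H2 : forall n, 0 < 2 ^ n) by (intros; apply pow_lt; lra).
  assert (Hmon : forall i x, Rabs x < 3 * X -> (i <= r * p)%nat ->
    Rabs (monomial (r * p) i x) <= E / l ^ (r * p - i)).
  { intros i x Hx Hi.
    eapply Rle_trans; [apply (monomial_bound _ _ x (3 * X)); [lra|exact Hi]|].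
    set (d := (r * p - i)%nat).
    replace (3 * X) with (3 * kap * INR p / l) by (unfold X; field; lra).
    unfold Rdiv at 2; rewrite Rpow_mult_distr, pow_inv.
    assert (Q := pow_fact_le_exp (3 * kap * INR p) d ltac:(nra)); fold E in Q.
    replace ((3 * kap * INR p) ^ d * / l ^ d / INR (fact d)) with
      ((3 * kap * INR p) ^ d / INR (fact d) / l ^ d)
      by (field; split; first [apply INR_fact_neq_0|apply Rgt_not_eq, Hli]).
    apply Rmult_le_compat_r; [left; apply Rinv_0_lt_compat, Hli|exact Q]. }
  assert (Hhead : forall a, (a <= r * p)%nat -> bprod (fun i => 2 / w i) a = 2 ^ a * l ^ a).
  { intros a Ha; rewrite <- Rpow_mult_distr, <- bprod_const; apply bprod_ext; intros i Hi.
    unfold w; rewrite (proj2 (Nat.ltb_lt _ _)) by lia; field; lra. }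
  assert (Htail : forall m, bprod (fun i => 2 / w (r * p + i)%nat) (r * m) =
    2 ^ (r * m) * (N (p + m)%nat / N p * damping r c p m)).
  { intros m; rewrite <- block_product by lra; apply bprod_ext; intros i Hi.
    unfold w; rewrite (proj2 (Nat.ltb_ge _ _)) by lia; rewrite div_add_r by exact hr.
    reflexivity. }
  assert (H4 : forall n, 4 ^ n = 2 ^ n * 2 ^ n)
    by (intros; rewrite <- Rpow_mult_distr; f_equal; ring).
  eexists; split; [exact HB|split].
  - intros n x Hn; cbv beta.
    rewrite H4; set (W := E * 2 ^ (r * n) / l ^ (r * (p - n))).
    replace (E * (2 ^ (r * n) * 2 ^ (r * n)) / l ^ (r * (p - n))) with (2 ^ (r * n) * W)
      by (unfold W; field; apply Rgt_not_eq, Hli).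
    assert (HW : 0 < W)
      by (apply Rdiv_lt_0_compat; [apply Rmult_lt_0_compat|]; auto).
    apply leibniz_bound; intros i j Hij.
    destruct (Rle_or_lt (3 * X) (Rabs x)) as [Hx|Hx].
    { rewrite P4, Rmult_0_r, Rabs_R0 by lra; lra. }
    assert (Hi : (i <= r * p)%nat) by nia.
    assert (Hj : (j <= r * p)%nat) by nia.
    specialize (P5 j 0%nat (r * p)%nat x Hj); simpl (bprod _ 0) in P5.
    rewrite Rmult_1_r, Nat.add_0_r, Hhead in P5 by exact Hj.
    rewrite Rabs_mult.
    eapply Rle_trans; [apply Rmult_le_compat; [apply Rabs_pos|apply Rabs_pos|apply Hmon; auto|exact P5]|].
    replace (r * p - i)%nat with (j + r * (p - n))%nat by nia.
    rewrite pow_add; unfold W.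
    replace (E / (l ^ j * l ^ (r * (p - n))) * (2 ^ j * l ^ j)) with
      (E * 2 ^ j / l ^ (r * (p - n))) by (field; split; apply Rgt_not_eq, Hli).
    apply Rmult_le_compat_r; [left; apply Rinv_0_lt_compat, Hli|].
    apply Rmult_le_compat_l; [left; auto|]; apply Rle_pow; [lra|lia].
  - intros m x; cbv beta.
    set (T := N (p + m)%nat / N p * damping r c p m).
    assert (HT : 0 < T).
    { apply Rmult_lt_0_compat; [|apply damping_pos].
      apply Rdiv_lt_0_compat; apply weight_pos; auto. }
    rewrite H4.
    replace (E * (2 ^ (r * (p + m)) * 2 ^ (r * (p + m))) * T) with
      (2 ^ (r * (p + m)) * (E * 2 ^ (r * (p + m)) * T)) by ring.
    assert (HW : 0 < E * 2 ^ (r * (p + m)) * T)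
      by (apply Rmult_lt_0_compat; [apply Rmult_lt_0_compat; auto|exact HT]).
    apply leibniz_bound; intros i j Hij.
    destruct (Rle_or_lt (3 * X) (Rabs x)) as [Hx|Hx].
    { rewrite P4, Rmult_0_r, Rabs_R0 by lra; lra. }
    destruct (Nat.le_gt_cases i (r * p)) as [Hi|Hi].
    2:{ unfold monomial; rewrite (proj2 (Nat.leb_gt _ _) Hi), Rmult_0_l, Rabs_R0; lra. }
    (* Of the [j] derivatives on the cutoff, as many as the remaining degree go to boxes of width
       [/ l], where they cancel its powers of [l]; the other [r * m] go to the boxes from index
       [r * p] on. *)
    specialize (P5 (r * p - i)%nat (r * m)%nat (r * p)%nat x ltac:(lia)).
    replace (r * p - i + r * m)%nat with j in P5 by nia.
    rewrite Hhead, Htail in P5 by lia; fold T in P5.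
    rewrite Rabs_mult.
    eapply Rle_trans; [apply Rmult_le_compat; [apply Rabs_pos|apply Rabs_pos|apply Hmon; auto|exact P5]|].
    set (d := (r * p - i)%nat).
    replace (E / l ^ d * (2 ^ d * l ^ d * (2 ^ (r * m) * T))) with
      (E * 2 ^ (d + r * m) * T)
      by (rewrite pow_add; field; apply Rgt_not_eq, Hli).
    apply Rmult_le_compat_r; [left; auto|].
    apply Rmult_le_compat_l; [left; auto|]; apply Rle_pow; [lra|unfold d; nia].
Qed.

Lemma scaled_large_block p l kap sig Mp ap : (1 <= p)%nat -> 0 < l -> 0 < kap -> 0 < sig ->
  (forall n, bsum (fun i => if Nat.ltb i (r * p) then / l
     else c (S (i / r)) * beta r N (S (i / r))) n <= kap * INR p / l) ->
  3 * (kap * INR p / l) <= 1 ->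
  (forall n, (n <= p)%nat -> Mp <= sig ^ p * N n * (l * c p) ^ (r * (p - n))) ->
  Rabs ap * c p ^ (2 * (r * p)) <= Mp ->
  exists G, block_at p G /\
    forall n x, Rabs (ap * G (r * n)%nat x) <=
      exp (3 * kap * INR p) * sig ^ p / c p ^ (r * p) *
      (4 ^ (r * n) * (N n * damping r c 0 n)).
Proof.
  intros Hp Hl Hkap Hsig HX HX1 HU Ha.
  destruct (large_block p l kap Hp Hl Hkap HX HX1) as [G [G1 [G2 G3]]].
  exists G; split; [exact G1|]; intros n x; rewrite Rabs_mult.
  set (E := exp (3 * kap * INR p)) in *; assert (HE : 0 < E) by apply exp_pos.
  assert (Hcp := c_pow_pos p); assert (Hli : forall n, 0 < l ^ n) by (intros; apply pow_lt; auto).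
  assert (HN := weight_pos N hN); assert (Hs : 0 < sig ^ p) by (apply pow_lt; auto).
  assert (H4 : forall n, 0 < 4 ^ n) by (intros; apply pow_lt; lra).
  assert (Ha' : Rabs ap <= Mp / c p ^ (2 * (r * p))) by (apply (proj1 (Rle_div_r _ _ _ (Hcp _))); exact Ha).
  destruct (Nat.le_gt_cases n p) as [Hn|Hn].
  - eapply Rle_trans; [apply Rmult_le_compat; [apply Rabs_pos|apply Rabs_pos| |apply G2; exact Hn]|].
    { eapply Rle_trans; [exact Ha'|].
      apply Rmult_le_compat_r; [left; apply Rinv_0_lt_compat, Hcp|apply (HU n Hn)]. }
    assert (D := damping_ge p n Hn).
    replace (sig ^ p * N n * (l * c p) ^ (r * (p - n)) * / c p ^ (2 * (r * p)) *
      (E * 4 ^ (r * n) / l ^ (r * (p - n)))) with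
      (E * sig ^ p / c p ^ (r * p) * (4 ^ (r * n) * (N n * / c p ^ (r * n)))).
    + apply Rmult_le_compat_l.
      { left; apply Rdiv_lt_0_compat; [apply Rmult_lt_0_compat|]; auto. }
      apply Rmult_le_compat_l; [left; auto|]; apply Rmult_le_compat_l; [left; auto|exact D].
    + rewrite Rpow_mult_distr.
      (* The three parts of the exponent of [c p] serve, in this order, the summability over [p],
         the factor [damping r c 0 n], and the passage from [l * c p] to [l]. *)
      replace (2 * (r * p))%nat with (r * p + (r * n + r * (p - n)))%nat by nia.
      rewrite !pow_add; field; repeat split; apply Rgt_not_eq; first [apply Hcp|apply Hli|apply HN].
  - assert (En : n = (p + (n - p))%nat) by (clear - Hn; lia).
    rewrite En; set (m := (n - p)%nat) in *; clearbody m; clear En Hn n.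
    eapply Rle_trans; [apply Rmult_le_compat; [apply Rabs_pos|apply Rabs_pos| |apply G3]|].
    { eapply Rle_trans; [exact Ha'|].
      apply Rmult_le_compat_r; [left; apply Rinv_0_lt_compat, Hcp|].
      specialize (HU p (le_n _)); rewrite Nat.sub_diag, Nat.mul_0_r, Rmult_1_r in HU; exact HU. }
    rewrite damping_add.
    assert (D := damping_ge p p (le_n _)); assert (Dm := damping_pos p m).
    replace (sig ^ p * N p * / c p ^ (2 * (r * p)) *
      (E * 4 ^ (r * (p + m)) * (N (p + m)%nat / N p * damping r c p m))) with
      (E * sig ^ p / c p ^ (r * p) * (4 ^ (r * (p + m)) * (N (p + m)%nat *
        (/ c p ^ (r * p) * damping r c p m)))).
    + apply Rmult_le_compat_l.
      { left; apply Rdiv_lt_0_compat; [apply Rmult_lt_0_compat|]; auto. }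
      apply Rmult_le_compat_l; [left; auto|]; apply Rmult_le_compat_l; [left; auto|].
      apply Rmult_le_compat_r; lra.
    + replace (2 * (r * p))%nat with (r * p + r * p)%nat by lia.
      rewrite !pow_add; field; repeat split; apply Rgt_not_eq; first [apply Hcp|apply Hli|apply HN].
Qed.

End Blocks.

Lemma exp_mult_INR x n : exp (x * INR n) = exp x ^ n.
Proof.
  induction n as [|n IH]; [simpl; rewrite Rmult_0_r; apply exp_0|].
  rewrite S_INR; simpl; rewrite <- IH, <- exp_plus; f_equal; ring.
Qed.

Lemma ex_series_root_test u K c r : (1 <= r)%nat -> 0 < K -> (forall p, 1 <= c p) ->
  is_lim_seq c p_infty ->
  (exists p0, forall p, (p0 <= p)%nat -> 0 <= u p <= K ^ p / c p ^ (r * p)) ->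
  (forall p, 0 <= u p) -> ex_series u.
Proof.
  intros hr HK Hc Lc [p0 Hu] Hu0.
  rewrite lim_p_infty_iff in Lc; destruct (Lc (2 * K)) as [p1 Hp1].
  assert (H2 : forall p, 0 < 2 ^ p) by (intros; apply pow_lt; lra).
  set (v := fun p => u p * 2 ^ p).
  assert (Hv0 : forall p, 0 <= v p)
    by (intros p; apply Rmult_le_pos; [apply Hu0|left; apply H2]).
  set (n := (p0 + p1)%nat).
  assert (Hv : forall p, v p <= 1 + bsum v n).
  { intros p; destruct (Nat.le_gt_cases n p) as [Hp|Hp].
    - assert (P := bsum_nonneg v n Hv0).
      assert (v p <= 1); [|lra].
      destruct (Hu p) as [_ H]; [unfold n in Hp; lia|].
      assert (Hcp : 0 < c p) by (specialize (Hc p); lra).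
      assert (Hcr : 0 < c p ^ (r * p)) by (apply pow_lt; auto).
      unfold v; apply Rle_trans with (K ^ p / c p ^ (r * p) * 2 ^ p).
      + apply Rmult_le_compat_r; [left; apply H2|exact H].
      + replace (K ^ p / c p ^ (r * p) * 2 ^ p) with ((2 * K) ^ p / c p ^ (r * p))
          by (rewrite Rpow_mult_distr; field; lra).
        apply Rle_div_l; [auto|]; rewrite Rmult_1_l.
        specialize (Hp1 p ltac:(unfold n in Hp; lia)).
        apply Rle_trans with (c p ^ p); [apply pow_incr; lra|].
        apply Rle_pow; [apply Hc|nia].
    - apply Rle_trans with (bsum v (S p)).
      + simpl; assert (P := bsum_nonneg v p Hv0); lra.
      + assert (P := bsum_mono v (S p) n Hv0 Hp); lra. }
  apply (ex_series_le (V := R_CompleteNormedModule) u (fun p => (/ 2) ^ p * (1 + bsum v n))).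
  - intros p; specialize (Hv p); change (Rabs (u p) <= (/ 2) ^ p * (1 + bsum v n)).
    rewrite Rabs_pos_eq by apply Hu0; rewrite pow_inv.
    specialize (H2 p); replace (u p) with (/ 2 ^ p * v p) by (unfold v; field; lra).
    apply Rmult_le_compat_l; [left; apply Rinv_0_lt_compat; auto|exact Hv].
  - apply ex_series_scal_r, ex_series_geom; rewrite Rabs_pos_eq; lra.
Qed.

Lemma assemble r N c (a : nat -> R) (G : nat -> nat -> R -> R) (D : nat -> R) B :
  (1 <= r)%nat -> LC N -> (forall k, 1 <= c k <= c (S k)) -> is_lim_seq c p_infty ->
  0 < B -> (forall p, block_at r p (G p)) -> ex_series D ->
  (forall p n x, Rabs (a p * G p (r * n)%nat x) <=
    D p * (B ^ (r * n) * (N n * damping r c 0 n))) ->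
  exists F, RD_Beurling r N F /\ forall j, F (r * j)%nat 0 = a j.
Proof.
  intros hr hN hc Lc HB HG HD HGB.
  set (H := fun p m x => a p * G p m x).
  assert (HT : forall p, tower (H p)) by (intros p; apply tower_scal, HG).
  assert (HV : forall p m x, 1 <= Rabs x -> H p m x = 0).
  { intros p m x Hx; unfold H; destruct (HG p) as [_ [_ Q]]; rewrite Q by auto; ring. }
  set (W := fun n => B ^ (r * n) * (N n * damping r c 0 n)) in HGB.
  (* Differentiating the series needs summable bounds at every order; order [m] is dominated through
     order [r * m], a multiple of [r]. *)
  assert (HH : forall p m x, Rabs (H p m x) <= D p * (2 ^ (r * m - m) * W m)).
  { intros p m x.
    eapply Rle_trans; [apply (vanishing_tower_bound (H p) m (r * m - m) (D p * W m)); auto|].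
    - intros y; assert (Hrm : (1 * m <= r * m)%nat) by (apply Nat.mul_le_mono_r; exact hr).
      replace (m + (r * m - m))%nat with (r * m)%nat by lia; apply HGB.
    - right; ring. }
  assert (Hs : forall k : R, ex_series (fun p => D p * k)) by (intros; apply ex_series_scal_r, HD).
  assert (Hval : forall m, Series (fun p => H p m 0) =
    Series (fun p => if Nat.eqb m (r * p) then a p else 0)).
  { intros m; apply Series_ext; intros p; unfold H.
    destruct (HG p) as [_ [Q _]]; rewrite Q; destruct (Nat.eqb m (r * p)); ring. }
  exists (fun m x => Series (fun p => H p m x)); split; [split; [|split; [|split]]|].
  - apply (tower_series H (fun m p => D p * (2 ^ (r * m - m) * W m))); auto.
  (* The zero series is put into the form that [Series_single] evaluates. *)
  - intros x Hx; rewrite (Series_ext _ (fun p => if Nat.eqb p 0 then 0 else 0)).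
    + apply Series_single.
    + intros p; rewrite HV by lra; destruct (Nat.eqb p 0); reflexivity.
  - intros n j Hj; rewrite Hval, (Series_ext _ (fun p => if Nat.eqb p 0 then 0 else 0)).
    + apply Series_single.
    + intros p; destruct (Nat.eqb_spec (r * n + j) (r * p)) as [E|_];
        [exfalso|destruct (Nat.eqb p 0); reflexivity].
      destruct (Nat.le_gt_cases p n) as [Q|Q]; apply (Nat.mul_le_mono_l _ _ r) in Q; lia.
  - intros h Hh.
    assert (Hcr : forall k, 1 <= c (S k) ^ r) by (intros; apply pow_R1_Rle, hc).
    destruct (prod_decay (fun k => c (S k) ^ r) (B ^ r / h)) as [A HA].
    { intros k; specialize (Hcr k); lra. }
    { apply (is_lim_seq_le_p_loc (fun k => c (S k))).
      - exists 0%nat; intros k _; rewrite <- (pow_1 (c (S k))) at 1.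
        apply Rle_pow; [apply hc|exact hr].
      - apply -> is_lim_seq_incr_1; exact Lc. }
    { apply Rdiv_lt_0_compat; [apply pow_lt|]; auto. }
    assert (HD0 : 0 <= Series D * A).
    { assert (HA0 := HA 0%nat); simpl in HA0; apply Rmult_le_pos; [|lra].
      rewrite <- (Series_single 0 0); apply Series_le; [|exact HD].
      intros p; assert (Q := HGB p 0%nat 0); destruct (Nat.eqb p 0);
      (split; [lra|]); unfold W in Q; simpl in Q; rewrite Nat.mul_0_r in Q; simpl in Q;
      rewrite (proj1 (proj2 hN)) in Q; unfold damping in Q; simpl in Q;
      assert (Q' := Rabs_pos (a p * G p 0%nat 0)); lra. }
    exists (Series D * A); intros n x.
    assert (HW : W n <= A * (h ^ n * N n)).
    { assert (Hhn : 0 < h ^ n) by (apply pow_lt; auto).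
      specialize (HA n); unfold Rdiv in HA.
      rewrite bprod_mult, bprod_const in HA.
      change (bprod (fun i => / c (S i) ^ r) n) with (damping r c 0 n) in HA.
      rewrite Rpow_mult_distr, <- pow_mult, pow_inv in HA.
      assert (P := weight_pos N hN n); unfold W.
      replace (B ^ (r * n) * (N n * damping r c 0 n)) with
        (B ^ (r * n) * / h ^ n * damping r c 0 n * (h ^ n * N n)) by (field; lra).
      apply Rmult_le_compat_r; [|exact HA]; left; apply Rmult_lt_0_compat; auto. }
    rewrite Rmult_assoc, <- Series_scal_r.
    assert (Hterm : forall p, Rabs (H p (r * n)%nat x) <= D p * (A * (h ^ n * N n))).
    { intros p; eapply Rle_trans; [apply HGB|].
      apply Rmult_le_compat_l; [|exact HW].
      (* As [W 0 = 1], the bound at order 0 shows that [D p] is nonnegative. *)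
      assert (Q := HGB p 0%nat 0); unfold W in Q; rewrite Nat.mul_0_r in Q; simpl in Q;
      rewrite (proj1 (proj2 hN)) in Q; unfold damping in Q; simpl in Q.
      assert (Q' := Rabs_pos (a p * G p 0%nat 0)); lra. }
    assert (Hab : ex_series (fun p => Rabs (H p (r * n)%nat x))).
    { apply (ex_series_le (V := R_CompleteNormedModule) _ (fun p => D p * (A * (h ^ n * N n)))); auto.
      intros p; eapply Rle_trans; [|apply Hterm]; apply Req_le, Rabs_Rabsolu. }
    eapply Rle_trans; [apply Series_Rabs, Hab|].
    apply Series_le; [|apply Hs]; intros p; split; [apply Rabs_pos|apply Hterm].
  - intros j; rewrite Hval, (Series_ext _ (fun p => if Nat.eqb p j then a j else 0)).
    + apply Series_single.
    + intros p; destruct (Nat.eqb_spec (r * j) (r * p)) as [E|E], (Nat.eqb_spec p j) as [E'|E'];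
        subst; auto; exfalso; nia.
Qed.

Lemma construction r N M a sig A (Y : nat -> R) : (1 <= r)%nat -> LC N -> (forall p, 0 < M p) ->
  0 < sig -> 0 <= A -> (forall p, 0 < Y p) ->
  (forall p n, (1 <= p)%nat -> (n <= p)%nat ->
    M p <= sig ^ p * N n * Y p ^ (r * (p - n))) ->
  ex_series (beta r N) ->
  (forall p, (1 <= p)%nat -> Y p * Series (fun i => beta r N (p + i)) <= A * INR p) ->
  is_lim_seq (fun p => Y p / INR p) p_infty ->
  RLambda M a ->
  exists F, RD_Beurling r N F /\ forall j, F (r * j)%nat 0 = a j.
Proof.
  intros hr hN HM Hsig HA HY HU Hser HV HW Ha.
  assert (HR := INR_gt_0 r hr).
  (* In units of [p / l]: [r] from the [r * p] boxes of width [/ l], and [2 * r * A] from the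
     weighted tail, the 2 being that of [slow_weights]. *)
  set (kap := INR r * (1 + 2 * A)).
  assert (Hkap : 0 < kap) by (apply Rmult_lt_0_compat; lra).
  destruct (Lambda_root_growth M a HM Ha) as [b [b1 [b2 b3]]].
  assert (Lroot := Rpower_root_lim b (2 * r) ltac:(lia) b1 b2).
  (* The first bound on [c p] makes the support fit, [3 * (kap * p / l) <= 1]; the second gives
     [Rabs (a p) * c p ^ (2 * (r * p)) <= M p]. *)
  assert (Lu : is_lim_seq (fun p => Rmin (Y p / INR p / (3 * kap)) (Rpower (b p) (1 / INR (2 * r)))) p_infty).
  { rewrite lim_p_infty_iff in *; intros H.
    destruct (HW (H * (3 * kap))) as [n1 H1]; destruct (Lroot H) as [n2 H2].
    exists (n1 + n2)%nat; intros k Hk; apply Rmin_glb_lt; [|apply H2; lia].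
    apply (proj1 (Rlt_div_r H (Y k / INR k) (3 * kap) ltac:(lra))); apply H1; lia. }
  destruct (slow_weights (beta r N) _ (beta_pos r N) Hser Lu) as [c [c1 [c2 [c3 [k0 c4]]]]].
  assert (Hcb : forall k, 0 < c k * beta r N k).
  { intros k; destruct (c1 k); apply Rmult_lt_0_compat; [lra|apply beta_pos]. }
  set (Z := INR r * (2 * c 1%nat * Series (fun i => beta r N (1 + i)))).
  assert (Hblocks : forall p n, bsum (fun i => c (S (p + i / r)) * beta r N (S (p + i / r))) (r * n) <=
    INR r * (2 * c p * Series (fun i => beta r N (p + i)))).
  { intros p n; rewrite (bsum_blocks (fun k => c (S (p + k)) * beta r N (S (p + k)))) by exact hr.
    apply Rmult_le_compat_l; [lra|]; eapply Rle_trans; [|apply (c3 p (S n))].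
    replace (S n) with (1 + n)%nat by lia; rewrite bsum_add; simpl (bsum _ 1).
    rewrite Rplus_0_l, (bsum_ext (fun i => c (p + (1 + i))%nat * beta r N (p + (1 + i)))
      (fun k => c (S (p + k)) * beta r N (S (p + k)))).
    - specialize (Hcb (p + 0)%nat); lra.
    - intros i _; replace (p + (1 + i))%nat with (S (p + i)) by lia; reflexivity. }
  set (Z0 := INR r * (2 * c 0%nat * Series (fun i => beta r N (0 + i)))).
  assert (HZ0 : 0 <= Z0) by (eapply Rle_trans; [|apply (Hblocks 0%nat 0%nat)]; rewrite Nat.mul_0_r; simpl; lra).
  set (eta := / (3 * (Z0 + 1))).
  assert (Heta : 0 < eta <= 1).
  { unfold eta; split; [apply Rinv_0_lt_compat; lra|].
    rewrite <- Rinv_1; apply Rinv_le_contravar; lra. }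
  assert (Hsmall : forall n, bsum (fun i => eta * (c (S (i / r)) * beta r N (S (i / r)))) n <= 1 / 3).
  { intros n; rewrite bsum_scal.
    apply Rle_trans with (eta * Z0).
    - apply Rmult_le_compat_l; [lra|]; eapply Rle_trans; [|apply (Hblocks 0%nat n)].
      apply bsum_mono; [intros; left; apply Hcb|nia].
    - unfold eta; apply Rmult_le_reg_l with (3 * (Z0 + 1)); [lra|].
      rewrite <- Rmult_assoc, Rinv_r by lra; lra. }
  (* The successor guarantees [1 <= p] for the large blocks. *)
  set (p0 := S k0).
  set (D := fun p => if Nat.ltb p p0 then Rabs (a p)
    else exp (3 * kap * INR p) * sig ^ p / c p ^ (r * p)).
  assert (Hc0 : forall p, 0 < c p) by (intros p; destruct (c1 p); lra).
  assert (Hdp : forall n, 0 < N n * damping r c 0 n).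
  { intros n; apply Rmult_lt_0_compat; [apply weight_pos, hN|apply damping_pos, c1]. }
  assert (Hex : forall p, exists G, block_at r p G /\ forall n x,
    Rabs (a p * G (r * n)%nat x) <= D p * ((4 / eta) ^ (r * n) * (N n * damping r c 0 n))).
  { intros p; unfold D; destruct (Nat.ltb_spec p p0) as [Hp|Hp].
    - destruct (small_block r N c hr hN c1 p eta Heta Hsmall) as [G [G1 G2]].
      exists G; split; [exact G1|]; intros n x.
      rewrite Rabs_mult; apply Rmult_le_compat_l; [apply Rabs_pos|apply G2].
    - assert (Hp1 : (1 <= p)%nat) by (unfold p0 in Hp; lia).
      assert (Hpp := INR_gt_0 p Hp1).
      specialize (c4 p ltac:(unfold p0 in Hp; lia)); specialize (Hc0 p).
      assert (Q1 := Rle_trans _ _ _ c4 (Rmin_l _ _)); assert (Q2 := Rle_trans _ _ _ c4 (Rmin_r _ _)).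
      set (l := Y p / c p).
      assert (Hl : 0 < l) by (apply Rdiv_lt_0_compat; auto).
      assert (HYl : l * c p = Y p) by (unfold l; field; lra).
      destruct (scaled_large_block r N c hr hN c1 p l kap sig (M p) (a p)) as [G [G1 G2]]; auto.
      + assert (Htot : forall m, bsum (fun i => if Nat.ltb i (r * p) then / l
            else c (S (i / r)) * beta r N (S (i / r))) (r * p + r * m) <= kap * INR p / l).
        { intros m; rewrite bsum_add.
          rewrite (bsum_ext _ (fun _ => / l)), bsum_const, mult_INR.
          2:{ intros i Hi; rewrite (proj2 (Nat.ltb_lt _ _) Hi); reflexivity. }
          rewrite (bsum_ext _ (fun i => c (S (p + i / r)) * beta r N (S (p + i / r)))).
          2:{ intros i _; rewrite (proj2 (Nat.ltb_ge _ _)), div_add_r by lia; reflexivity. }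
          specialize (Hblocks p m); specialize (HV p Hp1).
          assert (Q : c p * Series (fun i => beta r N (p + i)) <= A * INR p / l).
          { apply (proj1 (Rle_div_r _ _ _ Hl)).
            replace (c p * Series (fun i => beta r N (p + i)) * l) with
              (l * c p * Series (fun i => beta r N (p + i))) by ring.
            rewrite HYl; exact HV. }
          eapply Rle_trans; [apply Rplus_le_compat_l, Hblocks|].
          unfold kap; replace (INR r * (1 + 2 * A) * INR p / l) with
            (INR r * INR p * / l + INR r * (2 * (A * INR p / l))) by (field; lra).
          apply Rplus_le_compat_l, Rmult_le_compat_l; lra. }
        intros n; eapply Rle_trans; [|apply (Htot n)].
        apply bsum_mono; [|nia]; intros i; destruct (Nat.ltb i (r * p)).
        * left; apply Rinv_0_lt_compat, Hl.
        * left; apply Hcb.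
      + apply (proj2 (Rle_div_r (c p) (Y p / INR p) (3 * kap) ltac:(lra))) in Q1.
        apply (proj2 (Rle_div_r _ _ _ Hpp)) in Q1.
        replace (3 * (kap * INR p / l)) with (c p * (3 * kap) * INR p / Y p).
        * apply Rle_div_l; [apply HY|lra].
        * unfold l; specialize (HY p); field; split; lra.
      + intros n Hn; rewrite HYl; apply HU; auto.
      + eapply Rle_trans; [|apply (b3 p Hp1)].
        apply Rmult_le_compat_l; [apply Rabs_pos|].
        rewrite Nat.mul_assoc, pow_mult; apply pow_incr; split; [left; apply pow_lt; auto|].
        rewrite <- (Rpower_root_pow (b p) (2 * r)) by (auto; lia).
        apply pow_incr; lra.
      + exists G; split; [exact G1|]; intros n x; eapply Rle_trans; [apply G2|].
        apply Rmult_le_compat_l.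
        { left; apply Rdiv_lt_0_compat; [|apply pow_lt; auto].
          apply Rmult_lt_0_compat; [apply exp_pos|apply pow_lt; auto]. }
        apply Rmult_le_compat_r; [left; apply Hdp|].
        apply pow_incr; split; [lra|].
        apply (proj1 (Rle_div_r _ _ _ (proj1 Heta))); lra. }
  apply choice in Hex; destruct Hex as [G HG].
  apply (assemble r N c a G D (4 / eta)); auto.
  - apply Rdiv_lt_0_compat; lra.
  - intros p; apply HG.
  - apply (ex_series_root_test _ (exp (3 * kap) * sig) c r); auto.
    + apply Rmult_lt_0_compat; [apply exp_pos|auto].
    + intros p; apply c1.
    + exists p0; intros p Hp; unfold D; rewrite (proj2 (Nat.ltb_ge _ _) Hp).
      rewrite exp_mult_INR, <- Rpow_mult_distr; split; [|apply Rle_refl].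
      left; apply Rdiv_lt_0_compat; apply pow_lt; auto.
      apply Rmult_lt_0_compat; [apply exp_pos|auto].
    + intros p; unfold D; destruct (Nat.ltb p p0); [apply Rabs_pos|].
      left; apply Rdiv_lt_0_compat; [|apply pow_lt; auto].
      apply Rmult_lt_0_compat; [apply exp_pos|apply pow_lt; auto].
  - intros p; apply HG.
Qed.

Theorem sufficiency r M N : (1 <= r)%nat -> LC M -> LC N ->
  is_lim_seq (fun p => Rpower (Rpower (M p) (1 / INR r) / INR (fact p)) (1 / INR p)) p_infty ->
  (exists C0, 1 <= C0 /\ forall p, M p <= C0 ^ p * N p) ->
  SV r M N -> RBorel r M N.
Proof.
  intros hr hM hN HMr [C0 [HC0 HMN]] [s [Hs [Hser [A HA]]]] a Ha.
  assert (HM : forall p, 0 < M p) by apply hM.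
  assert (HN : forall p, 0 < N p) by apply hN.
  assert (Hs1 : 1 <= INR s) by (apply (le_INR 1); exact Hs).
  set (lam := fun p => lambda_ps M N p s).
  set (Y := fun p => Rpower (lam p) (1 / INR r)).
  assert (HY : forall p, 0 < Y p) by (intros; apply Rpower_pos).
  assert (Hlam : forall p j, (j < p)%nat ->
    Rpower (M p / (INR s ^ p * N j)) (1 / INR (p - j)) <= lam p)
    by (intros p j Hj; apply lambda_ps_lub; [lia|exact Hj]).
  assert (HYl : forall p, (1 <= p)%nat -> Y p ^ r = lam p).
  { intros p Hp; apply Rpower_root_pow; [exact hr|].
    eapply Rlt_le_trans; [apply Rpower_pos|apply (Hlam p 0%nat); lia]. }
  assert (Hsp : forall p, 0 < INR s ^ p) by (intros; apply pow_lt; lra).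
  assert (HU0 : forall p n, (n < p)%nat -> M p <= INR s ^ p * N n * Y p ^ (r * (p - n))).
  { intros p n Hn; rewrite pow_mult, HYl by lia.
    assert (Hsn : 0 < INR s ^ p * N n) by (apply Rmult_lt_0_compat; auto).
    rewrite Rmult_comm; apply (Rle_div_l (M p) _ _ Hsn).
    rewrite <- (Rpower_root_pow (M p / (INR s ^ p * N n)) (p - n)).
    - apply pow_incr; split; [left; apply Rpower_pos|apply Hlam, Hn].
    - lia.
    - apply Rdiv_lt_0_compat; auto. }
  apply (construction r N M a (INR s * C0) (Rmax A 0) Y); auto.
  - apply Rmult_lt_0_compat; lra.
  - apply Rmax_r.
  - intros p n Hp Hn; rewrite Rpow_mult_distr.
    (* The case [n = p] lies outside the supremum; there [M p <= C0 ^ p * N p] takes over, whence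
       [C0] in the constant. *)
    destruct (Nat.eq_dec n p) as [->|Hne].
    + rewrite Nat.sub_diag, Nat.mul_0_r, Rmult_1_r.
      eapply Rle_trans; [apply HMN|].
      apply Rmult_le_compat_r; [left; auto|].
      rewrite <- (Rmult_1_l (C0 ^ p)) at 1; apply Rmult_le_compat_r.
      * apply pow_le; lra.
      * apply pow_R1_Rle; exact Hs1.
    + eapply Rle_trans; [apply (HU0 p n); lia|].
      apply Rmult_le_compat_r; [apply pow_le; left; auto|].
      apply Rmult_le_compat_r; [left; auto|].
      rewrite <- (Rmult_1_r (INR s ^ p)) at 1; apply Rmult_le_compat_l; [left; auto|].
      apply pow_R1_Rle; exact HC0.
  - apply (ex_series_incr_1 (beta r N)); exact (Hser 1%nat (le_n _)).
  - intros p Hp; specialize (HA p Hp); assert (Hpp := INR_gt_0 p Hp).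
    change (Y p / INR p * Series (fun i => beta r N (p + i)) <= A) in HA.
    assert (HAm := Rmax_l A 0).
    replace (Y p * Series (fun i => beta r N (p + i))) with
      (Y p / INR p * Series (fun i => beta r N (p + i)) * INR p) by (field; lra).
    apply Rmult_le_compat_r; lra.
  (* The candidate [j = 0] gives $Y_p^{rp}\ge M_p/s^p$, and $p!\ge (p/e)^p$; so [Y p / INR p] is at
     least [q / (exp 1 * INR s)], where [q] is the quantity assumed to tend to infinity. *)
  - rewrite lim_p_infty_iff in *; intros H.
    assert (He := exp_pos 1).
    set (H' := (Rabs H + 1) * (exp 1 * INR s)).
    destruct (HMr H') as [n Hn]; exists (S n); intros p Hp; specialize (Hn p ltac:(lia)).
    set (q := Rpower _ (1 / INR p)) in Hn.
    assert (Hpp := INR_gt_0 p ltac:(lia)).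
    assert (HfP : 0 < INR (fact p)) by (apply lt_0_INR, lt_O_fact).
    assert (Hq : 0 < q) by apply Rpower_pos.
    assert (Eq : q ^ p = Rpower (M p) (1 / INR r) / INR (fact p)).
    { apply Rpower_root_pow; [lia|apply Rdiv_lt_0_compat; [apply Rpower_pos|auto]]. }
    assert (EM : M p = (q ^ p * INR (fact p)) ^ r).
    { rewrite Eq; replace (Rpower (M p) (1 / INR r) / INR (fact p) * INR (fact p))
        with (Rpower (M p) (1 / INR r)) by (field; lra).
      rewrite Rpower_root_pow; auto. }
    assert (Hst := pow_fact_le_exp (INR p) p (Rlt_le _ _ Hpp)).
    replace (exp (INR p)) with (exp 1 ^ p) in Hst by (rewrite <- exp_mult_INR; f_equal; ring).
    apply (proj1 (Rle_div_l _ _ _ HfP)) in Hst.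
    assert (Hqp : q * INR p / exp 1 <= Y p * INR s).
    { apply (pow_le_reg _ _ (p * r)); [nia|apply Rmult_le_pos; [left; apply HY|lra]|].
      rewrite !pow_mult; apply Rle_trans with (M p).
      - rewrite EM; apply pow_incr; split.
        { apply pow_le; left; apply Rdiv_lt_0_compat; [apply Rmult_lt_0_compat|]; auto. }
        unfold Rdiv; rewrite !Rpow_mult_distr, pow_inv, Rmult_assoc.
        apply Rmult_le_compat_l; [apply pow_le; lra|].
        apply (Rle_div_l _ _ _ (pow_lt _ p He)); lra.
      - eapply Rle_trans; [apply (HU0 p 0%nat); lia|].
        rewrite (proj1 (proj2 hN)), Rmult_1_r, Nat.sub_0_r, <- pow_mult, Rpow_mult_distr.
        rewrite (Nat.mul_comm p r), Rmult_comm; apply Rmult_le_compat_l; [apply pow_le; left; auto|].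
        apply Rle_pow; [exact Hs1|nia]. }
    eapply Rle_lt_trans; [apply Rle_abs|].
    apply (proj1 (Rlt_div_r _ _ _ Hpp)).
    assert (Hse : 0 < exp 1 * INR s) by (apply Rmult_lt_0_compat; lra).
    apply (Rmult_lt_reg_r (exp 1 * INR s)); [exact Hse|].
    apply (proj1 (Rle_div_l _ _ _ He)) in Hqp.
    assert (HP := Rabs_pos H).
    assert (Hf : H' * INR p < q * INR p) by (apply Rmult_lt_compat_r; auto).
    unfold H' in Hf.
    assert (0 < exp 1 * INR s * INR p) by (apply Rmult_lt_0_compat; auto).
    lra.
Qed.

(** * Real and complex-valued functions *)

Lemma is_derive_pair (f g : R -> R) x (df dg : R) :
  is_derive f x df -> is_derive g x dg ->
  is_derive (fun t => (f t, g t) : C) x (df, dg).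
Proof.
  intros Hf Hg.
  apply (filterdiff_comp'_2 f g (fun u v => (u, v)) x (fun y => scal y df) (fun y => scal y dg)
    (fun u v => (u, v)) Hf Hg).
  apply (filterdiff_ext_lin _ (fun t => t)); [|intros [u v]; reflexivity].
  apply (filterdiff_ext (fun t => t)); [intros [u v]; reflexivity|].
  apply filterdiff_id.
Qed.

Lemma is_derive_Re (f : R -> C) x l : is_derive f x l -> is_derive (fun t => Re (f t)) x (Re l).
Proof.
  intros H; apply (filterdiff_comp' f fst x (fun y : R => scal y l) fst H).
  apply filterdiff_linear, is_linear_fst.
Qed.

Lemma RCDerive_n_pair F G n x : tower F -> tower G ->
  RCDerive_n (fun t => (F 0%nat t, G 0%nat t)) n x = (F n x, G n x).
Proof.
  intros HF HG; revert x; induction n as [|n IH]; intros x; [reflexivity|].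
  simpl; unfold RCDerive; f_equal; apply is_derive_unique.
  - apply (is_derive_ext (F n)); [intros t; rewrite IH; reflexivity|apply HF].
  - apply (is_derive_ext (G n)); [intros t; rewrite IH; reflexivity|apply HG].
Qed.

Lemma Re_tower f : smooth f -> tower (fun n x => Re (RCDerive_n f n x)).
Proof. intros H n x; apply is_derive_Re, RCDerive_correct, H. Qed.

Lemma D_Beurling_Re r N f : (forall n, 0 < N n) -> D_Beurling r N f ->
  RD_Beurling r N (fun n x => Re (RCDerive_n f n x)).
Proof.
  intros HN [H1 [H2 [H3 H4]]]; split; [apply Re_tower, H1|split; [|split]].
  - intros x Hx; simpl; destruct (classic (f x = RtoC 0)) as [E|E]; [rewrite E; reflexivity|].
    exfalso; assert (Q : -1 <= x <= 1); [|apply Rabs_le in Q; lra].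
    apply H2; intros V [d Hd]; exists x; split; [|exact E].
    apply Hd; unfold disc; rewrite Rminus_diag, Rabs_R0; apply cond_pos.
  - intros n j Hj; rewrite H3 by exact Hj; reflexivity.
  - intros h Hh; destruct (H4 h Hh) as [A HA]; exists A; intros n x.
    eapply Rle_trans; [apply re_le_Cmod|].
    apply (Rle_div_l (Cmod (RCDerive_n f (r * n) x))); [|apply HA].
    apply Rmult_lt_0_compat; [apply pow_lt; auto|auto].
Qed.

Lemma D_Beurling_pair r N F G : (forall n, 0 < N n) -> RD_Beurling r N F -> RD_Beurling r N G ->
  D_Beurling r N (fun t => (F 0%nat t, G 0%nat t)).
Proof.
  intros HN [F1 [F2 [F3 F4]]] [G1 [G2 [G3 G4]]]; split; [|split; [|split]].
  - intros n x; exists (F (S n) x, G (S n) x).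
    apply (is_derive_ext (fun t => (F n t, G n t) : C)).
    + intros t; symmetry; apply RCDerive_n_pair; auto.
    + apply is_derive_pair; [apply F1|apply G1].
  - intros x Hx; apply Rabs_le_between, Rnot_lt_le; intros Hlt.
    destruct (Hx (fun y => 1 < Rabs y)) as [y [Hy1 Hy2]].
    + assert (Hd : 0 < Rabs x - 1) by lra.
      exists (mkposreal _ Hd); intros y Hy; unfold disc in Hy; simpl in Hy.
      assert (T := Rabs_triang_inv x y); rewrite Rabs_minus_sym in Hy; lra.
    + apply Hy2; rewrite F2, G2 by exact Hy1; reflexivity.
  - intros n j Hj; rewrite RCDerive_n_pair, F3, G3 by auto; reflexivity.
  - intros h Hh; destruct (F4 h Hh) as [A HA]; destruct (G4 h Hh) as [B HB].
    exists (A + B); intros n x; rewrite RCDerive_n_pair by auto.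
    specialize (HA n x); specialize (HB n x).
    apply (proj2 (Rle_div_l _ _ _ ltac:(apply Rmult_lt_0_compat; [apply (pow_lt h n Hh)|apply HN]))).
    replace (F (r * n)%nat x, G (r * n)%nat x) with
      (Cplus (RtoC (F (r * n)%nat x)) (Cmult Ci (RtoC (G (r * n)%nat x))))
      by (apply injective_projections; simpl; ring).
    eapply Rle_trans; [apply Cmod_triangle|].
    rewrite Cmod_mult, !Cmod_R.
    replace (Cmod Ci) with 1; [lra|].
    unfold Cmod, Ci; rewrite <- sqrt_1 at 1; f_equal; simpl; ring.
Qed.

(** Taking real parts preserves the function class; conversely the real and imaginary parts of a
    sequence are realised separately and paired. *)
Lemma Borel_real_complex r M N : (forall p, 0 < M p) -> (forall p, 0 < N p) ->
  (forall a : nat -> C, Lambda_Beurling M a ->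
    exists f : R -> C, D_Beurling r N f /\ forall j : nat, a j = RCDerive_n f (r * j) 0)
  <-> RBorel r M N.
Proof.
  intros HM HN.
  assert (Hhp : forall h p, 0 < h -> 0 < h ^ p * M p)
    by (intros; apply Rmult_lt_0_compat; [apply pow_lt|]; auto).
  split; intros H a Ha.
  - destruct (H (fun p => RtoC (a p))) as [f [Hf Hj]].
    { intros h Hh; destruct (Ha h Hh) as [A HA]; exists A; intros p.
      rewrite Cmod_R; apply (proj2 (Rle_div_l _ _ _ (Hhp h p Hh))), HA. }
    exists (fun n x => Re (RCDerive_n f n x)); split; [apply D_Beurling_Re; auto|].
    intros j; rewrite <- Hj; reflexivity.
  - assert (Hpart : forall b : nat -> R, (forall p, Rabs (b p) <= Cmod (a p)) -> RLambda M b).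
    { intros b Hb h Hh; destruct (Ha h Hh) as [A HA]; exists A; intros p.
      eapply Rle_trans; [apply Hb|]; apply (Rle_div_l _ _ _ (Hhp h p Hh)), HA. }
    destruct (H (fun p => Re (a p))) as [F [HF EF]]; [apply Hpart; intros; apply re_le_Cmod|].
    destruct (H (fun p => Im (a p))) as [G [HG EG]].
    { apply Hpart; intros p; eapply Rle_trans; [apply Rmax_r|apply (Rmax_Cmod (a p))]. }
    exists (fun t => (F 0%nat t, G 0%nat t)); split; [apply D_Beurling_pair; auto|].
    intros j; rewrite RCDerive_n_pair, EF, EG by (apply HF || apply HG).
    destruct (a j); reflexivity.
Qed.

Theorem theorem4p2 (r : nat) (hr : (1 <= r)%nat) (M N : nat -> R)
  (hM : LC M) (hN : LC N)
  (hMr : is_lim_seq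
    (fun p => Rpower (Rpower (M p) (1 / INR r) / INR (fact p)) (1 / INR p))
    p_infty)
  (hMN : exists C0 : R, 1 <= C0 /\ forall p : nat, M p <= C0 ^ p * N p) :
  (forall a : nat -> C, Lambda_Beurling M a ->
    exists f : R -> C, D_Beurling r N f /\
      forall j : nat, a j = RCDerive_n f (r * j) 0)
  <-> SV r M N.
Proof.
  rewrite Borel_real_complex by (apply hM || apply hN); split.
  - apply necessity; auto.
  - apply sufficiency; auto.
Qed.
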